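(* Let $K$ be a field, and for $i\in\{1,2\}$ let $n_i\ge1$ and let $\Lambda_i$ be an $n_i$-representation infinite $K$-algebra with Jacobson radical $J_i$. If $\Lambda_1/J_1\otimes_K\Lambda_2/J_2$ is semisimple, then $\Lambda_1\otimes_K\Lambda_2$ is an $(n_1+n_2)$-representation infinite algebra.
   Context: $D=\operatorname{Hom}_K(-,K)$; modules are left modules. For a finite dimensional $K$-algebra $\Lambda$ with $\operatorname{gl.dim}\Lambda\le n$, let $\nu=D\mathbf{R}\operatorname{Hom}_\Lambda(-,\Lambda)$ on $\mathsf{D}^{b}(\mathsf{mod}\,\Lambda)$ (an autoequivalence) and $\nu_n:=\nu\circ[-n]$. A finite dimensional algebra $\Lambda$ is $n$-representation infinite if $\operatorname{gl.dim}\Lambda\le n$ and $\nu_n^{-i}(\Lambda)\in\mathsf{mod}\,\Lambda$ (i.e. has cohomology concentrated in degree $0$) for all $i\ge0$. *)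

(* Defs.v *)
From HB Require Import structures.
From mathcomp Require Import all_boot all_order all_algebra.
From mathcomp Require Import falgebra.
From mathcomp Require Import boolp.

Set Implicit Arguments.
Unset Strict Implicit.
Unset Printing Implicit Defensive.

Import GRing.Theory.
Local Open Scope ring_scope.

(* A nonzero finite-dimensional unital K-algebra is a falgType K. In mod A,   *)
(* the category of finite-dimensional left A-modules, gl.dim A is the         *)
(* supremum of the projective dimensions. The derived category D^b(mod A)     *)
(* enters only through its objects (bounded complexes) and the relation of    *)
(* being isomorphic in it; functors on it are given by their graphs up to     *)
(* isomorphism: is_nu X Y means Y ~ D RHom_A(X, A), is_nu_n n X Y means       *)
(* Y ~ nu(X[-n]), and is_nu_n_invpow n i X Y means Y ~ nu_n^{-i}(X).          *)

Section TensorAlgebra.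

Variables (K : fieldType) (A B : falgType K).

(* Coordinates with respect to the tensor product of two fixed bases. *)
Definition tens : Type := 'M[K]_(\dim {:A}, \dim {:B}).

HB.instance Definition _ := Vector.copy tens 'M[K]_(\dim {:A}, \dim {:B}).

Let e (i : 'I_(\dim {:A})) : A := (vbasis {:A})`_i.
Let f (j : 'I_(\dim {:B})) : B := (vbasis {:B})`_j.

Definition pure (a : A) (b : B) : tens :=
  \matrix_(i, j) (coord (vbasis {:A}) i a * coord (vbasis {:B}) j b).

Definition tlift (V : lmodType K) (h : A -> B -> V) (t : tens) : V :=
  \sum_i \sum_j t i j *: h (e i) (f j).

Lemma pure_linearl b : linear (pure^~ b).
Proof. by move=> k x y; apply/matrixP => i j; rewrite !mxE linearP mulrDl mulrA. Qed.

Lemma pure_linearr a : linear (pure a).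
Proof.
by move=> k x y; apply/matrixP => i j; rewrite !mxE linearP mulrDr mulrCA.
Qed.

Lemma tlift_linear (V : lmodType K) (h : A -> B -> V) : linear (tlift h).
Proof.
move=> k s t; rewrite /tlift scaler_sumr -big_split; apply: eq_bigr => i _.
rewrite scaler_sumr -big_split; apply: eq_bigr => j _.
by rewrite !mxE scalerDl scalerA.
Qed.

Lemma tlift_pure (V : lmodType K) (h : A -> B -> V) :
  (forall b, linear (h^~ b)) -> (forall a, linear (h a)) ->
  forall a b, tlift h (pure a b) = h a b.
Proof.
move=> hl hr a b.
pose hL b : {linear A -> V} :=
  HB.pack (h^~ b) (GRing.isLinear.Build K A V _ _ (hl b)).
pose hR a : {linear B -> V} :=
  HB.pack (h a) (GRing.isLinear.Build K B V _ _ (hr a)).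
rewrite [in RHS](coord_vbasis (memvf a)) -[h _ b]/(hL b _) linear_sum.
apply: eq_bigr => i _; rewrite linearZ.
rewrite [in RHS](coord_vbasis (memvf b)) /= -[h _ _ in RHS]/(hR (e i) _).
rewrite linear_sum scaler_sumr; apply: eq_bigr => j _.
by rewrite mxE linearZ scalerA.
Qed.

Lemma tens_pureE (t : tens) : t = tlift pure t.
Proof.
rewrite /tlift; apply/matrixP => i j.
rewrite summxE (bigD1 i) //= summxE (bigD1 j) //= !mxE.
have freeA := basis_free (vbasisP {:A}); have freeB := basis_free (vbasisP {:B}).
rewrite !coord_free // !eqxx !mulr1 !big1 ?addr0 // => [k nk|l nl].
  rewrite summxE big1 // => l _; rewrite !mxE !coord_free //.
  by rewrite (negbTE nk) mul0r mulr0.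
by rewrite !mxE !coord_free // eqxx (negbTE nl) !mulr0.
Qed.

Lemma tens_ext (V : lmodType K) (g h : tens -> V) : linear g -> linear h ->
  (forall a b, g (pure a b) = h (pure a b)) -> g =1 h.
Proof.
move=> gl hl gh t.
pose gL : {linear tens -> V} := HB.pack g (GRing.isLinear.Build K tens V _ _ gl).
pose hL : {linear tens -> V} := HB.pack h (GRing.isLinear.Build K tens V _ _ hl).
rewrite (tens_pureE t) -[g _]/(gL _) -[h _]/(hL _) /tlift !linear_sum.
apply: eq_bigr => i _; rewrite !linear_sum; apply: eq_bigr => j _.
by rewrite !linearZ /= gh.
Qed.

Definition tens_mul (s t : tens) : tens :=
  tlift (fun a b => tlift (fun c d => pure (a * c) (b * d)) t) s.

Definition tens_one : tens := pure 1 1.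

Lemma tens_mul_linearl t : linear (tens_mul^~ t).
Proof. exact: tlift_linear. Qed.

Lemma tens_mul_linearr s : linear (tens_mul s).
Proof.
move=> k t u; rewrite /tens_mul {1 3 5}/tlift scaler_sumr -big_split.
apply: eq_bigr => i _; rewrite scaler_sumr -big_split; apply: eq_bigr => j _.
by rewrite tlift_linear scalerDr !scalerA mulrC.
Qed.

Lemma tens_mul_pure a b c d :
  tens_mul (pure a b) (pure c d) = pure (a * c) (b * d).
Proof.
have inner a' b' : tlift (fun c d => pure (a' * c) (b' * d)) (pure c d)
                   = pure (a' * c) (b' * d).
  apply: (tlift_pure (h := fun c d => pure (a' * c) (b' * d))) => [d'|c'] k x y.
    by rewrite mulrDr -scalerAr pure_linearl.
  by rewrite mulrDr -scalerAr pure_linearr.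
rewrite /tens_mul tlift_pure ?inner // => [b'|a'] k x y; rewrite !inner.
  by rewrite mulrDl -scalerAl pure_linearl.
by rewrite mulrDl -scalerAl pure_linearr.
Qed.

Lemma tens_mulA : associative tens_mul.
Proof.
move=> s t u; move: s; apply: tens_ext => [||a b].
- exact: tens_mul_linearl.
- by move=> k x y; rewrite !tens_mul_linearl.
move: t; apply: tens_ext => [||c d].
- by move=> k x y; rewrite tens_mul_linearl tens_mul_linearr.
- by move=> k x y; rewrite tens_mul_linearr tens_mul_linearl.
move: u; apply: tens_ext => [||c' d'].
- by move=> k x y; rewrite !tens_mul_linearr.
- exact: tens_mul_linearr.
by rewrite !tens_mul_pure !mulrA.
Qed.

Lemma tens_mul1l : left_id tens_one tens_mul.
Proof.
apply: tens_ext => [||a b]; [exact: tens_mul_linearr | by [] |].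
by rewrite tens_mul_pure !mul1r.
Qed.

Lemma tens_mul1r : right_id tens_one tens_mul.
Proof.
apply: tens_ext => [||a b]; [exact: tens_mul_linearl | by [] |].
by rewrite tens_mul_pure !mulr1.
Qed.

Lemma tens_mulDl : left_distributive tens_mul +%R.
Proof.
by move=> x y t; have := tens_mul_linearl t 1 x y; rewrite !scale1r.
Qed.

Lemma tens_mulDr : right_distributive tens_mul +%R.
Proof.
by move=> t x y; have := tens_mul_linearr t 1 x y; rewrite !scale1r.
Qed.

Lemma tens_one_neq0 : tens_one != 0.
Proof.
have coord1 (C : falgType K) : exists i, coord (vbasis {:C}) i 1 != 0.
  apply/existsP; apply: contraT; rewrite negb_exists => /forallP c0.
  have /eqP[] := oner_neq0 C; rewrite (coord_vbasis (memvf 1)) big1 // => i _.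
  by move/negPn/eqP: (c0 i) => ->; rewrite scale0r.
have [[i ai] [j bj]] := (coord1 A, coord1 B).
apply/eqP => /matrixP/(_ i j); rewrite !mxE => /eqP.
by rewrite mulf_eq0 (negbTE ai) (negbTE bj).
Qed.

HB.instance Definition _ := GRing.Zmodule_isNzRing.Build tens
  tens_mulA tens_mul1l tens_mul1r tens_mulDl tens_mulDr tens_one_neq0.

Lemma tens_scaleAl (k : K) (s t : tens) : k *: (s * t) = (k *: s) * t.
Proof.
have := tens_mul_linearl t k s 0; rewrite -[tens_mul]/(@GRing.mul tens) /=.
by rewrite mul0r !addr0.
Qed.

HB.instance Definition _ := GRing.Lmodule_isLalgebra.Build K tens tens_scaleAl.

Lemma tens_scaleAr (k : K) (s t : tens) : k *: (s * t) = s * (k *: t).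
Proof.
have := tens_mul_linearr s k t 0; rewrite -[tens_mul]/(@GRing.mul tens) /=.
by rewrite mulr0 !addr0.
Qed.

HB.instance Definition _ := GRing.Lalgebra_isAlgebra.Build K tens tens_scaleAr.
HB.instance Definition _ := Algebra_isFalgebra.Build K tens.

Lemma pureM a b c d : pure a b * pure c d = pure (a * c) (b * d).
Proof. exact: tens_mul_pure. Qed.

Lemma pure1 : pure 1 1 = 1.
Proof. by []. Qed.

End TensorAlgebra.

Section Quotient.

Variables (K : fieldType) (A : falgType K).

Record tsideal := TSIdeal {
  ts_space :> {vspace A};
  ts_mull : forall a x, x \in ts_space -> a * x \in ts_space;
  ts_mulr : forall a x, x \in ts_space -> x * a \in ts_space;
  ts_proper : 1 \notin ts_space
}.

Variable I : tsideal.

(* A / I is carried by a linear complement of I; the multiplication is that   *)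
(* of A followed by the projection along I.                                   *)
Definition quo : Type := subvs_of (I^C)%VS.

HB.instance Definition _ := Vector.copy quo (subvs_of (I^C)%VS).

Definition quo_repr (x : quo) : A := vsval x.
Definition quo_pi (a : A) : quo := vsproj (I^C)%VS (daddv_pi (I^C)%VS I a).

Lemma quo_pi_linear : linear quo_pi.
Proof. by move=> k x y; rewrite /quo_pi !linearP. Qed.

HB.instance Definition _ := GRing.isLinear.Build K A quo _ quo_pi quo_pi_linear.

Lemma quo_piZ k a : quo_pi (k *: a) = k *: quo_pi a.
Proof. exact: linearZ. Qed.

Let capCI : (I^C :&: I)%VS = 0%VS.
Proof. by rewrite capvC capv_compl. Qed.

Lemma quo_reprK : cancel quo_repr quo_pi.
Proof. by move=> x; rewrite /quo_pi daddv_pi_id ?subvsP // vsvalK. Qed.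

Lemma quo_pi_repr a : a - quo_repr (quo_pi a) \in I.
Proof.
rewrite /quo_repr /quo_pi vsprojK ?memv_pi //.
have aIC : a \in (I^C + I)%VS by rewrite addvC addv_complf memvf.
by rewrite -{1}(daddv_pi_add capCI aIC) addrC addKr memv_pi.
Qed.

Lemma quo_pi_eq0 a : (quo_pi a == 0) = (a \in I).
Proof.
apply/eqP/idP => [pa0|aI].
  by have := quo_pi_repr a; rewrite pa0 subr0.
apply: val_inj; rewrite /= -[vsval _]/(quo_repr _).
have pC : quo_repr (quo_pi a) \in (I^C)%VS by apply: subvsP.
have pI : quo_repr (quo_pi a) \in I.
  by have := memvB aI (quo_pi_repr a); rewrite opprB addrC subrK.
by apply/eqP; rewrite -memv0 -capCI memv_cap pC pI.
Qed.

Lemma quo_pi_eq a b : (quo_pi a == quo_pi b) = (a - b \in I).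
Proof. by rewrite -subr_eq0 -linearB quo_pi_eq0. Qed.

Definition quo_mul (x y : quo) : quo := quo_pi (quo_repr x * quo_repr y).

Lemma quo_piM a b : quo_pi (a * b) = quo_mul (quo_pi a) (quo_pi b).
Proof.
apply/eqP; rewrite quo_pi_eq.
set a' := quo_repr _; set b' := quo_repr _.
have -> : a * b - a' * b' = (a - a') * b + a' * (b - b').
  by rewrite mulrBl mulrBr addrA subrK.
apply: memvD; [apply: ts_mulr | apply: ts_mull]; exact: quo_pi_repr.
Qed.

Lemma quo_mulA : associative quo_mul.
Proof.
move=> x y z; rewrite -(quo_reprK x) -(quo_reprK y) -(quo_reprK z).
by rewrite -!quo_piM mulrA.
Qed.

Lemma quo_mul1l : left_id (quo_pi 1) quo_mul.
Proof. by move=> x; rewrite -(quo_reprK x) -quo_piM mul1r. Qed.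

Lemma quo_mul1r : right_id (quo_pi 1) quo_mul.
Proof. by move=> x; rewrite -(quo_reprK x) -quo_piM mulr1. Qed.

Lemma quo_mulDl : left_distributive quo_mul +%R.
Proof.
move=> x y z; rewrite -(quo_reprK x) -(quo_reprK y) -(quo_reprK z).
by rewrite -linearD -!quo_piM mulrDl linearD.
Qed.

Lemma quo_mulDr : right_distributive quo_mul +%R.
Proof.
move=> x y z; rewrite -(quo_reprK x) -(quo_reprK y) -(quo_reprK z).
by rewrite -linearD -!quo_piM mulrDr linearD.
Qed.

Lemma quo_one_neq0 : quo_pi 1 != 0.
Proof. by rewrite quo_pi_eq0 ts_proper. Qed.

HB.instance Definition _ := GRing.Zmodule_isNzRing.Build quo
  quo_mulA quo_mul1l quo_mul1r quo_mulDl quo_mulDr quo_one_neq0.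

Lemma quo_scaleAl (k : K) (x y : quo) : k *: (x * y) = (k *: x) * y.
Proof.
change (k *: quo_mul x y = quo_mul (k *: x) y).
by rewrite -(quo_reprK x) -(quo_reprK y) -!quo_piM -!quo_piZ -quo_piM scalerAl.
Qed.

HB.instance Definition _ := GRing.Lmodule_isLalgebra.Build K quo quo_scaleAl.

Lemma quo_scaleAr (k : K) (x y : quo) : k *: (x * y) = x * (k *: y).
Proof.
change (k *: quo_mul x y = quo_mul x (k *: y)).
by rewrite -(quo_reprK x) -(quo_reprK y) -!quo_piM -!quo_piZ -quo_piM scalerAr.
Qed.

HB.instance Definition _ := GRing.Lalgebra_isAlgebra.Build K quo quo_scaleAr.
HB.instance Definition _ := Algebra_isFalgebra.Build K quo.

Lemma quo_pi_monoid_morphism : monoid_morphism quo_pi.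
Proof. by split=> // a b; apply: quo_piM. Qed.

HB.instance Definition _ :=
  GRing.isMonoidMorphism.Build A quo quo_pi quo_pi_monoid_morphism.

End Quotient.

Section Radical.

Variables (K : fieldType) (A : falgType K).
Implicit Types L : {vspace A}.

(* Every left ideal of the ring A is a K-subspace, since K acts through A.    *)
Definition left_ideal L := forall a x, x \in L -> a * x \in L.

Definition max_left_ideal L :=
  [/\ left_ideal L, L <> {:A}%VS &
      forall L', left_ideal L' -> (L <= L')%VS -> L' = L \/ L' = {:A}%VS].

Definition min_left_ideal L :=
  [/\ left_ideal L, L <> 0%VS &
      forall L', left_ideal L' -> (L' <= L)%VS -> L' = 0%VS \/ L' = L].

(* The regular left module is a direct sum of simple submodules. *)
Definition semisimple_alg :=
  exists (r : nat) (L : 'I_r -> {vspace A}),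
    [/\ forall i, min_left_ideal (L i),
        (\sum_i L i)%VS = {:A}%VS & directv (\sum_i L i)].

Lemma vcap_exists (P : {vspace A} -> Prop) :
  {J : {vspace A} | forall x, x \in J <-> (forall L, P L -> x \in L)}.
Proof.
apply: cid.
pose Q (d : nat) := `[< exists s : seq {vspace A},
  (forall L, L \in s -> P L) /\ \dim (\bigcap_(L <- s) L)%VS = d >].
have exQ : exists d, Q d.
  by exists (\dim {:A}); apply/asboolP; exists [::]; rewrite big_nil.
case: (ex_minnP exQ) => d /asboolP[s [sP sd]] dmin.
exists (\bigcap_(L <- s) L)%VS => x; split=> [xs L PL | xP].
  have: (\dim (\bigcap_(L' <- s) L')%VS <= \dim (\bigcap_(L' <- L :: s) L')%VS)%N.
    rewrite sd; apply: dmin; apply/asboolP; exists (L :: s); split=> // L'.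
    by rewrite inE => /orP[/eqP-> //|]; apply: sP.
  rewrite big_cons => le_s.
  have /eqP eq_s: (L :&: \bigcap_(L' <- s) L' == \bigcap_(L' <- s) L')%VS.
    by rewrite eqEdim capvSr le_s.
  by move: xs; rewrite -eq_s memv_cap => /andP[].
elim: s sP {sd} => [|L s IHs] sP; first by rewrite big_nil memvf.
rewrite big_cons memv_cap xP; last by apply: sP; rewrite mem_head.
by apply: IHs => L' L's; apply: sP; rewrite inE L's orbT.
Qed.

Definition jacobson_space : {vspace A} := sval (vcap_exists max_left_ideal).

Lemma jacobson_spaceP x :
  x \in jacobson_space <-> (forall L, max_left_ideal L -> x \in L).
Proof. exact: (svalP (vcap_exists max_left_ideal)). Qed.

Lemma left_ideal_full L : left_ideal L -> 1 \in L -> L = {:A}%VS.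
Proof.
move=> idL L1; apply/vspaceP => x; rewrite memvf.
by rewrite -[x]mulr1 idL.
Qed.

Lemma jacobson_mull a x : x \in jacobson_space -> a * x \in jacobson_space.
Proof.
move/jacobson_spaceP => Jx; apply/jacobson_spaceP => L mL.
by have [idL _ _] := mL; apply: idL; apply: Jx.
Qed.

Lemma jacobson_mulr a x : x \in jacobson_space -> x * a \in jacobson_space.
Proof.
move/jacobson_spaceP => Jx; apply/jacobson_spaceP => L mL.
have [idL ntL maxL] := mL.
have [aL|aNL] := boolP (a \in L); first exact: idL.
pose La : {vspace A} := (amulr a @^-1: L)%VS.
have memLa y : (y \in La) = (y * a \in L) by rewrite -memv_preim lfunE.
suff mLa : max_left_ideal La by rewrite -memLa; apply: Jx.
have idLa : left_ideal La by move=> b y; rewrite !memLa -mulrA; apply: idL.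
split=> // [LaT|L' idL' sLL'].
  by move: aNL; rewrite -[a]mul1r -memLa LaT memvf.
pose M : {vspace A} := (L + (amulr a @: L'))%VS.
have idM : left_ideal M.
  move=> b _ /memv_addP[u uL [_ /memv_imgP[v vL' ->] ->]].
  rewrite mulrDr lfunE /= mulrA; apply: memv_add; first exact: idL.
  by apply/memv_imgP; exists (b * v); rewrite ?lfunE ?idL'.
have inM y : y \in L' -> y * a \in M.
  move=> yL'; rewrite -[y * a]add0r; apply: memv_add; first exact: mem0v.
  by apply/memv_imgP; exists y; rewrite ?lfunE.
have [ML|MT] := maxL M idM (addvSl _ _).
  left; apply/eqP; rewrite eqEsubv sLL' andbT.
  by apply/subvP => y yL'; rewrite memLa -ML inM.
right; apply: left_ideal_full => //.
have : a \in M by rewrite MT memvf.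
move=> /memv_addP[u uL [_ /memv_imgP[v vL' ->] auv]].
rewrite lfunE /= in auv.
have : 1 - v \in L'.
  by apply: (subvP sLL'); rewrite memLa mulrBl mul1r {1}auv addrK.
by move=> /memvD/(_ vL'); rewrite subrK.
Qed.

Lemma max_left_ideal_exists : exists L, max_left_ideal L.
Proof.
pose Q (d : nat) := `[< exists L, [/\ left_ideal L, L <> {:A}%VS & \dim L = d] >].
have exQ : exists d, Q d.
  exists 0%N; apply/asboolP; exists 0%VS; split; last exact: dimv0.
    by move=> a x; rewrite !memv0 => /eqP->; rewrite mulr0.
  move=> AT; have := memvf (1 : A); rewrite -AT memv0.
  by rewrite oner_eq0.
have leQ d : Q d -> (d <= \dim {:A})%N.
  by move=> /asboolP[L [_ _ <-]]; apply: dimvS; apply: subvf.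
case: (ex_maxnP exQ leQ) => d /asboolP[L [idL ntL Ld]] dmax.
exists L; split=> // L' idL' sLL'.
have [-> | /eqP ntL'] := eqVneq L' {:A}%VS; [by right | left].
apply/esym/eqP; rewrite eqEdim sLL' Ld; apply: dmax.
by apply/asboolP; exists L'.
Qed.

Lemma jacobson_proper : 1 \notin jacobson_space.
Proof.
have [L mL] := max_left_ideal_exists; have [idL ntL _] := mL.
apply/negP => /jacobson_spaceP/(_ L mL)/(left_ideal_full idL).
exact: ntL.
Qed.

Definition jacobson : tsideal A :=
  TSIdeal jacobson_mull jacobson_mulr jacobson_proper.

End Radical.

Section Modules.

Variables (K : fieldType) (A : falgType K).

Record fdmod := FdMod {
  fdcar :> vectType K;
  fdact : {linear A -> 'End(fdcar)};
  fdact1 : forall x, fdact 1 x = x;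
  fdactM : forall a b x, fdact (a * b) x = fdact a (fdact b x)
}.

Definition alinear (M N : fdmod) (f : 'Hom(M, N)) :=
  forall a x, f (fdact M a x) = fdact N a (f x).

Definition projective (P : fdmod) :=
  forall (M N : fdmod) (p : 'Hom(M, N)) (f : 'Hom(P, N)),
    alinear p -> limg p = fullv -> alinear f ->
  exists2 g : 'Hom(P, M), alinear g & (p \o g)%VF = f.

Fact reg_act1 (x : A) : amull 1 x = x.
Proof. by rewrite lfunE /= mul1r. Qed.
Fact reg_actM (a b x : A) : amull (a * b) x = amull a (amull b x).
Proof. by rewrite !lfunE /= mulrA. Qed.

Definition regmod : fdmod :=
  @FdMod A (@amull K A) reg_act1 reg_actM.

Fact zero_act1 (x : 'rV[K]_0) : (\0 : {linear A -> 'End('rV[K]_0)}) 1 x = x.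
Proof. by rewrite !thinmx0. Qed.
Fact zero_actM a b (x : 'rV[K]_0) (h := (\0 : {linear A -> 'End('rV[K]_0)})) :
  h (a * b) x = h a (h b x).
Proof. by rewrite !thinmx0. Qed.

Definition zeromod : fdmod := FdMod zero_act1 zero_actM.

Section HomA.
Variables M N : fdmod.

Definition commut_at (f : 'Hom(M, N)) (a : A) : 'Hom(M, N) :=
  (f \o fdact M a)%VF - (fdact N a \o f)%VF.

Fact commut_at_linear f : linear (commut_at f).
Proof.
move=> k a b; apply/lfunP => x; rewrite /commut_at !linearP !lfun_simp /=.
by rewrite linearP scalerBr opprD addrACA.
Qed.
HB.instance Definition _ f :=
  GRing.isLinear.Build K A 'Hom(M, N) _ (commut_at f) (commut_at_linear f).

Definition commut (f : 'Hom(M, N)) : 'Hom(A, 'Hom(M, N)) := linfun (commut_at f).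

Fact commut_linear : linear commut.
Proof.
move=> k f g; apply/lfunP => a; apply/lfunP => x.
rewrite !lfun_simp /=.
by rewrite linearP scalerBr opprD addrACA.
Qed.
HB.instance Definition _ :=
  GRing.isLinear.Build K 'Hom(M, N) 'Hom(A, 'Hom(M, N)) _ commut commut_linear.

Definition homA : {vspace 'Hom(M, N)} := lker (linfun commut).

Lemma homAP f : f \in homA <-> alinear f.
Proof.
rewrite memv_ker lfunE; split=> [/eqP f0 a x | fA].
  move/lfunP/(_ a): f0; rewrite lfunE => /lfunP/(_ x).
  by rewrite /= /commut_at !lfun_simp => /eqP; rewrite subr_eq0 => /eqP.
apply/eqP/lfunP => a; rewrite lfunE; apply/lfunP => x.
by rewrite /= /commut_at !lfun_simp fA subrr.
Qed.
End HomA.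

(* The Nakayama functor D Hom_A(-, A): mod A -> mod A. The right action on    *)
(* Hom_A(M, A) is (g . a) x = g x * a, and (a . phi) g = phi (g . a).         *)
Section Nakayama.

Definition dualA (M : fdmod) : {vspace 'Hom(M, A)} := homA M regmod.

Lemma dualAP (M : fdmod) (f : 'Hom(M, A)) :
  f \in dualA M <-> forall a x, f (fdact M a x) = a * f x.
Proof.
have fE a x : fdact regmod a (f x) = a * f x by rewrite lfunE.
have [h1 h2] := @homAP M regmod f; split=> [/h1 fA a x | fA].
  by rewrite -fE -fA.
by apply: h2 => a x; rewrite fE -fA.
Qed.

Definition nu_car (M : fdmod) : vectType K := 'Hom(subvs_of (dualA M), K^o).

Definition hom_ract_fun (M : fdmod) (a : A) (g : subvs_of (dualA M)) :
    subvs_of (dualA M) :=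
  vsproj (dualA M) (amulr a \o vsval g)%VF.

Fact hom_ract_linear M a : linear (@hom_ract_fun M a).
Proof.
move=> k g h; rewrite /hom_ract_fun -linearP /=; congr (vsproj _ _).
by rewrite comp_lfunDr comp_lfunZr.
Qed.
HB.instance Definition _ M a := GRing.isLinear.Build K (subvs_of (dualA M))
  (subvs_of (dualA M)) _ (@hom_ract_fun M a) (@hom_ract_linear M a).

Definition hom_ract (M : fdmod) (a : A) : 'End(subvs_of (dualA M)) :=
  linfun (@hom_ract_fun M a).

Lemma hom_ractE M a g x : vsval (hom_ract M a g) x = vsval g x * a.
Proof.
rewrite lfunE /= vsprojK; first by rewrite lfunE /= lfunE.
apply/dualAP => b y; have /dualAP gA := subvsP g.
by rewrite !lfun_simp /= gA mulrA.
Qed.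

Definition nu_act (M : fdmod) (a : A) : 'End(nu_car M) :=
  linfun (fun phi : nu_car M => (phi \o hom_ract M a)%VF).

Fact nu_act_linear_subproof M a :
  linear (fun phi : nu_car M => (phi \o hom_ract M a)%VF : nu_car M).
Proof. by move=> k f g; rewrite comp_lfunDl comp_lfunZl. Qed.

Lemma nu_actE M a (phi : nu_car M) g : nu_act M a phi g = phi (hom_ract M a g).
Proof.
pose F : {linear nu_car M -> nu_car M} := HB.pack
  (fun phi : nu_car M => (phi \o hom_ract M a)%VF : nu_car M)
  (GRing.isLinear.Build K _ _ _ _ (@nu_act_linear_subproof M a)).
by rewrite /nu_act -[linfun _]/(linfun F) lfunE /= lfunE.
Qed.

Fact nu_act_linear M : linear (nu_act M).
Proof.
move=> k a b; apply/lfunP => phi; apply/lfunP => g.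
rewrite !lfun_simp !nu_actE -linearP; congr (phi _).
apply: subvs_inj; apply/lfunP => x.
rewrite linearP add_lfunE scale_lfunE !hom_ractE.
by rewrite mulrDr -scalerAr.
Qed.
HB.instance Definition _ M := GRing.isLinear.Build K A 'End(nu_car M) _
  (nu_act M) (@nu_act_linear M).

Fact nu_act1 M (phi : nu_car M) : nu_act M 1 phi = phi.
Proof.
apply/lfunP => g; rewrite nu_actE; congr (phi _).
by apply: subvs_inj; apply/lfunP => x; rewrite hom_ractE mulr1.
Qed.

Fact nu_actM M a b (phi : nu_car M) :
  nu_act M (a * b) phi = nu_act M a (nu_act M b phi).
Proof.
apply/lfunP => g; rewrite !nu_actE; congr (phi _).
by apply: subvs_inj; apply/lfunP => x; rewrite !hom_ractE mulrA.
Qed.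

Definition nu_mod (M : fdmod) : fdmod :=
  @FdMod (nu_car M) (nu_act M) (@nu_act1 M) (@nu_actM M).

(* Functoriality: (nu_map f phi) g = phi (g \o f). As nu_map is defined for   *)
(* every K-linear f, g \o f is projected to Hom_A(M, A); by precompE this has *)
(* no effect when f is A-linear, the only case in which nu_map is used.       *)
Variables M N : fdmod.

Definition precomp_fun (f : 'Hom(M, N)) (g : subvs_of (dualA N)) :
    subvs_of (dualA M) := vsproj (dualA M) (vsval g \o f)%VF.

Fact precomp_linear f : linear (precomp_fun f).
Proof.
move=> k g h; rewrite /precomp_fun -linearP /=; congr (vsproj _ _).
by rewrite comp_lfunDl comp_lfunZl.
Qed.
HB.instance Definition _ f := GRing.isLinear.Build K (subvs_of (dualA N))
  (subvs_of (dualA M)) _ (precomp_fun f) (precomp_linear f).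

Definition precomp (f : 'Hom(M, N)) : 'Hom(subvs_of (dualA N), subvs_of (dualA M)) :=
  linfun (precomp_fun f).

Lemma precompE f g : alinear f -> vsval (precomp f g) = (vsval g \o f)%VF.
Proof.
move=> fA; rewrite lfunE /= vsprojK //; apply/dualAP => a x.
by have /dualAP gA := subvsP g; rewrite !lfun_simp fA gA.
Qed.

Definition nu_map (f : 'Hom(M, N)) : 'Hom(nu_mod M, nu_mod N) :=
  linfun (fun phi : nu_car M => (phi \o precomp f)%VF : nu_car N).

Fact nu_map_linear_subproof f :
  linear (fun phi : nu_car M => (phi \o precomp f)%VF : nu_car N).
Proof. by move=> k phi psi; rewrite comp_lfunDl comp_lfunZl. Qed.

Lemma nu_mapE f (phi : nu_car M) g : (nu_map f phi : nu_car N) g = phi (precomp f g).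
Proof.
pose F : {linear nu_car M -> nu_car N} := HB.pack
  (fun phi : nu_car M => (phi \o precomp f)%VF : nu_car N)
  (GRing.isLinear.Build K _ _ _ _ (@nu_map_linear_subproof f)).
by rewrite /nu_map -[linfun _]/(linfun F) lfunE /= lfunE.
Qed.

Lemma nu_map_alinear f : alinear f -> alinear (nu_map f).
Proof.
move=> fA a phi; apply/lfunP => g; rewrite nu_mapE /= !nu_actE nu_mapE.
congr (phi _); apply: subvs_inj; apply/lfunP => x.
by rewrite hom_ractE !precompE // !comp_lfunE hom_ractE.
Qed.

End Nakayama.

Lemma nu_map0 (M N : fdmod) : nu_map (0 : 'Hom(M, N)) = 0.
Proof.
apply/lfunP => phi; apply/lfunP => g; rewrite nu_mapE !zero_lfunE.
rewrite -[RHS](linear0 phi); congr (phi _); apply: subvs_inj.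
rewrite precompE ?comp_lfun0r //.
by move=> a x; rewrite !zero_lfunE linear0.
Qed.

Lemma nu_map_comp (M N P : fdmod) (f : 'Hom(M, N)) (g : 'Hom(N, P)) :
  alinear f -> alinear g -> nu_map (g \o f)%VF = (nu_map g \o nu_map f)%VF.
Proof.
move=> fA gA; apply/lfunP => phi; apply/lfunP => h.
rewrite comp_lfunE !nu_mapE; congr (phi _); apply: subvs_inj.
rewrite !precompE ?comp_lfunA // => a x.
by rewrite !lfun_simp fA gA.
Qed.

Lemma nu_mod_dim0 (M : fdmod) : \dim {:M} = 0%N -> \dim {:nu_mod M} = 0%N.
Proof.
move=> M0; apply/eqP; rewrite dimv_eq0 -subv0; apply/subvP => phi _.
rewrite memv0; apply/eqP/lfunP => g; rewrite zero_lfunE.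
suff -> : g = 0 by rewrite linear0.
apply: subvs_inj; apply/lfunP => x.
have : x \in {:M}%VS by rewrite memvf.
have /eqP -> : {:M}%VS == 0%VS by rewrite -dimv_eq0 M0.
by rewrite memv0 => /eqP->; rewrite !linear0.
Qed.

End Modules.

Section Complexes.

Variables (K : fieldType) (A : falgType K).

(* diff i j is the differential X^i -> X^j when j = i + 1 and zero otherwise; *)
(* this avoids transports along equations between integers.                   *)
Record bcomplex := BComplex {
  cob :> int -> fdmod A;
  diff : forall i j, 'Hom(cob i, cob j);
  diff_alinear : forall i j, alinear (diff i j);
  diff_shape : forall i j, j != i + 1 -> diff i j = 0;
  diff_sq : forall i j k, (diff j k \o diff i j)%VF = 0;
  diff_bounded : exists b : nat, forall i, (b < absz i)%N -> \dim {:cob i} = 0%N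
}.

Definition cocycles (X : bcomplex) (i : int) : {vspace X i} := lker (diff X i (i + 1)).
Definition coboundaries (X : bcomplex) (i : int) : {vspace X i} :=
  limg (diff X (i - 1) i).

Definition exact_at (X : bcomplex) (i : int) :=
  (cocycles X i <= coboundaries X i)%VS.

(* The last two conditions say that H^i(f) is injective and surjective.       *)
Record quasi_iso (X Y : bcomplex) (f : forall i, 'Hom(X i, Y i)) : Prop :=
  QuasiIso {
    qi_alinear : forall i, alinear (f i);
    qi_chain : forall i j, (f j \o diff X i j)%VF = (diff Y i j \o f i)%VF;
    qi_inj : forall i x, x \in cocycles X i ->
      f i x \in coboundaries Y i -> x \in coboundaries X i;
    qi_surj : forall i y, y \in cocycles Y i ->
      exists2 x, x \in cocycles X i & y - f i x \in coboundaries Y i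
  }.

Definition qis (X Y : bcomplex) := exists f, @quasi_iso X Y f.

(* Isomorphisms of the derived category are the roofs X <- Z -> Y of          *)
(* quasi-isomorphisms.                                                        *)
Definition dbiso (X Y : bcomplex) := exists2 Z, qis Z X & qis Z Y.

Section Stalk.
Variable M : fdmod A.

Definition stalk_ob (i : int) : fdmod A := if i == 0 then M else zeromod A.

Fact stalk_alinear i j : alinear (0 : 'Hom(stalk_ob i, stalk_ob j)).
Proof. by move=> a x; rewrite !zero_lfunE linear0. Qed.
Fact stalk_sq i j k :
  ((0 : 'Hom(stalk_ob j, stalk_ob k)) \o (0 : 'Hom(stalk_ob i, stalk_ob j)))%VF
  = 0.
Proof. exact: comp_lfun0l. Qed.
Fact stalk_bounded :
  exists b : nat, forall i, (b < absz i)%N -> \dim {:stalk_ob i} = 0%N.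
Proof.
exists 0%N => i; rewrite absz_gt0 /stalk_ob => /negbTE ->.
by rewrite dimvf dim_matrix.
Qed.

Definition stalk : bcomplex :=
  BComplex stalk_alinear (fun _ _ _ => erefl) stalk_sq stalk_bounded.
End Stalk.

Section Shift.
Variables (X : bcomplex) (m : int).

Definition shift_d i j : 'Hom(X (i + m), X (j + m)) :=
  (-1) ^ m *: diff X (i + m) (j + m).

Fact shift_alinear i j : alinear (shift_d i j).
Proof. by move=> a x; rewrite !lfun_simp diff_alinear linearZ. Qed.
Fact shift_shape i j : j != i + 1 -> shift_d i j = 0.
Proof.
move=> ne; rewrite /shift_d diff_shape ?scaler0 //.
by rewrite addrAC (inj_eq (addIr m)).
Qed.
Fact shift_sq i j k : (shift_d j k \o shift_d i j)%VF = 0.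
Proof. by rewrite /shift_d -comp_lfunZl -comp_lfunZr diff_sq !scaler0. Qed.
Fact shift_bounded :
  exists b : nat, forall i, (b < absz i)%N -> \dim {:X (i + m)} = 0%N.
Proof.
have [b bX] := diff_bounded X; exists (b + absz m)%N => i bi; apply: bX.
have : (absz i <= absz (i + m)%R + absz m)%N.
  by have := leqD_dist (i + m) 0 m; rewrite addrK subr0 sub0r abszN.
by move=> /(leq_trans bi); rewrite ltn_add2r.
Qed.

Definition shift : bcomplex :=
  @BComplex (fun i => X (i + m)) shift_d
    shift_alinear shift_shape shift_sq shift_bounded.
End Shift.

Section NuComplex.
Variable X : bcomplex.

Fact nuc_alinear i j : alinear (nu_map (diff X i j)).
Proof. by apply: nu_map_alinear; apply: diff_alinear. Qed.
Fact nuc_shape i j : j != i + 1 -> nu_map (diff X i j) = 0.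
Proof. by move=> ne; rewrite diff_shape // nu_map0. Qed.
Fact nuc_sq i j k : (nu_map (diff X j k) \o nu_map (diff X i j))%VF = 0.
Proof. by rewrite -nu_map_comp ?diff_sq ?nu_map0 //; apply: diff_alinear. Qed.
Fact nuc_bounded :
  exists b : nat, forall i, (b < absz i)%N -> \dim {:nu_mod (X i)} = 0%N.
Proof. by have [b bX] := diff_bounded X; exists b => i /bX; apply: nu_mod_dim0. Qed.

Definition nu_complex : bcomplex :=
  @BComplex (fun i => nu_mod (X i)) (fun i j => nu_map (diff X i j))
    nuc_alinear nuc_shape nuc_sq nuc_bounded.
End NuComplex.

(* P -> M[0] is a quasi-isomorphism with P concentrated in degrees -n, ..., 0 *)
(* exactly when 0 -> P^{-n} -> ... -> P^0 -> M -> 0 is exact.                 *)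
Definition projdim_le (n : nat) (M : fdmod A) :=
  exists P : bcomplex,
    [/\ forall i, projective (P i),
        forall i : int, (i < - n%:Z) || (0 < i) -> \dim {:P i} = 0%N &
        qis P (stalk M)].

Definition gldim_le (n : nat) := forall M : fdmod A, projdim_le n M.

(* RHom_A(X, A) is computed on a projective resolution P of X, and            *)
(* D Hom_A(P, A) is the Nakayama functor applied to P degreewise.             *)
Definition is_nu (X Y : bcomplex) :=
  exists P : bcomplex,
    [/\ forall i, projective (P i), qis P X & dbiso (nu_complex P) Y].

Definition is_nu_n (n : nat) (X Y : bcomplex) := is_nu (shift X (- n%:Z)) Y.

(* When gl.dim A is finite nu_n is an autoequivalence, so that nu_n^{-1}(Z)   *)
(* is determined up to isomorphism by nu_n(nu_n^{-1}(Z)) ~ Z.                 *)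
Fixpoint is_nu_n_invpow (n i : nat) (X Y : bcomplex) : Prop :=
  if i is i'.+1 then exists2 Z, is_nu_n_invpow n i' X Z & is_nu_n n Y Z
  else dbiso X Y.

Definition rep_infinite (n : nat) :=
  gldim_le n /\
  forall i : nat, exists2 X : bcomplex,
    is_nu_n_invpow n i (stalk (regmod A)) X & forall j, j != 0 -> exact_at X j.

End Complexes.

(* Main.v *)
Require Import Defs.
From HB Require Import structures.
From mathcomp Require Import all_boot all_order all_algebra falgebra.
From mathcomp Require Import zify.
From mathcomp Require boolp.

Set Implicit Arguments.
Unset Strict Implicit.
Unset Printing Implicit Defensive.

Import GRing.Theory.
Local Open Scope ring_scope.

(** The proof works on complexes instead of the derived category. Write
    [Lambda = Lambda_1 (x) Lambda_2] and [n = n_1 + n_2].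

    The Nakayama functor. On bounded complexes one forms the total tensor product
    over [K] ([ctens]). Over the field [K] a quasi-isomorphism has an inverse up to
    homotopy ([qis_model_hequiv]: contract its cone), so tensor products of
    quasi-isomorphisms are quasi-isomorphisms ([ctens_qis]). Tensor products of
    projectives are projective ([tmod_projective]), and for projective modules a
    dual basis argument gives [Hom_A(M, A) (x) Hom_B(N, B) = Hom(M (x) N, A (x) B)]
    ([htens_surj]), whose dual is [nu M (x) nu N = nu (M (x) N)] ([nu_tens]). With
    the compatibility with shifts ([gtens_shift]) this shows that [nu_n] maps [X (x) Y] to
    [nu_n1 X (x) nu_n2 Y] ([is_nu_n_ctens]). If [X] and [Y] are [nu_n1^-i Lambda_1] and
    [nu_n2^-i Lambda_2], then [X (x) Y] is [nu_n^-i Lambda]; the chain of complexes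
    that witnesses this is the tensor product of the two given chains. Cohomology
    outside degree [0] vanishes by the Kuenneth theorem ([ctens_exact]).

    The global dimension. Let [omega M] be the kernel of [Lambda (x)_K M -> M]. It is
    an exact functor, and [M] has projective dimension at most [n] if and only if
    [omega^n M] is projective ([projective_projdim_le], [projdim_le_projective]).
    Hence this property passes to retracts and to extensions. The top
    [S = Lambda_1/J_1 (x) Lambda_2/J_2] has it, by the tensor product of two
    resolutions. A nonzero [Lambda]-module contains a nonzero element annihilated by
    [J_1] and [J_2] ([tens_socle]), so it contains a nonzero image of [S]
    ([top_map]); as [S] is a semisimple algebra this image is a retract of [S]
    ([top_image_retract]), and induction on the dimension concludes
    ([omega_top_projective]).

    To avoid transports between the terms of a complex, a complex is handled through
    its total module with the projections onto the homogeneous parts ([gcx],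
    [model]). *)

(** * Linear maps and tensor products of vector spaces *)

Section LinearMaps.

Variables (K : fieldType) (U V : vectType K).

Definition lin_of (f : U -> V) (lf : linear f) : 'Hom(U, V) :=
  linfun (HB.pack_for {linear U -> V} f (GRing.isLinear.Build K U V _ f lf)).

Lemma lin_ofE (f : U -> V) (lf : linear f) x : lin_of lf x = f x.
Proof. by rewrite lfunE. Qed.

End LinearMaps.

Section Tensor.

Variable K : fieldType.
Implicit Types U V W : vectType K.

(** With these coordinates [vtens A B] and [vpure] are, for algebras [A] and [B],
    convertible to [tens A B] and [pure]. *)
Definition vtens V W : vectType K := 'M[K]_(\dim {:V}, \dim {:W}).

Section Universal.
Variables V W : vectType K.

Let e (i : 'I_(\dim {:V})) : V := (vbasis {:V})`_i.
Let f (j : 'I_(\dim {:W})) : W := (vbasis {:W})`_j.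

Definition vpure (v : V) (w : W) : vtens V W :=
  \matrix_(i, j) (coord (vbasis {:V}) i v * coord (vbasis {:W}) j w).

Lemma vpure_linearl w : linear (vpure^~ w).
Proof. by move=> k x y; apply/matrixP => i j; rewrite !mxE linearP mulrDl mulrA. Qed.

Lemma vpure_linearr v : linear (vpure v).
Proof.
by move=> k x y; apply/matrixP => i j; rewrite !mxE linearP mulrDr mulrCA.
Qed.

Definition vlift (Z : lmodType K) (h : V -> W -> Z) (t : vtens V W) : Z :=
  \sum_i \sum_j t i j *: h (e i) (f j).

Lemma vlift_linear (Z : lmodType K) (h : V -> W -> Z) : linear (vlift h).
Proof.
move=> k s t; rewrite /vlift scaler_sumr -big_split; apply: eq_bigr => i _.
rewrite scaler_sumr -big_split; apply: eq_bigr => j _.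
by rewrite !mxE scalerDl scalerA.
Qed.

Lemma vlift_vpure (Z : lmodType K) (h : V -> W -> Z) :
  (forall w, linear (h^~ w)) -> (forall v, linear (h v)) ->
  forall v w, vlift h (vpure v w) = h v w.
Proof.
move=> hl hr v w.
pose hL w : {linear V -> Z} :=
  HB.pack (h^~ w) (GRing.isLinear.Build K V Z _ _ (hl w)).
pose hR v : {linear W -> Z} :=
  HB.pack (h v) (GRing.isLinear.Build K W Z _ _ (hr v)).
rewrite [in RHS](coord_vbasis (memvf v)) -[h _ w]/(hL w _) linear_sum.
apply: eq_bigr => i _; rewrite linearZ.
rewrite [in RHS](coord_vbasis (memvf w)) /= -[h _ _ in RHS]/(hR (e i) _).
rewrite linear_sum scaler_sumr; apply: eq_bigr => j _.
by rewrite mxE linearZ scalerA.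
Qed.

Lemma vpure_decomp (t : vtens V W) : t = vlift vpure t.
Proof.
rewrite /vlift; apply/matrixP => i j.
rewrite summxE (bigD1 i) //= summxE (bigD1 j) //= !mxE.
have frV := basis_free (vbasisP {:V}); have frW := basis_free (vbasisP {:W}).
rewrite !coord_free // !eqxx !mulr1 !big1 ?addr0 // => [k nk|l nl].
  rewrite summxE big1 // => l _; rewrite !mxE !coord_free //.
  by rewrite (negbTE nk) mul0r mulr0.
by rewrite !mxE !coord_free // eqxx (negbTE nl) !mulr0.
Qed.

Lemma vtens_ind (P : vtens V W -> Prop) :
  P 0 -> (forall k t s, P t -> P s -> P (k *: t + s)) ->
  (forall v w, P (vpure v w)) -> forall t, P t.
Proof.
move=> P0 Pl Pt t; rewrite (vpure_decomp t) /vlift; elim/big_ind: _ => //.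
  by move=> x y Px Py; rewrite -[x]scale1r; apply: Pl.
move=> i _; elim/big_ind: _ => //.
  by move=> x y Px Py; rewrite -[x]scale1r; apply: Pl.
by move=> j _; rewrite -[_ *: _]addr0; apply: Pl.
Qed.

Lemma vtens_ext (Z : lmodType K) (g h : vtens V W -> Z) : linear g -> linear h ->
  (forall v w, g (vpure v w) = h (vpure v w)) -> g =1 h.
Proof.
move=> gl hl gh; apply: vtens_ind => [|k t s|] //; last by rewrite gl hl => -> ->.
by have := gl (-1) 0 0; have := hl (-1) 0 0; rewrite !scaleN1r !addNr => -> ->.
Qed.

Lemma vtens_hom_ext (Z : vectType K) (g h : 'Hom(vtens V W, Z)) :
  (forall v w, g (vpure v w) = h (vpure v w)) -> g = h.
Proof. by move=> gh; apply/lfunP; apply: vtens_ext gh; apply: linearP. Qed.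

Definition vtens_lift (Z : vectType K) (h : V -> W -> Z) : 'Hom(vtens V W, Z) :=
  lin_of (vlift_linear h).

Lemma vtens_liftE (Z : vectType K) (h : V -> W -> Z) :
  (forall w, linear (h^~ w)) -> (forall v, linear (h v)) ->
  forall v w, vtens_lift h (vpure v w) = h v w.
Proof. by move=> hl hr v w; rewrite lin_ofE vlift_vpure. Qed.

Lemma vpureDl v v' w : vpure (v + v') w = vpure v w + vpure v' w.
Proof. by have := vpure_linearl w 1 v v'; rewrite !scale1r. Qed.
Lemma vpureDr v w w' : vpure v (w + w') = vpure v w + vpure v w'.
Proof. by have := vpure_linearr v 1 w w'; rewrite !scale1r. Qed.
Lemma vpure0l w : vpure 0 w = 0.
Proof. by have := vpure_linearl w (-1) 0 0; rewrite !scaleN1r !addNr. Qed.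
Lemma vpure0r v : vpure v 0 = 0.
Proof. by have := vpure_linearr v (-1) 0 0; rewrite !scaleN1r !addNr. Qed.
Lemma vpureZl k v w : vpure (k *: v) w = k *: vpure v w.
Proof. by have := vpure_linearl w k v 0; rewrite !addr0 vpure0l addr0. Qed.
Lemma vpureZr k v w : vpure v (k *: w) = k *: vpure v w.
Proof. by have := vpure_linearr v k w 0; rewrite !addr0 vpure0r addr0. Qed.
Lemma vpureNl v w : vpure (- v) w = - vpure v w.
Proof. by rewrite -scaleN1r vpureZl scaleN1r. Qed.
Lemma vpureNr v w : vpure v (- w) = - vpure v w.
Proof. by rewrite -scaleN1r vpureZr scaleN1r. Qed.
Lemma vpureBl v v' w : vpure (v - v') w = vpure v w - vpure v' w.
Proof. by rewrite vpureDl vpureNl. Qed.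
Lemma vpureBr v w w' : vpure v (w - w') = vpure v w - vpure v w'.
Proof. by rewrite vpureDr vpureNr. Qed.
Lemma vpure_suml (I : Type) (r : seq I) (P : pred I) (F : I -> V) w :
  vpure (\sum_(i <- r | P i) F i) w = \sum_(i <- r | P i) vpure (F i) w.
Proof. by apply: (big_morph (vpure^~ w)) => [x y|]; rewrite ?vpureDl ?vpure0l. Qed.
Lemma vpure_sumr (I : Type) (r : seq I) (P : pred I) v (F : I -> W) :
  vpure v (\sum_(i <- r | P i) F i) = \sum_(i <- r | P i) vpure v (F i).
Proof. by apply: (big_morph (vpure v)) => [x y|]; rewrite ?vpureDr ?vpure0r. Qed.

End Universal.

Definition vmap (V V' W W' : vectType K) (f : 'Hom(V, V')) (g : 'Hom(W, W')) :
    'Hom(vtens V W, vtens V' W') :=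
  vtens_lift (fun v w => vpure (f v) (g w)).

Lemma vmapE (V V' W W' : vectType K) (f : 'Hom(V, V')) (g : 'Hom(W, W')) v w :
  vmap f g (vpure v w) = vpure (f v) (g w).
Proof.
rewrite vtens_liftE // => [w'|v'] k x y.
  by rewrite linearP vpure_linearl.
by rewrite linearP vpure_linearr.
Qed.

Lemma vmap_comp (V V' V'' W W' W'' : vectType K)
    (f : 'Hom(V, V')) (f' : 'Hom(V', V'')) (g : 'Hom(W, W')) (g' : 'Hom(W', W'')) t :
  vmap f' g' (vmap f g t) = vmap (f' \o f)%VF (g' \o g)%VF t.
Proof.
rewrite -comp_lfunE; move: t; apply/lfunP; apply: vtens_hom_ext => v w.
by rewrite comp_lfunE !vmapE !comp_lfunE.
Qed.

Lemma vmap_id (V W : vectType K) t : vmap (\1%VF : 'End(V)) (\1%VF : 'End(W)) t = t.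
Proof.
rewrite -[RHS]id_lfunE; move: t; apply/lfunP; apply: vtens_hom_ext => v w.
by rewrite vmapE !id_lfunE.
Qed.

(** Separating families of functionals on the factors separate the tensor
    product: contracting with a functional on the second factor gives a vector
    of the first one, and the vanishing of all these vectors can be read
    coordinate by coordinate. *)
Lemma vtens_sep (V W : vectType K) (X Y : Type)
    (al : X -> 'Hom(V, K^o)) (be : Y -> 'Hom(W, K^o)) :
  (forall v, (forall x, al x v = 0) -> v = 0) ->
  (forall w, (forall y, be y w = 0) -> w = 0) ->
  forall t, (forall x y, vtens_lift (fun v w => (al x v : K^o) * be y w : K^o) t = 0) ->
  t = 0.
Proof.
move=> alP beP t t0.
pose vy y := \sum_i \sum_j (t i j * be y (vbasis {:W})`_j) *: (vbasis {:V})`_i.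
have vy0 y : vy y = 0.
  apply: alP => x; rewrite -[RHS](t0 x y) lin_ofE /vlift /vy linear_sum.
  apply: eq_bigr => i _; rewrite linear_sum; apply: eq_bigr => j _.
  by rewrite linearZ /= /GRing.scale /= mulrAC mulrA.
have frV := basis_free (vbasisP {:V}); have frW := basis_free (vbasisP {:W}).
have row0 i : \sum_j t i j *: (vbasis {:W})`_j = 0.
  apply: beP => y; rewrite linear_sum.
  have /(congr1 (coord (vbasis {:V}) i)) := vy0 y.
  rewrite linear0 linear_sum (bigD1 i) //= [X in _ + X]big1 => [|k ki]; last first.
    rewrite linear_sum big1 // => j _; rewrite linearZ /= coord_free //.
    by rewrite (negbTE ki) mulr0.
  rewrite addr0 linear_sum => {2}<-; apply: eq_bigr => j _.
  by rewrite !linearZ /= coord_free // eqxx mulr1.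
apply/matrixP => i j; rewrite mxE.
have /(congr1 (coord (vbasis {:W}) j)) := row0 i.
rewrite linear0 linear_sum (bigD1 j) //= [X in _ + X]big1 => [|k ki]; last first.
  by rewrite linearZ /= coord_free // (negbTE ki) mulr0.
by rewrite addr0 linearZ /= coord_free // eqxx mulr1.
Qed.

End Tensor.

(** * Finite dimensional modules *)

Section ModuleConstruction.

Variables (K : fieldType) (A : falgType K) (V : vectType K) (act : A -> V -> V).
Hypothesis act_linear : forall a, linear (act a).
Hypothesis act_linearl : forall x, linear (act^~ x).
Hypothesis act_1 : forall x, act 1 x = x.
Hypothesis act_M : forall a b x, act (a * b) x = act a (act b x).

Definition mkact (a : A) : 'End(V) := lin_of (act_linear a).

Fact mkact_linear : linear mkact.
Proof.
by move=> k a b; apply/lfunP => x; rewrite add_lfunE scale_lfunE !lin_ofE act_linearl.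
Qed.

Fact mkact1 x : (HB.pack_for {linear A -> 'End(V)} mkact
  (GRing.isLinear.Build K A 'End(V) _ mkact mkact_linear)) 1 x = x.
Proof. by rewrite /= /mkact lin_ofE act_1. Qed.

Fact mkactM a b x (h := HB.pack_for {linear A -> 'End(V)} mkact
    (GRing.isLinear.Build K A 'End(V) _ mkact mkact_linear)) :
  h (a * b) x = h a (h b x).
Proof. by rewrite /= /mkact !lin_ofE act_M. Qed.

Definition mkmod : fdmod A := FdMod mkact1 mkactM.

Lemma mkmodE a x : fdact mkmod a x = act a x.
Proof. exact: lin_ofE. Qed.

End ModuleConstruction.

Section Submodules.

Variables (K : fieldType) (A : falgType K).
Implicit Types M N P : fdmod A.

Definition stable M (U : {vspace M}) := forall a x, x \in U -> fdact M a x \in U.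

Lemma alinear_comp M N P (f : 'Hom(M, N)) (g : 'Hom(N, P)) :
  alinear f -> alinear g -> alinear (g \o f)%VF.
Proof. by move=> fA gA a x; rewrite !comp_lfunE fA gA. Qed.

Lemma alinear_id M : @alinear K A M M \1%VF.
Proof. by move=> a x; rewrite !id_lfunE. Qed.

Lemma stable_lker M N (f : 'Hom(M, N)) : alinear f -> stable (lker f).
Proof. by move=> fA a x; rewrite !memv_ker fA => /eqP->; rewrite linear0. Qed.

Lemma stable_limg M N (f : 'Hom(M, N)) : alinear f -> stable (limg f).
Proof.
by move=> fA a _ /memv_imgP[x _ ->]; rewrite -fA memv_img ?memvf.
Qed.

Section Submodule.
Variables (M : fdmod A) (U : {vspace M}) (sU : stable U).

Let act a (u : subvs_of U) : subvs_of U := vsproj U (fdact M a (vsval u)).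

Let actE a u : vsval (act a u) = fdact M a (vsval u).
Proof. by rewrite vsprojK // sU // subvsP. Qed.

Fact submod_linear a : linear (act a).
Proof. by move=> k x y; apply: val_inj; rewrite /= !actE !linearP. Qed.
Fact submod_linearl x : linear (act^~ x).
Proof.
by move=> k a b; apply: val_inj; rewrite /= !actE linearP add_lfunE scale_lfunE.
Qed.
Fact submod1 x : act 1 x = x.
Proof. by apply: val_inj; rewrite /= actE fdact1. Qed.
Fact submodM a b x : act (a * b) x = act a (act b x).
Proof. by apply: val_inj; rewrite /= !actE fdactM. Qed.

Definition submod : fdmod A :=
  mkmod submod_linear submod_linearl submod1 submodM.

Definition sincl : 'Hom(submod, M) := linfun (vsval : subvs_of U -> M).
Definition sproj : 'Hom(M, submod) := linfun (vsproj U : M -> subvs_of U).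

Lemma sinclE (x : submod) : sincl x = vsval (x : subvs_of U).
Proof. by rewrite lfunE. Qed.

Lemma sincl_inj : injective sincl.
Proof. by move=> x y; rewrite !sinclE; apply: subvs_inj. Qed.

Lemma sincl_mem x : sincl x \in U.
Proof. by rewrite sinclE subvsP. Qed.

Lemma sprojK x : x \in U -> sincl (sproj x) = x.
Proof. by move=> xU; rewrite sinclE lfunE /= vsprojK. Qed.

Lemma sincl_alinear : alinear sincl.
Proof. by move=> a x; rewrite !sinclE mkmodE actE. Qed.

Lemma sproj_act a x : x \in U -> sproj (fdact M a x) = fdact submod a (sproj x).
Proof.
by move=> xU; apply: sincl_inj; rewrite sincl_alinear !sprojK // sU.
Qed.

End Submodule.

Section Quotient.
Variables (M : fdmod A) (U : {vspace M}) (sU : stable U).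

Let C := (U^C)%VS.
Let pr : 'End(M) := daddv_pi C U.

Let capCU : (C :&: U)%VS = 0%VS.
Proof. by rewrite capvC capv_compl. Qed.

Let pr_mem x : pr x \in C.
Proof. exact: memv_pi. Qed.

Let pr_sub x : x - pr x \in U.
Proof.
have xCU : x \in (C + U)%VS by rewrite addvC addv_complf memvf.
by rewrite -{1}(daddv_pi_add capCU xCU) addrC addKr memv_pi.
Qed.

Let pr_id x : x \in C -> pr x = x.
Proof. exact: daddv_pi_id. Qed.

Let pr_eq0 x : (pr x == 0) = (x \in U).
Proof.
apply/eqP/idP => [p0 | xU]; first by have := pr_sub x; rewrite p0 subr0.
apply/eqP; rewrite -memv0 -capCU memv_cap pr_mem /=.
by have := memvB xU (pr_sub x); rewrite opprB addrC subrK.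
Qed.

Let act a (u : subvs_of C) : subvs_of C := vsproj C (pr (fdact M a (vsval u))).

Let actE a u : vsval (act a u) = pr (fdact M a (vsval u)).
Proof. by rewrite vsprojK. Qed.

Fact qmod_linear a : linear (act a).
Proof. by move=> k x y; apply: val_inj; rewrite /= !actE !linearP. Qed.
Fact qmod_linearl x : linear (act^~ x).
Proof.
move=> k a b; apply: val_inj.
by rewrite /= !actE linearP add_lfunE scale_lfunE linearP.
Qed.
Fact qmod1 x : act 1 x = x.
Proof. by apply: val_inj; rewrite /= actE fdact1 pr_id ?subvsP. Qed.

Let pr_act a x : pr (fdact M a (pr x)) = pr (fdact M a x).
Proof.
apply/eqP; rewrite -subr_eq0 -!linearB pr_eq0; apply: sU.
by rewrite -opprB rpredN.
Qed.

Fact qmodM a b x : act (a * b) x = act a (act b x).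
Proof. by apply: val_inj; rewrite /= !actE pr_act fdactM. Qed.

Definition qmod : fdmod A := mkmod qmod_linear qmod_linearl qmod1 qmodM.

Definition qpi : 'Hom(M, qmod) :=
  linfun ((vsproj C : M -> subvs_of C) \o pr).

Lemma qpi_val x : vsval (qpi x : subvs_of C) = pr x.
Proof. by rewrite lfunE /= vsprojK. Qed.

Lemma qpi_alinear : alinear qpi.
Proof.
move=> a x; apply: val_inj; rewrite [fdact qmod a _]mkmodE /=.
by rewrite actE !qpi_val pr_act.
Qed.

Lemma qpi_ker : lker qpi = U.
Proof.
apply/vspaceP => x; rewrite memv_ker -pr_eq0 -qpi_val.
apply/eqP/eqP => [->|x0]; first exact: (linear0 (@vsval K M C)).
apply: val_inj; rewrite /= x0; exact/esym/(linear0 (@vsval K M C)).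
Qed.

Lemma qpi_surj : limg qpi = fullv.
Proof.
apply/vspaceP => x; rewrite memvf; apply/memv_imgP; exists (vsval (x : subvs_of C)).
  exact: memvf.
by apply: val_inj; rewrite /= qpi_val pr_id ?subvsP.
Qed.

End Quotient.

End Submodules.

(** * Projective modules and syzygies *)

Section Projective.

Variables (K : fieldType) (A : falgType K).
Implicit Types M N P L : fdmod A.

Lemma surj_limg (V W : vectType K) (f : 'Hom(V, W)) :
  (forall y, exists x, f x = y) <-> limg f = fullv.
Proof.
split=> [fs | fs y].
  by apply/vspaceP => y; rewrite memvf; have [x <-] := fs y; rewrite memv_img ?memvf.
have : y \in limg f by rewrite fs memvf.
by case/memv_imgP => x _ ->; exists x.
Qed.

Lemma surj_section (V W : vectType K) (f : 'Hom(V, W)) :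
  (forall y, exists x, f x = y) -> forall y, f (f^-1%VF y) = y.
Proof. by move/surj_limg => fs y; rewrite limg_lfunVK // fs memvf. Qed.

Lemma inj_retraction (V W : vectType K) (f : 'Hom(V, W)) :
  injective f -> cancel f f^-1%VF.
Proof. by move/lker0P => /lker0_lfunK. Qed.

Definition lifts P := forall M N (p : 'Hom(M, N)) (f : 'Hom(P, N)),
  alinear p -> (forall y, exists x, p x = y) -> alinear f ->
  exists2 g : 'Hom(P, M), alinear g & forall x, p (g x) = f x.

Lemma projectiveP P : projective P <-> lifts P.
Proof.
split=> [prP M N p f pA ps fA | li M N p f pA ps fA].
  have [g gA pg] := prP M N p f pA (proj1 (surj_limg p) ps) fA.
  by exists g => // x; rewrite -pg comp_lfunE.
have [g gA pg] := li M N p f pA (proj2 (surj_limg p) ps) fA.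
by exists g => //; apply/lfunP => x; rewrite comp_lfunE.
Qed.

Definition retract N M := exists (i : 'Hom(N, M)) (r : 'Hom(M, N)),
  [/\ alinear i, alinear r & cancel i r].

Lemma retract_projective N M : retract N M -> projective M -> projective N.
Proof.
move=> [i [r [iA rA iK]]] /projectiveP prM; apply/projectiveP => L L' p f pA ps fA.
have [g gA pg] := prM _ _ p (f \o r)%VF pA ps (alinear_comp rA fA).
exists (g \o i)%VF; first exact: alinear_comp.
by move=> x; rewrite comp_lfunE pg comp_lfunE iK.
Qed.

Definition ses L M N := exists (f : 'Hom(L, M)) (g : 'Hom(M, N)),
  [/\ alinear f /\ alinear g, injective f, forall y, exists x, g x = y,
      forall x, g (f x) = 0 & forall y, g y = 0 -> exists x, f x = y].

Lemma ses_ker M N (g : 'Hom(M, N)) (gA : alinear g) :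
  (forall y, exists x, g x = y) -> ses (submod (stable_lker gA)) M N.
Proof.
move=> gs; exists (sincl (stable_lker gA)), g; split=> //.
- by split=> //; apply: sincl_alinear.
- exact: sincl_inj.
- by move=> x; apply/eqP; rewrite -memv_ker sincl_mem.
by move=> y gy0; exists (sproj _ y); rewrite sprojK // memv_ker gy0.
Qed.

(** The two outer liftings are glued along the splitting of the sequence given
    by the projectivity of [N]. *)
Lemma ses_projective L M N :
  ses L M N -> projective L -> projective N -> projective M.
Proof.
move=> [f [g [[fA gA] fi gs gf fg]]] /projectiveP prL /projectiveP prN.
apply/projectiveP => X Y p phi pA ps phiA.
have [s sA gs1] := prN _ _ g \1%VF gA gs (@alinear_id _ _ _).
have [al alA pal] := prL _ _ p (phi \o f)%VF pA ps (alinear_comp fA phiA).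
have [be beA pbe] := prN _ _ p (phi \o s)%VF pA ps (alinear_comp sA phiA).
pose u := (f^-1 \o (\1 - (s \o g)))%VF.
have uE x : f (u x) = x - s (g x).
  have [z fz] : exists z, f z = x - s (g x).
    by apply: fg; rewrite linearB /= gs1 id_lfunE subrr.
  by rewrite !(comp_lfunE, add_lfunE, opp_lfunE, id_lfunE) -fz inj_retraction.
clearbody u; have uA : alinear u.
  by move=> a x; apply: fi; rewrite fA !uE gA sA linearB.
exists ((al \o u) + (be \o g))%VF => [a x | x].
  by rewrite !add_lfunE !comp_lfunE uA gA alA beA linearD.
rewrite add_lfunE !comp_lfunE linearD /= pal pbe !comp_lfunE uE.
by rewrite -linearD subrK.
Qed.

Section Free.
Variable V : vectType K.

Let act a : 'End(vtens A V) := vmap (amull a) \1%VF.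

Fact free_linear a : linear (act a).
Proof. exact: linearP. Qed.
Fact free_linearl x : linear (act^~ x).
Proof.
move=> k a b; rewrite -scale_lfunE -add_lfunE; move: x; apply/lfunP.
apply: vtens_hom_ext => c v; rewrite add_lfunE scale_lfunE !vmapE !lfunE /=.
by rewrite mulrDl -scalerAl vpureDl vpureZl.
Qed.
Fact free1 x : act 1 x = x.
Proof.
rewrite -[RHS]id_lfunE; move: x; apply/lfunP; apply: vtens_hom_ext => c v.
by rewrite vmapE !id_lfunE lfunE /= mul1r.
Qed.
Fact freeM a b x : act (a * b) x = act a (act b x).
Proof.
rewrite -comp_lfunE; move: x; apply/lfunP; apply: vtens_hom_ext => c v.
by rewrite comp_lfunE !vmapE !lfunE /= mulrA.
Qed.

Definition freemod : fdmod A := mkmod free_linear free_linearl free1 freeM.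

Lemma free_actE a b v : fdact freemod a (vpure b v) = vpure (a * b) v.
Proof. by rewrite mkmodE /act vmapE id_lfunE lfunE. Qed.

Lemma free_alinear M (f : 'Hom(freemod, M)) :
  (forall a b v, f (vpure (a * b) v) = fdact M a (f (vpure b v))) -> alinear f.
Proof.
move=> fP a x; rewrite -!comp_lfunE; move: x; apply/lfunP.
apply: (@vtens_hom_ext _ A V) => b v; rewrite !comp_lfunE.
by rewrite free_actE fP.
Qed.

Definition free_ext M (h : 'Hom(V, M)) : 'Hom(freemod, M) :=
  vtens_lift (fun a v => fdact M a (h v)).

Lemma free_extE M (h : 'Hom(V, M)) a v : free_ext h (vpure a v) = fdact M a (h v).
Proof.
rewrite vtens_liftE // => [w|b] k x y; last by rewrite !linearP.
by rewrite linearP add_lfunE scale_lfunE.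
Qed.

Lemma free_ext_alinear M (h : 'Hom(V, M)) : alinear (free_ext h).
Proof. by apply: free_alinear => a b v; rewrite !free_extE fdactM. Qed.

(** Maps out of a free module are free extensions of linear maps, and linear maps
    always lift along a surjection. *)
Lemma free_projective : projective freemod.
Proof.
apply/projectiveP => M N p f pA ps fA.
pose h : 'Hom(V, M) := (p^-1 \o (f \o lin_of (@vpure_linearr K A V 1)))%VF.
exists (free_ext h); first exact: free_ext_alinear.
apply: (@vtens_ext _ A V) => [k x y|k x y|a v]; rewrite ?linearP //.
rewrite free_extE pA !comp_lfunE surj_section // lin_ofE -fA free_actE.
by rewrite mulr1.
Qed.

End Free.

Definition mu M : 'Hom(freemod M, M) := free_ext \1%VF.

Lemma muE M a (x : M) : mu M (vpure a x) = fdact M a x.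
Proof. by rewrite free_extE id_lfunE. Qed.

Lemma mu_alinear M : alinear (mu M).
Proof. exact: free_ext_alinear. Qed.

Lemma mu_surj M y : exists x, mu M x = y.
Proof. by exists (vpure 1 y); rewrite muE fdact1. Qed.

Lemma projective_section M :
  projective M -> exists2 s : 'Hom(M, freemod M), alinear s & cancel s (mu M).
Proof.
move=> /projectiveP prM.
have [s sA sK] := prM _ _ (mu M) \1%VF (@mu_alinear M) (@mu_surj M)
  (@alinear_id _ _ _).
by exists s => // x; rewrite sK id_lfunE.
Qed.

Definition free_map (V W : vectType K) (f : 'Hom(V, W)) : 'Hom(freemod V, freemod W) :=
  vmap \1%VF f.

Lemma free_map_alinear (V W : vectType K) (f : 'Hom(V, W)) : alinear (free_map f).
Proof. by apply: free_alinear => a b v; rewrite /free_map !vmapE free_actE !id_lfunE. Qed.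

Lemma free_map_comp (U V W : vectType K) (f : 'Hom(U, V)) (g : 'Hom(V, W)) x :
  free_map g (free_map f x) = free_map (g \o f)%VF x.
Proof. by rewrite /free_map vmap_comp comp_lfun1l. Qed.

Lemma free_map_can (V W : vectType K) (f : 'Hom(V, W)) (g : 'Hom(W, V)) :
  cancel f g -> cancel (free_map f) (free_map g).
Proof.
move=> fK x; rewrite free_map_comp.
have -> : (g \o f = \1)%VF by apply/lfunP => y; rewrite comp_lfunE fK id_lfunE.
exact: vmap_id.
Qed.

Lemma mu_nat M N (f : 'Hom(M, N)) x :
  alinear f -> mu N (free_map f x) = f (mu M x).
Proof.
move=> fA; rewrite -!comp_lfunE; move: x; apply/lfunP; apply: vtens_hom_ext => a v.
by rewrite !comp_lfunE /free_map vmapE !muE id_lfunE fA.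
Qed.

(** As [freemod M] depends only on the underlying space of [M], this choice of
    first syzygy is an exact functor. *)
Definition omega M : fdmod A := submod (stable_lker (@mu_alinear M)).

Lemma omega_ses M : ses (omega M) (freemod M) M.
Proof. by apply: ses_ker; apply: mu_surj. Qed.

Definition oincl M : 'Hom(omega M, freemod M) := sincl (stable_lker (@mu_alinear M)).
Definition oproj M : 'Hom(freemod M, omega M) := sproj (stable_lker (@mu_alinear M)).

Lemma oinclP M x : mu M (oincl M x) = 0.
Proof. by apply/eqP; rewrite -memv_ker sincl_mem. Qed.

Lemma oprojK M x : mu M x = 0 -> oincl M (oproj M x) = x.
Proof. by move=> x0; rewrite /oincl /oproj sprojK // memv_ker x0. Qed.

Lemma oincl_inj M : injective (oincl M). Proof. exact: sincl_inj. Qed.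
Lemma oincl_alinear M : alinear (oincl M). Proof. exact: sincl_alinear. Qed.

Definition omap M N (f : 'Hom(M, N)) : 'Hom(omega M, omega N) :=
  (oproj N \o free_map f \o oincl M)%VF.

Lemma omapE M N (f : 'Hom(M, N)) x :
  alinear f -> oincl N (omap f x) = free_map f (oincl M x).
Proof.
by move=> fA; rewrite !comp_lfunE oprojK // mu_nat // oinclP linear0.
Qed.

Lemma omap_alinear M N (f : 'Hom(M, N)) : alinear f -> alinear (omap f).
Proof.
move=> fA a x; apply: oincl_inj.
by rewrite oincl_alinear !omapE // oincl_alinear free_map_alinear.
Qed.

Lemma retract_omega N M : retract N M -> retract (omega N) (omega M).
Proof.
move=> [i [r [iA rA iK]]]; exists (omap i), (omap r).
split; try exact: omap_alinear.
by move=> x; apply: oincl_inj; rewrite !omapE // (free_map_can iK).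
Qed.

(** Tensoring with [A] over the field is exact, and [mu] has the linear section
    [x |-> 1 (x) x]; so this is the snake lemma for the kernels of [mu]. *)
Lemma ses_omega L M N : ses L M N -> ses (omega L) (omega M) (omega N).
Proof.
move=> [f [g [[fA gA] fi gs gf fg]]]; exists (omap f), (omap g).
have fK := inj_retraction fi; have gK := surj_section gs.
split.
- by split; apply: omap_alinear.
- move=> x y /(congr1 (oincl M)); rewrite !omapE //.
  by move/(can_inj (free_map_can fK))/oincl_inj.
- move=> y; pose x := free_map g^-1%VF (oincl N y).
  have gx : free_map g x = oincl N y by rewrite /x (free_map_can gK).
  have [z fz] : exists z, f z = mu M x by apply: fg; rewrite -mu_nat // gx oinclP.
  (* x lifts y to the free module, but mu x = f z may be nonzero; subtracting
     1 (x) f z repairs this without changing the image. *)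
  have x0 : mu M (x - vpure 1 (f z)) = 0 by rewrite linearB /= muE fdact1 fz subrr.
  exists (oproj M (x - vpure 1 (f z))); apply: oincl_inj.
  rewrite omapE // oprojK // linearB /= gx /free_map vmapE gf.
  by rewrite [X in _ - X](vpure0r _ _) subr0.
- move=> x; apply: oincl_inj; rewrite !omapE // free_map_comp linear0.
  have -> : (g \o f = 0)%VF by apply/lfunP => y; rewrite comp_lfunE gf zero_lfunE.
  move: (oincl L x); apply: (@vtens_ext _ A L) => [k y z|k y z|a v].
  + exact: linearP.
  + by rewrite scaler0 addr0.
  by rewrite /free_map vmapE zero_lfunE vpure0r.
move=> x gx0; pose u := (f^-1 \o (\1 - (g^-1 \o g)))%VF.
have uE y : f (u y) = y - g^-1%VF (g y).
  have [z fz] : exists z, f z = y - g^-1%VF (g y).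
    by apply: fg; rewrite linearB /= gK subrr.
  by rewrite !(comp_lfunE, add_lfunE, opp_lfunE, id_lfunE) -fz fK.
clearbody u; have {}gx0 : free_map g (oincl M x) = 0 by rewrite -omapE // gx0 linear0.
have fux : free_map f (free_map u (oincl M x)) = oincl M x.
  have : free_map f (free_map u (oincl M x))
      + free_map g^-1%VF (free_map g (oincl M x)) = oincl M x.
    rewrite !free_map_comp; move: (oincl M x).
    apply: (@vtens_ext _ A M) => [k y z|k y z|a v] //.
      by rewrite !linearP scalerDr addrACA.
    by rewrite /free_map !vmapE -vpureDr !comp_lfunE uE subrK id_lfunE.
  by rewrite gx0 linear0 addr0.
have u0 : mu L (free_map u (oincl M x)) = 0.
  by apply: fi; rewrite linear0 -mu_nat // fux oinclP.
by exists (oproj L (free_map u (oincl M x))); apply: oincl_inj; rewrite omapE // oprojK.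
Qed.

(** A section of [mu M] splits [omega M] off [freemod M]. *)
Lemma projective_omega M : projective M -> projective (omega M).
Proof.
move=> /projective_section[s sA sK]; apply: (retract_projective _ (@free_projective M)).
exists (oincl M), (oproj M \o (\1 - (s \o mu M)))%VF.
have rE x : oincl M ((oproj M \o (\1 - (s \o mu M)))%VF x) = x - s (mu M x).
  rewrite comp_lfunE add_lfunE opp_lfunE id_lfunE comp_lfunE oprojK //.
  by rewrite linearB /= sK subrr.
split; first exact: oincl_alinear.
  move=> a x; apply: oincl_inj; rewrite oincl_alinear !rE.
  by rewrite mu_alinear sA linearB.
by move=> x; apply: oincl_inj; rewrite rE oinclP linear0 subr0.
Qed.

(** The kernel [R] of the composite [freemod Q -> Q -> N] is an extension of [Z] by
    [omega Q]; a linear section of [g] makes [omega N] a retract of [R]. *)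
Lemma projective_omega_ses Z Q N :
  ses Z Q N -> projective Z -> projective Q -> projective (omega N).
Proof.
move=> [f [g [[fA gA] fi gs gf fg]]] prZ prQ.
have fK := inj_retraction fi; have gK := surj_section gs.
have hA : alinear (g \o mu Q)%VF by apply: alinear_comp; first exact: mu_alinear.
pose R := submod (stable_lker hA); pose j : 'Hom(R, freemod Q) := sincl (stable_lker hA).
pose q : 'Hom(freemod Q, R) := sproj (stable_lker hA).
have jP x : g (mu Q (j x)) = 0.
  by apply/eqP; rewrite -comp_lfunE -memv_ker sincl_mem.
have qK x : g (mu Q x) = 0 -> j (q x) = x.
  by move=> x0; rewrite /j /q sprojK // memv_ker comp_lfunE x0.
have jA : alinear j by exact: sincl_alinear.
have ji : injective j by exact: sincl_inj.
have prR : projective R.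
  apply: (ses_projective _ (projective_omega prQ) prZ).
  exists (q \o oincl Q)%VF, (f^-1 \o (mu Q \o j))%VF.
  have jqE x : j ((q \o oincl Q)%VF x) = oincl Q x.
    by rewrite comp_lfunE qK // oinclP linear0.
  have fE x : f ((f^-1 \o (mu Q \o j))%VF x) = mu Q (j x).
    by rewrite !comp_lfunE; have [z <-] := fg _ (jP x); rewrite fK.
  split.
  - split=> a x; first by apply: ji; rewrite jA !jqE oincl_alinear.
    by apply: fi; rewrite fA !fE jA mu_alinear.
  - by move=> x y /(congr1 j); rewrite !jqE => /oincl_inj.
  - move=> z; exists (q (vpure 1 (f z))); apply: fi.
    by rewrite fE qK muE fdact1 ?gf.
  - by move=> x; apply: fi; rewrite fE jqE oinclP linear0.
  move=> x /(congr1 f); rewrite fE linear0 => x0.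
  by exists (oproj Q (j x)); apply: ji; rewrite jqE oprojK.
apply: (retract_projective _ prR).
exists (q \o (free_map g^-1 \o oincl N))%VF, (oproj N \o (free_map g \o j))%VF.
have iE x : j ((q \o (free_map g^-1 \o oincl N))%VF x)
    = free_map g^-1%VF (oincl N x).
  by rewrite !comp_lfunE qK // -mu_nat // (free_map_can gK) oinclP.
have rE x : oincl N ((oproj N \o (free_map g \o j))%VF x) = free_map g (j x).
  by rewrite !comp_lfunE oprojK // mu_nat // jP.
split=> [a x|a x|x].
- by apply: ji; rewrite jA !iE oincl_alinear free_map_alinear.
- by apply: oincl_inj; rewrite oincl_alinear !rE jA free_map_alinear.
by apply: oincl_inj; rewrite rE iE (free_map_can gK).
Qed.

End Projective.

(** * Tensor products of modules *)

Section TensorModule.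

Variables (K : fieldType) (A B : falgType K).
Notation AB := (tens A B).

Section Def.
Variables (M : fdmod A) (N : fdmod B).

Let act (t : AB) : 'End(vtens M N) :=
  tlift (fun a b => vmap (fdact M a) (fdact N b)) t.

Let act_pure a b : act (pure a b) = vmap (fdact M a) (fdact N b).
Proof.
apply: (tlift_pure (h := fun a b => vmap (fdact M a) (fdact N b))) => [d|c] k x y;
  apply: vtens_hom_ext => v w; rewrite add_lfunE scale_lfunE !vmapE linearP.
  by rewrite add_lfunE scale_lfunE vpure_linearl.
by rewrite add_lfunE scale_lfunE vpure_linearr.
Qed.

Let act_lin : linear act.
Proof. exact: tlift_linear. Qed.

Fact tmod_linear t : linear (act t).
Proof. exact: linearP. Qed.
Fact tmod_linearl x : linear (act^~ x).
Proof. by move=> k s t; rewrite act_lin add_lfunE scale_lfunE. Qed.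
Fact tmod_1 x : act 1 x = x.
Proof.
rewrite -pure1 act_pure -[RHS]id_lfunE; move: x; apply/lfunP.
by apply: vtens_hom_ext => v w; rewrite vmapE id_lfunE !fdact1.
Qed.
Fact tmod_M s t x : act (s * t) x = act s (act t x).
Proof.
rewrite -comp_lfunE; congr (fun_of_lfun _ x); move: s.
apply: tens_ext => [k s u|k s u|a b].
- by rewrite mulrDl -scalerAl act_lin.
- by rewrite act_lin comp_lfunDl comp_lfunZl.
move: t; apply: tens_ext => [k s u|k s u|c d].
- by rewrite mulrDr -scalerAr act_lin.
- by rewrite act_lin comp_lfunDr comp_lfunZr.
rewrite pureM !act_pure; apply: vtens_hom_ext => v w.
by rewrite comp_lfunE !vmapE !fdactM.
Qed.

Definition tmod : fdmod AB := mkmod tmod_linear tmod_linearl tmod_1 tmod_M.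

Lemma tmod_act a b x y :
  fdact tmod (pure a b) (vpure x y) = vpure (fdact M a x) (fdact N b y).
Proof. by rewrite mkmodE act_pure vmapE. Qed.

End Def.

Lemma tmod_ext (M : fdmod A) (N : fdmod B) (Z : vectType K) (f g : 'Hom(tmod M N, Z)) :
  (forall x y, f (vpure x y) = g (vpure x y)) -> f = g.
Proof. exact: (@vtens_hom_ext _ M N). Qed.

Lemma tens_alinear (P Q : fdmod AB) (F : 'Hom(P, Q)) :
  (forall a b x, F (fdact P (pure a b) x) = fdact Q (pure a b) (F x)) -> alinear F.
Proof.
move=> FP t x; move: t; apply: tens_ext => [k s t|k s t|a b] //.
  by rewrite linearP add_lfunE scale_lfunE linearP.
by rewrite linearP add_lfunE scale_lfunE.
Qed.

Lemma tmod_alinear (M : fdmod A) (N : fdmod B) (Q : fdmod AB) (F : 'Hom(tmod M N, Q)) :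
  (forall a b x y,
    F (vpure (fdact M a x) (fdact N b y)) = fdact Q (pure a b) (F (vpure x y))) ->
  alinear F.
Proof.
move=> FP; apply: tens_alinear => a b x; rewrite -!comp_lfunE; move: x; apply/lfunP.
by apply: (@vtens_hom_ext _ M N) => x y; rewrite !comp_lfunE tmod_act FP.
Qed.

Definition tmod_map (M M' : fdmod A) (N N' : fdmod B) (f : 'Hom(M, M')) (g : 'Hom(N, N')) :
  'Hom(tmod M N, tmod M' N') := vmap f g.

Lemma tmod_map_alinear (M M' : fdmod A) (N N' : fdmod B)
    (f : 'Hom(M, M')) (g : 'Hom(N, N')) :
  alinear f -> alinear g -> alinear (tmod_map f g).
Proof.
by move=> fA gA; apply: tmod_alinear => a b x y; rewrite /tmod_map !vmapE fA gA tmod_act.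
Qed.

Lemma retract_tmod (M M' : fdmod A) (N N' : fdmod B) :
  retract M M' -> retract N N' -> retract (tmod M N) (tmod M' N').
Proof.
move=> [i [r [iA rA iK]]] [i' [r' [iA' rA' iK']]].
exists (tmod_map i i'), (tmod_map r r'); split; try exact: tmod_map_alinear.
move=> x; rewrite /tmod_map vmap_comp -[RHS]vmap_id.
by congr (vmap _ _ x); apply/lfunP => y; rewrite comp_lfunE id_lfunE.
Qed.

Section Interchange.
Variables V W : vectType K.

Let g a v b w : vtens AB (vtens V W) := vpure (pure a b) (vpure v w).
Let g2 a v : 'Hom(vtens B W, vtens AB (vtens V W)) := vtens_lift (g a v).

Let g2E a v b w : g2 a v (vpure b w) = vpure (pure a b) (vpure v w).
Proof.
rewrite /g2 vtens_liftE // => [w'|b'] k x y; rewrite /g.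
  by rewrite pure_linearr vpure_linearl.
by rewrite vpure_linearr vpure_linearr.
Qed.

Let g3 : 'Hom(vtens A V, 'Hom(vtens B W, vtens AB (vtens V W))) := vtens_lift g2.

Let g3E a v : g3 (vpure a v) = g2 a v.
Proof.
rewrite /g3 vtens_liftE // => [v'|a'] k x y; apply: vtens_hom_ext => b w;
  rewrite add_lfunE scale_lfunE !g2E.
  by rewrite pure_linearl vpure_linearl.
by rewrite vpure_linearl vpure_linearr.
Qed.

Definition interchange : 'Hom(vtens (vtens A V) (vtens B W), vtens AB (vtens V W)) :=
  vtens_lift (fun x y => g3 x y).

Lemma interchangeE a v b w :
  interchange (vpure (vpure a v) (vpure b w)) = vpure (pure a b) (vpure v w).
Proof.
rewrite /interchange vtens_liftE ?g3E ?g2E // => [y|x] k x' y'; last exact: linearP.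
by rewrite linearP add_lfunE scale_lfunE.
Qed.

Lemma tmod_free : retract (tmod (freemod A V) (freemod B W)) (freemod AB (vtens V W)).
Proof.
pose h : 'Hom(vtens V W, tmod (freemod A V) (freemod B W)) :=
  vmap (lin_of (@vpure_linearr K A V 1)) (lin_of (@vpure_linearr K B W 1)).
have ext4 (Z : vectType K) (f f' : 'Hom(vtens (vtens A V) (vtens B W), Z)) :
    (forall a v b w, f (vpure (vpure a v) (vpure b w))
      = f' (vpure (vpure a v) (vpure b w))) -> f = f'.
  move=> ff'; apply: vtens_hom_ext => x y; move: x.
  apply: vtens_ext => [k x x'|k x x'|a v]; rewrite ?vpure_linearl ?linearP //.
  by move: y; apply: vtens_ext => [k x x'|k x x'|b w]; rewrite ?vpure_linearr ?linearP.
have act4 c d a v b w : fdact (tmod (freemod A V) (freemod B W)) (pure c d)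
    (@vpure K (vtens A V) (vtens B W) (vpure a v) (vpure b w))
    = vpure (vpure (c * a) v) (vpure (d * b) w).
  by apply: etrans (tmod_act _ _ _ _) _; rewrite !free_actE.
exists (interchange : 'Hom(tmod (freemod A V) (freemod B W), freemod AB (vtens V W))).
exists (free_ext h).
split; last 2 [exact: free_ext_alinear].
  apply: tens_alinear => c d x; rewrite -!comp_lfunE; move: x; apply/lfunP.
  apply: ext4 => a v b w; rewrite !comp_lfunE act4 !interchangeE.
  by rewrite free_actE pureM.
move=> x; rewrite -comp_lfunE -[RHS]id_lfunE; move: x; apply/lfunP.
apply: ext4 => a v b w; rewrite comp_lfunE id_lfunE interchangeE free_extE.
rewrite /h vmapE (lin_ofE (@vpure_linearr K A V 1)) (lin_ofE (@vpure_linearr K B W 1)).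
apply: etrans (act4 _ _ _ _ _ _) _.
by rewrite !mulr1.
Qed.

End Interchange.

(** Projective modules are retracts of free ones, and a tensor product of free
    modules is free, by exchange of the middle factors. *)
Lemma tmod_projective (P : fdmod A) (Q : fdmod B) :
  projective P -> projective Q -> projective (tmod P Q).
Proof.
move=> /projective_section[s sA sK] /projective_section[s' sA' sK'].
apply: (@retract_projective _ _ _ (tmod (freemod A P) (freemod B Q))).
  by apply: retract_tmod; [exists s, (mu P) | exists s', (mu Q)]; split=> //;
    apply: mu_alinear.
by apply: (retract_projective (tmod_free P Q)); apply: free_projective.
Qed.

End TensorModule.

(** * The Nakayama functor and tensor products *)

Section DualBasis.

Variables (K : fieldType) (A : falgType K).
Implicit Types M : fdmod A.

Definition hdual M : vectType K := subvs_of (dualA M).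
Definition hev M (f : hdual M) : 'Hom(M, A) := vsval (f : subvs_of (dualA M)).

Lemma hevP M (f : hdual M) a x : hev f (fdact M a x) = a * hev f x.
Proof. by have /dualAP := subvsP (f : subvs_of (dualA M)); apply. Qed.

Lemma hev_linear M : linear (@hev M).
Proof. by move=> k f g; rewrite /hev linearP. Qed.

Lemma hev_inj M : injective (@hev M).
Proof. exact: subvs_inj. Qed.

Lemma hdual_mk M (f : 'Hom(M, A)) :
  (forall a x, f (fdact M a x) = a * f x) ->
  hev (vsproj (dualA M) f : subvs_of (dualA M)) = f.
Proof. by move=> fA; rewrite /hev vsprojK //; apply/dualAP. Qed.

Definition hract M (a : A) : 'Hom(hdual M, hdual M) := hom_ract M a.

Lemma hractE M a (f : hdual M) x : hev (hract M a f) x = hev f x * a.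
Proof. exact: hom_ractE. Qed.

Lemma hract_linear M (f : hdual M) : linear (fun a => hract M a f).
Proof.
move=> k a b; apply: hev_inj; apply/lfunP => x.
by rewrite hev_linear add_lfunE scale_lfunE !hractE mulrDr scalerAr.
Qed.

(** The coordinates of a section of [A (x) M -> M] form a dual basis. *)
Lemma dual_basis M : projective M ->
  exists (f : 'I_(\dim {:M}) -> hdual M) (e : 'I_(\dim {:M}) -> M),
    forall x, x = \sum_i fdact M (hev (f i) x) (e i).
Proof.
move=> /projective_section[s sA sK].
pose e (i : 'I_(\dim {:M})) : M := (vbasis {:M})`_i.
pose c i : 'Hom(freemod A M, A) := vtens_lift (fun a x => coord (vbasis {:M}) i x *: a).
have cE i a x : c i (vpure a x) = coord (vbasis {:M}) i x *: a.
  rewrite vtens_liftE // => [y|b] k u v; first by rewrite scalerDr !scalerA mulrC.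
  by rewrite linearP scalerDl scalerA.
have cA i : @alinear K A (freemod A M) (regmod A) (c i).
  by apply: free_alinear => a b v; rewrite !cE lfunE /= scalerAr.
have fP i : forall a x, (c i \o s)%VF (fdact M a x) = a * (c i \o s)%VF x.
  by move=> a x; rewrite !comp_lfunE sA cA lfunE.
exists (fun i => vsproj (dualA M) (c i \o s)%VF), e => x; rewrite -{1}(sK x).
under eq_bigr do rewrite hdual_mk // comp_lfunE; move: (s x).
apply: (@vtens_ext _ A M) => [k y z|k y z|a v]; first exact: linearP.
  rewrite scaler_sumr -big_split; apply: eq_bigr => i _.
  by rewrite !linearP add_lfunE scale_lfunE.
rewrite muE {1}(coord_vbasis (memvf v)) linear_sum; apply: eq_bigr => i _.
by rewrite cE !linearZ scale_lfunE.
Qed.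

End DualBasis.

Section NuTensor.

Variables (K : fieldType) (A B : falgType K).
Notation AB := (tens A B).

Section Pair.
Variables (M : fdmod A) (N : fdmod B).

Let H2 := vtens (hdual M) (hdual N).

Definition htens_fun (f : hdual M) (g : hdual N) : hdual (tmod M N) :=
  vsproj (dualA (tmod M N)) (vmap (hev f) (hev g) : 'Hom(tmod M N, AB)).

Let htens_funE f g x y : hev (htens_fun f g) (vpure x y) = pure (hev f x) (hev g y).
Proof.
rewrite /hev vsprojK; first exact: vmapE.
have fgA : @alinear K AB (tmod M N) (regmod AB) (vmap (hev f) (hev g)).
  apply: tmod_alinear => a b u v; rewrite !vmapE !hevP lfunE /=.
  exact/esym/pureM.
by apply/dualAP => a u; rewrite fgA lfunE.
Qed.

Definition htens : 'Hom(H2, hdual (tmod M N)) := vtens_lift htens_fun.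

Lemma htensE f g x y : hev (htens (vpure f g)) (vpure x y) = pure (hev f x) (hev g y).
Proof.
rewrite /htens vtens_liftE // => [g'|f'] k u v; apply: hev_inj;
  rewrite hev_linear; apply: tmod_ext => x' y';
  rewrite add_lfunE scale_lfunE !htens_funE hev_linear add_lfunE scale_lfunE.
  exact: pure_linearl.
exact: pure_linearr.
Qed.

Lemma htens_ract a b t :
  hract (tmod M N) (pure a b) (htens t) = htens (vmap (hract M a) (hract N b) t).
Proof.
rewrite -!comp_lfunE; move: t; apply/lfunP; apply: vtens_hom_ext => f g.
rewrite !comp_lfunE vmapE; apply: hev_inj; apply: tmod_ext => x y.
by rewrite hractE !htensE !hractE pureM.
Qed.

(** The maps [f |-> c (f x)], for [x] in the module and [c] a coordinate of the
    algebra, separate the points of [hdual], so that [vtens_sep] applies. *)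
Lemma htens_inj : injective htens.
Proof.
apply/lker0P; rewrite -subv0; apply/subvP => t; rewrite memv_ker memv0 => /eqP t0.
apply/eqP.
have coordP (C : falgType K) (c : C) : (forall i, coord (vbasis {:C}) i c = 0) -> c = 0.
  by move=> c0; rewrite (coord_vbasis (memvf c)) big1 // => i _; rewrite c0 scale0r.
have lc (C : falgType K) (L : fdmod C) (x : L) (i : 'I_(\dim {:C})) :
    linear (fun f : hdual L => coord (vbasis {:C}) i (hev f x) : K^o).
  by move=> k f g; rewrite hev_linear add_lfunE scale_lfunE linearP.
apply: (@vtens_sep _ _ _ _ _ (fun xi : M * 'I_(\dim {:A}) => lin_of (@lc A M xi.1 xi.2))
  (fun yj : N * 'I_(\dim {:B}) => lin_of (@lc B N yj.1 yj.2))).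
- move=> f f0; apply: hev_inj; apply/lfunP => x; rewrite [hev 0]linear0 zero_lfunE.
  by apply: coordP => i; have := f0 (x, i); rewrite lin_ofE.
- move=> f f0; apply: hev_inj; apply/lfunP => x; rewrite [hev 0]linear0 zero_lfunE.
  by apply: coordP => i; have := f0 (x, i); rewrite lin_ofE.
move=> [x i] [y j]; pose G (t : H2) : K^o := (hev (htens t) (vpure x y) : tens A B) i j.
have Gl : linear G.
  by move=> k u v; rewrite /G linearP hev_linear add_lfunE scale_lfunE !mxE.
transitivity (G t); last by rewrite /G t0 [hev 0]linear0 zero_lfunE mxE.
move: t {t0}; apply: (vtens_ext _ Gl) => [|f g]; first exact: linearP.
rewrite /G htensE mxE vtens_liftE ?lin_ofE // => [g'|f'] k u v; rewrite linearP.
  by rewrite mulrDl /GRing.scale /= mulrA.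
by rewrite mulrDr /GRing.scale /= mulrCA.
Qed.

Hypotheses (prM : projective M) (prN : projective N).

(** With dual bases [f_i, e_i] of [M] and [g_j, d_j] of [N], linearity gives
    [F (x (x) y) = sum_ij (f_i x (x) g_j y) * F (e_i (x) d_j)], and the right factor
    can be absorbed in the [f_i] and [g_j] through the right actions. *)
Lemma htens_surj F : exists t, htens t = F.
Proof.
have [f [e fe]] := dual_basis prM; have [g [d gd]] := dual_basis prN.
pose psi i j : AB -> H2 := tlift (fun a b => vpure (hract M a (f i)) (hract N b (g j))).
have psiE i j a b : psi i j (pure a b) = vpure (hract M a (f i)) (hract N b (g j)).
  rewrite /psi tlift_pure // => [b'|a'] k u v; rewrite hract_linear.
    exact: vpure_linearl.
  exact: vpure_linearr.
have psiP i j t x y : hev (htens (psi i j t)) (vpure x y)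
    = pure (hev (f i) x) (hev (g j) y) * t.
  move: t; apply: tens_ext => [k u v|k u v|a b].
  - rewrite /psi tlift_linear.
    by rewrite linearP hev_linear add_lfunE scale_lfunE.
  - by rewrite mulrDr scalerAr.
  by rewrite psiE htensE !hractE pureM.
exists (\sum_i \sum_j psi i j (hev F (vpure (e i) (d j)))).
apply: hev_inj; apply: tmod_ext => x y.
pose E (h : hdual (tmod M N)) : tens A B := hev h (vpure x y).
have El : linear E.
  by move=> k u v; rewrite /E hev_linear add_lfunE scale_lfunE.
rewrite -[LHS]/(E _) -(lin_ofE El) linear_sum linear_sum.
rewrite [in RHS](fe x) vpure_suml linear_sum.
apply: eq_bigr => i _; rewrite [in RHS](gd y) vpure_sumr !linear_sum; apply: eq_bigr => j _.
rewrite /= lin_ofE /E psiP -tmod_act.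
have H := @hevP _ _ (tmod M N) F (pure (hev (f i) x) (hev (g j) y)) (vpure (e i) (d j)).
exact: esym H.
Qed.

Definition hsplit : 'Hom(hdual (tmod M N), H2) := (htens^-1)%VF.

Lemma htensK : cancel htens hsplit.
Proof. exact: inj_retraction htens_inj. Qed.

Lemma hsplitK : cancel hsplit htens.
Proof. by move=> F; have [t <-] := htens_surj F; rewrite htensK. Qed.

Definition dprod (p : nu_mod M) (q : nu_mod N) : 'Hom(H2, K^o) :=
  vtens_lift (fun f g => ((p : nu_car M) f : K^o) * ((q : nu_car N) g : K^o) : K^o).

Lemma dprodE p q f g : dprod p q (vpure f g) = (p : nu_car M) f * (q : nu_car N) g.
Proof.
rewrite /dprod vtens_liftE // => [g'|f'] k u v; rewrite linearP.
  by rewrite mulrDl /GRing.scale /= mulrA.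
by rewrite mulrDr /GRing.scale /= mulrCA.
Qed.

(** The dual over [K] of the inverse of [htens]. *)
Definition nu_tens : 'Hom(tmod (nu_mod M) (nu_mod N), nu_mod (tmod M N)) :=
  vtens_lift (fun p q => (dprod p q \o hsplit)%VF : nu_car (tmod M N)).

Lemma nu_tensE p q F :
  (nu_tens (vpure p q) : nu_car (tmod M N)) F = dprod p q (hsplit F).
Proof.
rewrite /nu_tens vtens_liftE; first exact: comp_lfunE.
  move=> q' k u v; apply/lfunP => G; rewrite add_lfunE scale_lfunE !comp_lfunE.
  move: (hsplit G) => t; rewrite -scale_lfunE -add_lfunE; move: t; apply/lfunP.
  apply: vtens_hom_ext => f g; rewrite add_lfunE scale_lfunE !dprodE.
  by rewrite add_lfunE scale_lfunE mulrDl /GRing.scale /= mulrA.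
move=> q' k u v; apply/lfunP => G; rewrite add_lfunE scale_lfunE !comp_lfunE.
move: (hsplit G) => t; rewrite -scale_lfunE -add_lfunE; move: t; apply/lfunP.
apply: vtens_hom_ext => f g; rewrite add_lfunE scale_lfunE !dprodE.
by rewrite add_lfunE scale_lfunE mulrDr /GRing.scale /= mulrCA.
Qed.

Lemma nu_tens_alinear : alinear nu_tens.
Proof.
apply: tmod_alinear => a b p q; apply/lfunP => F.
rewrite nu_tensE [RHS]nu_actE nu_tensE -(hsplitK F).
rewrite [hom_ract _ _ _]htens_ract !htensK; move: (hsplit F) => t.
rewrite -[RHS]comp_lfunE; move: t; apply/lfunP; apply: vtens_hom_ext => f g.
by rewrite comp_lfunE vmapE !dprodE !nu_actE.
Qed.

Lemma nu_tens_inj : injective nu_tens.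
Proof.
apply/lker0P; rewrite -subv0; apply/subvP => t; rewrite memv_ker memv0 => /eqP t0.
apply/eqP.
have le (C : falgType K) (L : fdmod C) (f : hdual L) :
    linear (fun p : nu_mod L => (p : nu_car L) f : K^o).
  by move=> k p q; rewrite add_lfunE scale_lfunE.
apply: (@vtens_sep _ _ _ _ _ (fun f => lin_of (@le A M f)) (fun g => lin_of (@le B N g))).
- by move=> p p0; apply/lfunP => f; have := p0 f; rewrite lin_ofE zero_lfunE.
- by move=> p p0; apply/lfunP => f; have := p0 f; rewrite lin_ofE zero_lfunE.
move=> f g.
pose G t : K^o := (nu_tens t : nu_car (tmod M N)) (htens (vpure f g)).
transitivity (G t); last by rewrite /G t0 zero_lfunE.
move: t {t0}; apply: vtens_ext => [k u v|k u v|p q]; first exact: linearP.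
  by rewrite /G linearP add_lfunE scale_lfunE.
rewrite /G nu_tensE htensK dprodE vtens_liftE ?lin_ofE // => [g'|f'] k u v; rewrite linearP.
  by rewrite mulrDl /GRing.scale /= mulrA.
by rewrite mulrDr /GRing.scale /= mulrCA.
Qed.

(** Both sides have the dimension of [Hom_A(M, A) (x) Hom_B(N, B)]. *)
Lemma nu_tens_surj y : exists x, nu_tens x = y.
Proof.
apply/surj_limg: y; apply/eqP; rewrite eqEdim subvf /=.
have dimH : dim (hdual (tmod M N)) = (\dim {:hdual M} * \dim {:hdual N})%N.
  have := limg_ker_dim htens fullv; have := limg_ker_dim hsplit fullv.
  have /lker0P/eqP-> := can_inj htensK; have /lker0P/eqP-> := can_inj hsplitK.
  rewrite !capv0 !dimv0 !add0n => s1 t1.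
  have sH : (\dim (limg hsplit) <= \dim {:H2})%N by apply: dimvS; apply: subvf.
  have tH : (\dim (limg htens) <= \dim {:hdual (tmod M N)})%N.
    by apply: dimvS; apply: subvf.
  rewrite s1 in sH; rewrite t1 in tH.
  have /eqP : \dim {:H2} == \dim {:hdual (tmod M N)} by rewrite eqn_leq tH sH.
  by rewrite !dimvf => <-; rewrite dim_matrix !dimvf.
have := limg_ker_dim nu_tens fullv; have /lker0P/eqP-> := nu_tens_inj.
rewrite capv0 dimv0 add0n => ->; rewrite !dimvf dim_matrix !dimvf.
have dD (V : vectType K) : dim 'Hom(V, K^o) = dim V by exact: muln1.
by rewrite [dim (nu_mod (tmod M N))]dD dimH [dim (nu_mod M)]dD [dim (nu_mod N)]dD !dimvf.
Qed.

End Pair.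

Lemma nu_tens_nat (M M' : fdmod A) (N N' : fdmod B)
    (f : 'Hom(M, M')) (g : 'Hom(N, N')) t :
  projective M -> projective N -> projective M' -> projective N' ->
  alinear f -> alinear g ->
  nu_tens M' N' (tmod_map (nu_map f) (nu_map g) t) = nu_map (tmod_map f g) (nu_tens M N t).
Proof.
move=> prM prN prM' prN' fA gA; have fgA := tmod_map_alinear fA gA.
rewrite -!comp_lfunE; move: t; apply/lfunP; apply: tmod_ext => p q.
rewrite !comp_lfunE [tmod_map (nu_map f) _ _]vmapE; apply/lfunP => F.
rewrite nu_tensE nu_mapE nu_tensE.
rewrite -(hsplitK prM' prN' F) htensK.
have -> : precomp (tmod_map f g) (htens M' N' (hsplit M' N' F))
    = htens M N (vmap (precomp f) (precomp g) (hsplit M' N' F)).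
  move: (hsplit M' N' F) => t; rewrite -!comp_lfunE; move: t; apply/lfunP.
  apply: vtens_hom_ext => h k; rewrite !comp_lfunE vmapE.
  apply: hev_inj; apply: tmod_ext => x y.
  have hevp (C : falgType K) (L L' : fdmod C) (u : 'Hom(L, L')) (k' : hdual L') z :
      alinear u -> hev (precomp u k') z = hev k' (u z).
    by move=> uA; rewrite /hev precompE // comp_lfunE.
  by rewrite hevp // [tmod_map f g _]vmapE !htensE !hevp.
rewrite htensK; move: (hsplit M' N' F) => t.
rewrite -[RHS]comp_lfunE; move: t; apply/lfunP; apply: vtens_hom_ext => h k.
by rewrite comp_lfunE vmapE !dprodE !nu_mapE.
Qed.

End NuTensor.

(** * Complexes as graded modules with a differential *)

Definition zrange (b : nat) : seq int := [seq i%:Z - b%:Z | i <- iota 0 b.*2.+1].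

Lemma mem_zrange b (i : int) : (i \in zrange b) = (absz i <= b)%N.
Proof.
apply/mapP/idP => [[j]|ib]; first by rewrite mem_iota => jb ->; lia.
by exists (absz (i + b)%R); rewrite ?mem_iota; lia.
Qed.

Lemma zrange_uniq b : uniq (zrange b).
Proof. by rewrite map_inj_uniq ?iota_uniq // => i j; lia. Qed.

Lemma sum_single (V : nmodType) (r : seq int) (f : int -> V) i :
  uniq r -> (forall j, j != i -> f j = 0) -> (i \notin r -> f i = 0) ->
  \sum_(j <- r) f j = f i.
Proof.
move=> ur f0 fi; have [ir|nir] := boolP (i \in r).
  by rewrite (bigD1_seq i) //= big1 ?addr0.
rewrite (fi nir) big_seq big1 // => j jr; apply: f0.
by apply: contraNneq nir => <-.
Qed.

Lemma dim0P (K : fieldType) (V : vectType K) : \dim {:V} = 0%N <-> forall x : V, x = 0.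
Proof.
split=> [/eqP V0 x | V0].
  by move: V0 (memvf x); rewrite dimv_eq0 => /eqP->; rewrite memv0 => /eqP.
by apply/eqP; rewrite dimv_eq0 -subv0; apply/subvP => x _; rewrite (V0 x) mem0v.
Qed.

Section Graded.

Variables (K : fieldType) (A : falgType K).

(** A bounded complex packed into one module, with [gp] the projections onto the
    homogeneous parts. Operators between such objects compose without any
    transport along equalities of degrees. Given the bound [gb], the axiom [gp_ext]
    says that the projections add up to the identity. *)
Record gcx := GCx {
  gV :> fdmod A;
  gp : int -> 'End(gV);
  gd : 'End(gV);
  gb : nat;
  gp_alin : forall i, alinear (gp i);
  gd_alin : alinear gd;
  gpp : forall i x, gp i (gp i x) = gp i x;
  gpp0 : forall i j x, i != j -> gp i (gp j x) = 0;
  gp_ext : forall x, (forall i, gp i x = 0) -> x = 0;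
  gp_bd : forall i x, (gb < absz i)%N -> gp i x = 0;
  gdp : forall i x, gd (gp i x) = gp (i + 1) (gd x);
  gdd : forall x, gd (gd x) = 0
}.

Lemma gp_eq (G : gcx) (x y : G) : (forall i, gp G i x = gp G i y) -> x = y.
Proof.
move=> xy; apply/eqP; rewrite -subr_eq0; apply/eqP; apply: gp_ext => i.
by rewrite linearB /= xy subrr.
Qed.

Lemma gppE (G : gcx) i j (x : G) : gp G i (gp G j x) = if i == j then gp G i x else 0.
Proof. by case: eqVneq => [->|ij]; [apply: gpp | apply: gpp0]. Qed.

Lemma gp_sum (G : gcx) (x : G) : \sum_(i <- zrange (gb G)) gp G i x = x.
Proof.
apply: gp_eq => i; rewrite linear_sum /= (@sum_single _ _ _ i) ?zrange_uniq ?gpp //.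
  by move=> j ji; rewrite gpp0 // eq_sym.
by rewrite mem_zrange -ltnNge => /gp_bd->.
Qed.

Lemma signzD (i j : int) : (-1 : K) ^ (i + j) = (-1) ^ i * (-1) ^ j.
Proof. by rewrite expfzDr // oppr_eq0 oner_eq0. Qed.

Lemma signz2 (i : int) : (-1 : K) ^ i * (-1) ^ i = 1.
Proof. by rewrite -expfzMl mulrNN mulr1 exp1rz. Qed.

Definition gsign (G : gcx) : 'End(G) := \sum_(i <- zrange (gb G)) (-1) ^ i *: gp G i.

Lemma gsign_gp (G : gcx) i (x : G) : gsign G (gp G i x) = (-1) ^ i *: gp G i x.
Proof.
rewrite /gsign sum_lfunE (@sum_single _ _ _ i) ?zrange_uniq //=.
- by rewrite scale_lfunE gpp.
- by move=> j ji; rewrite scale_lfunE gpp0 ?scaler0.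
by rewrite mem_zrange -ltnNge => /gp_bd ib; rewrite scale_lfunE !ib scaler0.
Qed.

Lemma gp_gsign (G : gcx) i (x : G) : gp G i (gsign G x) = (-1) ^ i *: gp G i x.
Proof.
rewrite -{1}(gp_sum x) !linear_sum /= (@sum_single _ _ _ i) ?zrange_uniq //.
- by rewrite gsign_gp linearZ /= gpp.
- by move=> j ji; rewrite gsign_gp linearZ /= gpp0 ?scaler0 // eq_sym.
by rewrite mem_zrange -ltnNge => /gp_bd ib; rewrite gsign_gp linearZ /= gpp ib scaler0.
Qed.

Lemma gsign_alin (G : gcx) : alinear (gsign G).
Proof.
move=> a x; rewrite /gsign !sum_lfunE linear_sum; apply: eq_bigr => i _ /=.
by rewrite !scale_lfunE gp_alin linearZ.
Qed.

Lemma gsignK (G : gcx) (x : G) : gsign G (gsign G x) = x.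
Proof. by apply: gp_eq => i; rewrite !gp_gsign scalerA signz2 scale1r. Qed.

Lemma gsign_comm (G G' : gcx) (F : 'Hom(G, G')) x :
  (forall i x, F (gp G i x) = gp G' i (F x)) -> F (gsign G x) = gsign G' (F x).
Proof. by move=> Fp; apply: gp_eq => i; rewrite gp_gsign -!Fp gp_gsign linearZ. Qed.

Lemma gsign_anti (G : gcx) (F : 'End(G)) x :
  (forall i x, F (gp G i x) = gp G (i - 1) (F x)) -> F (gsign G x) = - gsign G (F x).
Proof.
move=> Fp; apply: gp_eq => i; rewrite linearN /= gp_gsign.
have Fp' y : gp G i (F y) = F (gp G (i + 1) y) by rewrite Fp addrK.
by rewrite !Fp' gp_gsign linearZ /= signzD expr1z mulrN1 scaleNr.
Qed.

Lemma gd_gsign (G : gcx) (x : G) : gd G (gsign G x) = - gsign G (gd G x).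
Proof.
apply: gp_eq => i; rewrite linearN /= gp_gsign.
have dp y : gp G i (gd G y) = gd G (gp G (i - 1) y) by rewrite gdp subrK.
have -> : (-1 : K) ^ i = - (-1) ^ (i - 1).
  by rewrite -{1}(subrK 1 i) signzD expr1z mulrN1.
by rewrite !dp gp_gsign linearZ /= scaleNr opprK.
Qed.

(** ** Passage from graded modules to complexes and back *)

Section Bc.
Variable G : gcx.

Definition bc_ob (i : int) : fdmod A := submod (stable_limg (@gp_alin G i)).
Definition bc_in i : 'Hom(bc_ob i, G) := sincl (stable_limg (@gp_alin G i)).
Definition bc_out i : 'Hom(G, bc_ob i) := (sproj (stable_limg (@gp_alin G i)) \o gp G i)%VF.

Lemma bc_inP i x : gp G i (bc_in i x) = bc_in i x.
Proof. by have /memv_imgP[y _ ->] := sincl_mem x; rewrite gpp. Qed.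

Lemma bc_outK i x : bc_in i (bc_out i x) = gp G i x.
Proof. by rewrite comp_lfunE /bc_in sprojK // memv_img ?memvf. Qed.

Lemma bc_in_inj i : injective (bc_in i). Proof. exact: sincl_inj. Qed.

Lemma bc_inK i x : bc_out i (bc_in i x) = x.
Proof. by apply: bc_in_inj; rewrite bc_outK bc_inP. Qed.

Lemma bc_in_alin i : alinear (bc_in i). Proof. exact: sincl_alinear. Qed.

Lemma bc_out_alin i : alinear (bc_out i).
Proof. by move=> a x; apply: bc_in_inj; rewrite bc_in_alin !bc_outK gp_alin. Qed.

Definition bc_d i j : 'Hom(bc_ob i, bc_ob j) := (bc_out j \o gd G \o bc_in i)%VF.

Lemma bc_d_out i j x : bc_d i j x = bc_out j (gd G (bc_in i x)).
Proof. by rewrite /bc_d comp_lfunE comp_lfunE. Qed.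

Lemma bc_dE i j x : bc_in j (bc_d i j x) = gp G j (gd G (bc_in i x)).
Proof. by rewrite bc_d_out bc_outK. Qed.

Fact bc_alin i j : alinear (bc_d i j).
Proof.
by move=> a x; apply: bc_in_inj; rewrite bc_in_alin !bc_dE bc_in_alin gd_alin gp_alin.
Qed.

Fact bc_shape i j : j != i + 1 -> bc_d i j = 0.
Proof.
move=> ij; apply/lfunP => x; apply: bc_in_inj; rewrite bc_dE zero_lfunE linear0.
by rewrite -bc_inP gdp gpp0.
Qed.

Fact bc_sq i j k : (bc_d j k \o bc_d i j)%VF = 0.
Proof.
apply/lfunP => x; apply: bc_in_inj; rewrite comp_lfunE !bc_dE zero_lfunE linear0.
by rewrite gdp gdd !linear0.
Qed.

Fact bc_bounded :
  exists b : nat, forall i, (b < absz i)%N -> \dim {:bc_ob i} = 0%N.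
Proof.
exists (gb G) => i ib; apply/dim0P => x; apply: bc_in_inj.
by rewrite linear0 -bc_inP gp_bd.
Qed.

Definition bc : bcomplex A := BComplex bc_alin bc_shape bc_sq bc_bounded.

End Bc.

Lemma cocyclesP (X : bcomplex A) i x : x \in cocycles X i <-> diff X i (i + 1) x = 0.
Proof. by rewrite memv_ker; split=> /eqP. Qed.

Lemma coboundariesP (X : bcomplex A) i x :
  x \in coboundaries X i <-> exists j y, diff X j i y = x.
Proof.
split=> [/memv_imgP[y _ ->]|[j [y <-]]]; first by exists (i - 1), y.
have [ji|ji] := eqVneq j (i - 1).
  by case: _ / (esym ji) y => y; rewrite memv_img ?memvf.
by rewrite diff_shape ?zero_lfunE ?mem0v //; apply: contraNneq ji => ->; rewrite addrK.
Qed.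

(** A realization of [X] as the homogeneous parts of a graded module. It is not
    unique, which leaves the freedom to choose convenient models of shifts, of
    Nakayama images and of stalks. *)
Record model (X : bcomplex A) := Model {
  mG :> gcx;
  mi : forall k, 'Hom(X k, mG);
  mq : forall k, 'Hom(mG, X k);
  mi_alin : forall k, alinear (mi k);
  mq_alin : forall k, alinear (mq k);
  miK : forall k x, mq k (mi k x) = x;
  mqK : forall k x, mi k (mq k x) = gp mG k x;
  mdE : forall i j x, diff X i j x = mq j (gd mG (mi i x))
}.

Definition bc_model G : model (bc G) :=
  @Model (bc G) G (bc_in G) (bc_out G) (@bc_in_alin G) (@bc_out_alin G)
    (@bc_inK G) (@bc_outK G) (@bc_d_out G).

Section ModelTheory.
Variables (X : bcomplex A) (m : model X).

Lemma mi_inj k : injective (mi m k).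
Proof. exact: can_inj (@miK X m k). Qed.

Lemma gp_mi k x : gp m k (mi m k x) = mi m k x.
Proof. by rewrite -mqK miK. Qed.

Lemma mq_gp k x : mq m k (gp m k x) = mq m k x.
Proof. by rewrite -mqK miK. Qed.

Lemma mq_mi i j x : i != j -> mq m j (mi m i x) = 0.
Proof.
by move=> ij; apply: mi_inj; rewrite mqK -gp_mi gpp0 1?eq_sym // linear0.
Qed.

Lemma mi_d i j x : mi m j (diff X i j x) = gp m j (gd m (mi m i x)).
Proof. by rewrite (mdE m) mqK. Qed.

Lemma mi_d1 i x : mi m (i + 1) (diff X i (i + 1) x) = gd m (mi m i x).
Proof. by rewrite mi_d -gdp gp_mi. Qed.

Lemma mq_d i x : mq m i (gd m x) = diff X (i - 1) i (mq m (i - 1) x).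
Proof. by rewrite (mdE m) mqK gdp subrK mq_gp. Qed.

Lemma mcocycle i x : x \in cocycles X i <-> gd m (mi m i x) = 0.
Proof.
rewrite -mi_d1; split=> [/cocyclesP->|]; first exact: linear0.
by rewrite -[RHS](linear0 (mi m (i + 1))) => /mi_inj/cocyclesP.
Qed.

Lemma mcobound i x : x \in coboundaries X i <-> exists y, gd m y = mi m i x.
Proof.
split=> [/memv_imgP[y _ ->]|[y dy]].
  by exists (mi m (i - 1) y); rewrite mi_d -gp_mi gdp subrK gpp.
apply/coboundariesP; exists (i - 1), (mq m (i - 1) y).
by rewrite -mq_d dy miK.
Qed.

Lemma exact_atP i :
  exact_at X i <-> forall x : m, gp m i x = x -> gd m x = 0 -> exists y, gd m y = x.
Proof.
split=> [/subvP ex x px dx | ex].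
  have qx : mq m i x \in cocycles X i by apply/mcocycle; rewrite mqK px.
  have [y dy] := (mcobound _).1 (ex _ qx).
  by exists y; rewrite dy mqK px.
apply/subvP => x /mcocycle dx; apply/mcobound; apply: ex => //; exact: gp_mi.
Qed.

End ModelTheory.

(** ** Existence of models *)

Section DirectSum.
Variables M N : fdmod A.

Let act a (x : M * N) : M * N := (fdact M a x.1, fdact N a x.2).

Fact dsum_linear a : linear (act a).
Proof. by move=> k x y; rewrite /act !linearP. Qed.
Fact dsum_linearl x : linear (act^~ x).
Proof. by move=> k a b; rewrite /act !linearP !add_lfunE !scale_lfunE. Qed.
Fact dsum_1 x : act 1 x = x.
Proof. by rewrite /act !fdact1 -surjective_pairing. Qed.
Fact dsum_M a b x : act (a * b) x = act a (act b x).
Proof. by rewrite /act !fdactM. Qed.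

Definition dsum : fdmod A := mkmod dsum_linear dsum_linearl dsum_1 dsum_M.

End DirectSum.

Section Biproduct.
Variable F : int -> fdmod A.

(** The identity for [i = j] and zero otherwise: direct sums of a family indexed by
    integers can then be formed without transports. *)
Definition idc i j : 'Hom(F i, F j) :=
  if @eqP _ i j is ReflectT e then ecast z 'Hom(F i, F z) e \1%VF else 0.

Lemma idc_id i x : idc i i x = x.
Proof.
rewrite /idc; case: eqP => // e.
by rewrite (eq_irrelevance e (erefl i)) /= id_lfunE.
Qed.

Lemma idc_neq i j : i != j -> idc i j = 0.
Proof. by rewrite /idc; case: eqP. Qed.

Lemma idc_alin i j : alinear (idc i j).
Proof.
move=> a x; have [ij|ij] := eqVneq i j; last by rewrite idc_neq // !zero_lfunE linear0.
by case: j / ij; rewrite !idc_id.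
Qed.

Lemma biproduct (r : seq int) : uniq r ->
  exists (S : fdmod A) (u : forall i, 'Hom(F i, S)) (v : forall i, 'Hom(S, F i)),
    [/\ forall i, alinear (u i) /\ alinear (v i),
        forall i x, i \in r -> v i (u i x) = x,
        forall i j x, i != j -> v j (u i x) = 0,
        forall i, i \notin r -> u i = 0 /\ v i = 0
      & forall x, (forall i, v i x = 0) -> x = 0].
Proof.
elim: r => [_|a r IHr /= /andP[ar ur]].
  exists (zeromod A), (fun _ => 0), (fun _ => 0); split=> //.
  - by move=> i; split=> b x; rewrite !zero_lfunE ?linear0.
  - by move=> i j x _; rewrite zero_lfunE.
  by move=> x _; rewrite thinmx0.
have [S [u [v [uvA vuK vu0 uv0 vext]]]] := IHr ur.
have lu i : linear (fun x => (idc i a x, u i x) : dsum (F a) S).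
  by move=> k x y; rewrite !linearP.
have lv i : linear (fun p : dsum (F a) S => idc a i p.1 + v i p.2).
  by move=> k x y; rewrite !linearP scalerDr addrACA.
have [ua0 va0] := uv0 a ar.
exists (dsum (F a) S), (fun i => lin_of (lu i)), (fun i => lin_of (lv i)); split.
- move=> i; have [uA vA] := uvA i; split=> b x.
    by rewrite !(lin_ofE (lu i)) mkmodE idc_alin uA.
  by rewrite !(lin_ofE (lv i)) mkmodE /= idc_alin vA linearD.
- move=> i x; rewrite inE !lin_ofE /= => /orP[/eqP ia|ir].
    move: x; rewrite ia => x.
    by rewrite !idc_id ua0 zero_lfunE linear0 addr0.
  have ia : i != a by apply: contraNneq ar => <-.
  by rewrite (idc_neq ia) zero_lfunE linear0 add0r vuK.
- move=> i j x ij; rewrite !lin_ofE /= vu0 // addr0.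
  have [ia|ia] := eqVneq i a; last by rewrite (idc_neq ia) zero_lfunE linear0.
  by rewrite (@idc_neq a j) ?zero_lfunE // -ia.
- move=> i; rewrite inE negb_or => /andP[ia /uv0[ui0 vi0]].
  split; apply/lfunP => x; rewrite lin_ofE ?ui0 ?vi0 ?zero_lfunE /=.
    by rewrite (idc_neq ia) !zero_lfunE.
  by rewrite idc_neq 1?eq_sym // ?zero_lfunE addr0.
case=> x y xy.
have y0 : y = 0.
  apply: vext => i; have [->|ia] := eqVneq i a; first by rewrite va0 zero_lfunE.
  by have := xy i; rewrite lin_ofE /= idc_neq 1?eq_sym // zero_lfunE add0r.
by have := xy a; rewrite lin_ofE /= y0 linear0 addr0 idc_id => ->.
Qed.

End Biproduct.

Lemma model_exists (X : bcomplex A) : exists m : model X, True.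
Proof.
have [b bX] := diff_bounded X.
have X0 i (x : X i) : i \notin zrange b -> x = 0.
  by rewrite mem_zrange -ltnNge => /bX/dim0P; apply.
have [S [u [v [uvA vuK vu0 uv0 vext]]]] := biproduct X (zrange_uniq b).
have {}vuK i x : v i (u i x) = x.
  have [ib|ib] := boolP (i \in zrange b); first exact: vuK.
  by rewrite [LHS](X0 i) // [RHS](X0 i).
have vud k l j y : j = l -> v l (u j (diff X k j y)) = diff X k l y by move=> ->.
have vuv k i x : k = i -> v k (u i (v i x)) = v k x by move=> ->.
have dvu k i j x : k = i -> diff X k j (v k (u i x)) = diff X i j x.
  by move=> ->; rewrite vuK.
pose p i := (u i \o v i)%VF.
pose d := \sum_(i <- zrange b) (u (i + 1) \o (diff X i (i + 1) \o v i))%VF.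
have pE i x : p i x = u i (v i x) by rewrite comp_lfunE.
have vd i x : v i (d x) = diff X (i - 1) i (v (i - 1) x).
  rewrite sum_lfunE linear_sum (@sum_single _ _ _ (i - 1)) ?zrange_uniq //=.
  - by rewrite !comp_lfunE vud ?subrK.
  - move=> j ji; rewrite !comp_lfunE vu0 //; apply: contraNneq ji => <-.
    by rewrite addrK.
  by move=> /X0 x0; rewrite !comp_lfunE (x0 (v _ x)) !linear0.
have dp i x : d (p i x) = p (i + 1) (d x).
  apply/eqP; rewrite -subr_eq0; apply/eqP; apply: vext => j.
  rewrite linearB /= vd !pE.
  have [->|ji] := eqVneq j (i + 1).
    by rewrite vuK vd vuv ?addrK ?subrr.
  rewrite (@vu0 i) ?(@vu0 (i + 1)) 1?eq_sym // ?linear0 ?addr0 //.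
  by apply: contraNneq ji => <-; rewrite subrK.
have pA i : alinear (p i) by move=> a x; rewrite !pE (uvA i).2 (uvA i).1.
have dA : alinear d.
  move=> a x; rewrite !sum_lfunE linear_sum; apply: eq_bigr => i _ /=.
  by rewrite !comp_lfunE (uvA i).2 diff_alinear (uvA (i + 1)).1.
have pp i x : p i (p i x) = p i x by rewrite !pE vuK.
have pp0 i j x : i != j -> p i (p j x) = 0.
  by move=> ij; rewrite !pE vu0 1?eq_sym // linear0.
have pext x : (forall i, p i x = 0) -> x = 0.
  by move=> px; apply: vext => i; rewrite -[LHS]vuK -pE px linear0.
have pbd i x : (b < absz i)%N -> p i x = 0.
  by move=> ib; rewrite pE (X0 _ (v i x)) ?linear0 // mem_zrange -ltnNge.
have dd x : d (d x) = 0.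
  by apply: vext => i; rewrite !vd -comp_lfunE diff_sq zero_lfunE.
pose G := GCx pA dA pp pp0 pext pbd dp dd.
have qK k x : u k (v k x) = gp G k x by rewrite /= pE.
have dE i j x : diff X i j x = v j (gd G (u i x)).
  rewrite /= vd; have [->|ij] := eqVneq j (i + 1); first by rewrite dvu ?addrK.
  rewrite diff_shape // zero_lfunE vu0 ?linear0 //.
  by apply: contraNneq ij => ->; rewrite subrK.
by exists (@Model X G u v (fun k => (uvA k).1) (fun k => (uvA k).2) vuK qK dE).
Qed.

Definition tot (X : bcomplex A) : model X := sval (boolp.cid (model_exists X)).

End Graded.

(** * Homotopy equivalences *)

Section Contraction.

Variables (K : fieldType) (V : vectType K) (D : 'End(V)).

Lemma lfun_inv_mid x : D (D^-1%VF (D x)) = D x.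
Proof. by rewrite limg_lfunVK // memv_img ?memvf. Qed.

Lemma acyclic_contractible :
  (forall x, D (D x) = 0) -> (forall x, D x = 0 -> exists y, D y = x) ->
  exists H : 'End(V), forall x, D (H x) + H (D x) = x.
Proof.
move=> DD ac; pose h := (D^-1)%VF.
(* With D h D = D the map 1 - h D takes values in ker D = im D, where D h = 1. *)
exists (h \o (\1 - (h \o D)))%VF => x.
have [y Dy] : exists y, D y = x - h (D x).
  by apply: ac; rewrite linearB /= lfun_inv_mid subrr.
rewrite !(comp_lfunE, add_lfunE, opp_lfunE, id_lfunE) -Dy lfun_inv_mid Dy.
by rewrite DD !linear0 ?subr0 ?addr0 subrK.
Qed.

End Contraction.

Section Hequiv.

Variables (K : fieldType) (A : falgType K).
Implicit Types G : gcx A.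

Definition hasdeg (B C : falgType K) (G : gcx B) (G' : gcx C) (m : int) (f : 'Hom(G, G')) :=
  forall i x, f (gp G i x) = gp G' (i + m) (f x).

(** Only [F] has to be linear over the algebra: over the ground field every
    quasi-isomorphism has an inverse up to homotopy, and such inverses survive
    tensor products. *)
Record hequiv_data G G' (F : 'Hom(G, G')) (g : 'Hom(G', G))
    (h : 'End(G)) (h' : 'End(G')) : Prop := HequivData {
  he_alin : alinear F;
  he_degF : hasdeg 0 F;
  he_dF : forall x, F (gd G x) = gd G' (F x);
  he_degg : hasdeg 0 g;
  he_dg : forall x, g (gd G' x) = gd G (g x);
  he_degh : hasdeg (-1) h;
  he_degh' : hasdeg (-1) h';
  he_gF : forall x, g (F x) = x + (gd G (h x) + h (gd G x));
  he_Fg : forall x, F (g x) = x + (gd G' (h' x) + h' (gd G' x))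
}.

Definition hequiv G G' := exists F g h h', @hequiv_data G G' F g h h'.

Lemma hasdeg_comp (B1 B2 B3 : falgType K) (G1 : gcx B1) (G2 : gcx B2) (G3 : gcx B3)
    m n (f : 'Hom(G1, G2)) (g : 'Hom(G2, G3)) :
  hasdeg m f -> hasdeg n g -> hasdeg (m + n) (g \o f)%VF.
Proof. by move=> fm gn i x; rewrite !comp_lfunE fm gn addrA. Qed.

Lemma hasdeg_add (B C : falgType K) (G : gcx B) (G' : gcx C) m (f g : 'Hom(G, G')) :
  hasdeg m f -> hasdeg m g -> hasdeg m (f + g).
Proof. by move=> fm gm i x; rewrite !add_lfunE fm gm linearD. Qed.

Lemma hasdeg0 (B C : falgType K) (G : gcx B) (G' : gcx C) m :
  hasdeg m (0 : 'Hom(G, G')).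
Proof. by move=> i x; rewrite !zero_lfunE linear0. Qed.

Lemma hasdeg_id (B : falgType K) (G : gcx B) : hasdeg 0 (\1%VF : 'End(G)).
Proof. by move=> i x; rewrite !id_lfunE addr0. Qed.

Lemma hasdeg_gd (B : falgType K) (G : gcx B) : hasdeg 1 (gd G).
Proof. by move=> i x; rewrite gdp. Qed.

Lemma hasdeg_gsign (B : falgType K) (G : gcx B) : hasdeg 0 (gsign G).
Proof. by move=> i x; rewrite addr0 gsign_gp gp_gsign. Qed.

Lemma hasdeg_gp (B C : falgType K) (G : gcx B) (G' : gcx C) m (f : 'Hom(G, G')) j x :
  hasdeg m f -> gp G' j (f x) = f (gp G (j - m) x).
Proof. by move=> fm; rewrite fm subrK. Qed.

Lemma gp_gd (B : falgType K) (G : gcx B) j (x : G) :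
  gp G j (gd G x) = gd G (gp G (j - 1) x).
Proof. by rewrite gdp subrK. Qed.

Lemma hequiv_trans G1 G2 G3 : hequiv G1 G2 -> hequiv G2 G3 -> hequiv G1 G3.
Proof.
move=> [F [g [h [h' [FA dF cF dg cg dh dh' gF Fg]]]]].
move=> [F2 [g2 [k [k' [F2A dF2 cF2 dg2 cg2 dk dk' gF2 Fg2]]]]].
exists (F2 \o F)%VF, (g \o g2)%VF, (h + (g \o (k \o F)))%VF, (k' + (F2 \o (h' \o g2)))%VF.
split.
- exact: alinear_comp.
- exact: (hasdeg_comp dF dF2).
- by move=> x; rewrite !comp_lfunE cF cF2.
- exact: (hasdeg_comp dg2 dg).
- by move=> x; rewrite !comp_lfunE cg2 cg.
- apply: hasdeg_add => //; rewrite -[-1]addr0; apply: hasdeg_comp dg.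
  by rewrite -[-1]add0r; apply: hasdeg_comp dF dk.
- apply: hasdeg_add => //; rewrite -[-1]addr0; apply: hasdeg_comp dF2.
  by rewrite -[-1]add0r; apply: hasdeg_comp dg2 dh'.
- move=> x; rewrite !(comp_lfunE, add_lfunE) gF2 linearD /= gF -addrA; congr (_ + _).
  by rewrite !linearD /= cg cF addrACA.
move=> x; rewrite !(comp_lfunE, add_lfunE) Fg linearD /= Fg2 -addrA; congr (_ + _).
by rewrite !linearD /= cF2 cg2 addrACA.
Qed.

Lemma iso_hequiv G G' (F : 'Hom(G, G')) :
  alinear F -> (forall i x, F (gp G i x) = gp G' i (F x)) ->
  (forall x, F (gd G x) = gd G' (F x)) ->
  injective F -> (forall y, exists x, F x = y) -> hequiv G G' /\ hequiv G' G.
Proof.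
move=> FA Fp Fd Fi Fs; have FK := inj_retraction Fi; have KF := surj_section Fs.
pose g := F^-1%VF.
have gA : alinear g by move=> a y; apply: Fi; rewrite FA !KF.
have gp' i x : g (gp G' i x) = gp G i (g x) by apply: Fi; rewrite Fp !KF.
have gd' x : g (gd G' x) = gd G (g x) by apply: Fi; rewrite Fd !KF.
split; [exists F, g, 0, 0 | exists g, F, 0, 0]; split=> //;
  do ?[exact: hasdeg0 | by move=> i x; rewrite addr0];
  by move=> x; rewrite !zero_lfunE linear0 !addr0 ?FK ?KF.
Qed.

Section DegreePart.
Variables (B C : falgType K) (G : gcx B) (G' : gcx C) (m : int) (f : 'Hom(G, G')).

(** Homotopies found by linear algebra need not be homogeneous; their parts of the
    expected degree satisfy the same identities. *)
Definition degpart : 'Hom(G, G') :=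
  \sum_(i <- zrange (gb G)) (gp G' (i + m) \o (f \o gp G i))%VF.

Lemma gp_degpart j x : gp G' j (degpart x) = gp G' j (f (gp G (j - m) x)).
Proof.
rewrite sum_lfunE linear_sum (@sum_single _ _ _ (j - m)) ?zrange_uniq //=.
- by rewrite !comp_lfunE subrK gpp.
- move=> i ij; rewrite !comp_lfunE gpp0 //; apply: contraNneq ij => ->.
  by rewrite addrK.
by rewrite mem_zrange -ltnNge => /gp_bd b0; rewrite !comp_lfunE b0 !linear0.
Qed.

Lemma degpart_deg : hasdeg m degpart.
Proof.
move=> i x; apply: gp_eq => j; rewrite gp_degpart !gppE subr_eq.
by case: eqVneq => [|_]; [rewrite gp_degpart | rewrite !linear0].
Qed.

End DegreePart.

(** ** Quasi-isomorphisms and homotopy equivalences *)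

Lemma model_qis (X X' : bcomplex A) (m : model X) (m' : model X') :
  hequiv m m' -> qis X X'.
Proof.
move=> [F [g [h [h' [FA dF cF dg cg dh dh' gF Fg]]]]].
pose f k : 'Hom(X k, X' k) := (mq m' k \o (F \o mi m k))%VF.
have fA k : alinear (f k) by move=> a x; rewrite !comp_lfunE mi_alin FA mq_alin.
have fE k x : mi m' k (f k x) = F (mi m k x).
  by rewrite !comp_lfunE mqK -[RHS](congr1 F (gp_mi m x)) dF addr0.
clearbody f; exists f; split=> //.
- move=> i j; apply/lfunP => x; apply: (@mi_inj _ _ _ m').
  by rewrite !comp_lfunE fE !mi_d fE -cF dF addr0.
- move=> i x /(mcocycle m) dx /(mcobound m')[y dy]; apply/(mcobound m).
  exists (g y - h (mi m i x)); move: dy; rewrite fE => /(congr1 g).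
  by rewrite gF dx linear0 addr0 cg linearB /= => ->; rewrite addrK.
move=> i y /(mcocycle m') dy; exists (mq m i (g (mi m' i y))).
  apply/(mcocycle m); rewrite mqK gdp -cg dy !linear0 //.
apply/(mcobound m'); exists (- gp m' (i - 1) (h' (mi m' i y))).
rewrite linearN linearB /= fE mqK dF addr0 Fg dy linear0 addr0 linearD /= gp_mi.
by rewrite opprD addNKr gdp subrK.
Qed.

Lemma mq_ext (X : bcomplex A) (m : model X) (x y : m) :
  (forall i, mq m i x = mq m i y) -> x = y.
Proof. by move=> xy; apply: gp_eq => i; rewrite -!mqK xy. Qed.

Section QisModel.
Variables (X X' : bcomplex A) (m : model X) (m' : model X').
Variable f : forall i, 'Hom(X i, X' i).
Hypothesis qf : quasi_iso f.

Let F : 'Hom(m, m') := \sum_(i <- zrange (gb m)) (mi m' i \o (f i \o mq m i))%VF.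

Let mqF i x : mq m' i (F x) = f i (mq m i x).
Proof.
rewrite sum_lfunE linear_sum (@sum_single _ _ _ i) ?zrange_uniq //=.
- by rewrite !comp_lfunE miK.
- by move=> j ji; rewrite !comp_lfunE mq_mi.
rewrite mem_zrange -ltnNge => /gp_bd b0.
by rewrite !comp_lfunE -[mq m i x]mq_gp b0 !linear0.
Qed.

Let FA : alinear F.
Proof.
by move=> a x; apply: mq_ext => i; rewrite mqF !mq_alin mqF (qi_alinear qf).
Qed.

Let Fmi i x : F (mi m i x) = mi m' i (f i x).
Proof.
apply: mq_ext => j; rewrite mqF; have [ij|ij] := eqVneq i j.
  by case: j / ij; rewrite !miK.
by rewrite !mq_mi // linear0.
Qed.

Let Fp i x : F (gp m i x) = gp m' i (F x).
Proof. by rewrite -mqK Fmi -mqF mqK. Qed.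

Let Fd x : F (gd m x) = gd m' (F x).
Proof.
apply: mq_ext => i; rewrite mqF !mq_d mqF.
by have /lfunP/(_ (mq m (i - 1) x)) := qi_chain qf (i - 1) i; rewrite !comp_lfunE.
Qed.

Let Finj x y : gd m x = 0 -> F x = gd m' y -> exists z, gd m z = x.
Proof.
move=> dx Fx; suff : x \in limg (gd m) by case/memv_imgP => z _ ->; exists z.
rewrite -(gp_sum x); apply: memv_suml => i _; rewrite -mqK.
have [|z <-] := (mcobound m (mq m i x)).1 _; last by rewrite memv_img ?memvf.
apply: (qi_inj qf); first by apply/(mcocycle m); rewrite mqK gdp dx linear0.
apply/(mcobound m'); exists (gp m' (i - 1) y).
by rewrite gdp subrK -Fx -mqF mqK.
Qed.

Let Fsurj y : gd m' y = 0 ->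
  y \in (F @: lker (gd m) + limg (gd m'))%VS.
Proof.
move=> dy; rewrite -(gp_sum y); apply: memv_suml => i _; rewrite -mqK.
have cy : mq m' i y \in cocycles X' i.
  by apply/(mcocycle m'); rewrite mqK gdp dy linear0.
have [x /(mcocycle m) dx /(mcobound m')[z]] := qi_surj qf cy.
rewrite linearB /= -Fmi => dz; rewrite -(subrK (F (mi m i x)) (mi m' i _)) -dz addrC.
by apply: memv_add; rewrite memv_img ?memvf // memv_ker dx.
Qed.

(** The cone of a quasi-isomorphism is acyclic, hence contractible over the
    field [K]; the blocks of a contraction are a homotopy inverse together with
    the homotopies, and their homogeneous parts of the right degree still are. *)
Lemma qis_model_hequiv : hequiv m m'.
Proof.
pose C : vectType K := (fdcar m * fdcar m')%type.
have lD : linear (fun p : C => (- gd m p.1, F p.1 + gd m' p.2) : C).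
  move=> k p q; rewrite !linearP /=; congr pair.
  by rewrite /= scalerDr addrACA.
have DE x y : lin_of lD (x, y) = (- gd m x, F x + gd m' y) by rewrite lin_ofE.
have [|[x y]|H HP] := @acyclic_contractible K C (lin_of lD).
- by case=> x y; rewrite !DE !linearN /= gdd !oppr0 linearD /= gdd addr0 Fd addNr.
- rewrite DE => -[/eqP]; rewrite oppr_eq0 => /eqP dx /eqP.
  rewrite addr_eq0 -linearN => /eqP Fx.
  have [u du] := Finj dx Fx.
  have : gd m' (F u + y) = 0.
    by rewrite linearD /= -Fd du Fx linearN /= addNr.
  move=> /Fsurj/memv_addP[_ /memv_imgP[x' x'k ->] [_ /memv_imgP[y' _ ->] Fuy]].
  exists (x' - u, y'); rewrite DE !linearB /=.
  move: x'k; rewrite memv_ker => /eqP->; rewrite oppr0 sub0r opprK du.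
  by rewrite addrAC -Fuy addrC addKr.
(* The blocks of H: g0 is the inverse, h0 and - k0 are the diagonal ones; k0 takes
   a sign because D H + H D = 1 reads F g0 + (gd c + c gd) = 1 on the second summand. *)
pose fst' := linfun (@fst (fdcar m) (fdcar m')).
pose snd' := linfun (@snd (fdcar m) (fdcar m')).
have li1 : linear (fun x => (x, 0) : C).
  by move=> k x y; congr pair; rewrite /= scaler0 addr0.
have li2 : linear (fun y => (0, y) : C).
  by move=> k x y; congr pair; rewrite /= scaler0 addr0.
pose g0 : 'Hom(m', m) := (fst' \o (H \o lin_of li2))%VF.
pose h0 : 'End(m) := (fst' \o (H \o lin_of li1))%VF.
pose k0 : 'End(m') := (- (snd' \o (H \o lin_of li2)))%VF.
have g0E y : g0 y = (H (0, y)).1 by rewrite !comp_lfunE lin_ofE lfunE.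
have h0E x : h0 x = (H (x, 0)).1 by rewrite !comp_lfunE lin_ofE lfunE.
have k0E y : k0 y = - (H (0, y)).2.
  by rewrite opp_lfunE !comp_lfunE lin_ofE lfunE.
have Hsplit x y : H (x, y) = H (x, 0) + H (0, y).
  by rewrite -linearD; congr (H _); congr pair; rewrite ?addr0 ?add0r.
have g0d y : g0 (gd m' y) = gd m (g0 y).
  have := HP (0, y); rewrite DE !linear0 ?oppr0 add0r.
  case: (H (0, y)) (g0E y) => a b /= ->; rewrite DE => -[/eqP].
  by rewrite g0E addrC subr_eq0 => /eqP.
have Fg0 y : F (g0 y) = y + (gd m' (k0 y) + k0 (gd m' y)).
  have := HP (0, y); rewrite DE !linear0 ?oppr0 add0r.
  rewrite (k0E (gd m' y)).
  case: (H (0, y)) (g0E y) (k0E y) => a b /= -> ->; rewrite DE => -[_ {1}<-] /=.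
  by rewrite linearN /= -opprD -[X in X - _]addrA addrK.
have g0F x : g0 (F x) = x + (gd m (h0 x) + h0 (gd m x)).
  have := HP (x, 0); rewrite DE linear0 addr0 (Hsplit (- gd m x)).
  have -> : H (- gd m x, 0) = - H (gd m x, 0).
    rewrite -[RHS](linearN H); congr (H _); congr pair; exact/esym/oppr0.
  rewrite (g0E (F x)) (h0E (gd m x)).
  case: (H (x, 0)) (h0E x) => a b /= ->; rewrite DE => -[e _].
  rewrite -[X in _ = X + _]e /=.
  by rewrite addrA [X in X + _]addrAC addNr add0r addrC addNKr.
clearbody g0 h0 k0; exists F, (degpart 0 g0), (degpart (-1) h0), (degpart (-1) k0).
split=> //.
- by move=> i x; rewrite addr0.
- exact: degpart_deg.
- by move=> x; apply: gp_eq => j; rewrite !(gp_gd, gp_degpart, subr0) g0d gp_gd.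
- exact: degpart_deg.
- exact: degpart_deg.
- move=> x; apply: gp_eq => j; rewrite gp_degpart subr0 -Fp g0F !linearD /= gpp.
  by rewrite !(gp_gd, gp_degpart) opprK subrK addrK gdp subrK.
move=> x; apply: gp_eq => j; rewrite -[LHS]Fp gp_degpart subr0 Fp Fg0 !linearD /= gpp.
by rewrite !(gp_gd, gp_degpart) opprK subrK addrK gdp subrK.
Qed.

End QisModel.

Lemma qis_model (X X' : bcomplex A) (m : model X) (m' : model X') :
  qis X X' -> hequiv m m'.
Proof. by case=> f qf; apply: qis_model_hequiv qf. Qed.

Lemma qis_trans (X Y Z : bcomplex A) : qis X Y -> qis Y Z -> qis X Z.
Proof.
move=> XY YZ; apply: (@model_qis _ _ (tot X) (tot Z)).
by apply: hequiv_trans (qis_model (tot X) (tot Y) XY) (qis_model _ _ YZ).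
Qed.

(** Exactness outside degree [0] means that the complex is homotopic, over [K],
    to the image of a projection [E] onto cohomology, placed in degree [0]. *)
Lemma exact_harmonic G :
  (forall i, i != 0 -> forall x, gp G i x = x -> gd G x = 0 -> exists y, gd G y = x) ->
  exists E H : 'End(G),
    [/\ hasdeg 0 E, hasdeg (-1) H, forall x, gd G (E x) = 0 /\ E (gd G x) = 0,
        forall x, x = E x + (gd G (H x) + H (gd G x))
      & forall i x, i != 0 -> gp G i (E x) = 0].
Proof.
move=> ex; pose h := degpart (-1) (gd G)^-1%VF.
have hd : hasdeg (-1) h by exact: degpart_deg.
have dhd x : gd G (h (gd G x)) = gd G x.
  apply: gp_eq => j; rewrite gp_gd gp_degpart opprK subrK (gp_gd j x) -gp_gd.
  by rewrite lfun_inv_mid -gp_gd gpp.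
clearbody h; pose e : 'End(G) := (\1 - (gd G \o h) - (h \o gd G))%VF.
have eE x : e x = x - gd G (h x) - h (gd G x).
  by rewrite !(add_lfunE, opp_lfunE, comp_lfunE, id_lfunE).
have ed : hasdeg 0 e.
  move=> i x; rewrite !eE gdp !hd gdp !linearB /= addr0 subrK addrK //.
have de x : gd G (e x) = 0 by rewrite eE !linearB /= gdd subr0 dhd subrr.
have de' x : e (gd G x) = 0 by rewrite eE gdd linear0 subr0 dhd subrr.
have xe x : x = e x + (gd G (h x) + h (gd G x)).
  by rewrite eE -[X in X + _]addrA -opprD subrK.
(* A cocycle of nonzero degree is a boundary, and e vanishes on boundaries; as the
   values of e are cocycles, e \o e vanishes in nonzero degrees. *)
clearbody e; exists (e \o e)%VF, (h + (h \o e))%VF; split.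
- by rewrite -[0]addr0; apply: hasdeg_comp.
- by apply: hasdeg_add => //; rewrite -[-1]add0r; apply: hasdeg_comp.
- by move=> x; rewrite !comp_lfunE de de' linear0.
- move=> x; rewrite !(add_lfunE, comp_lfunE) de' linear0 addr0.
  rewrite {1}(xe x) {1}(xe (e x)) de linear0 addr0 linearD /= -!addrA; congr (_ + _).
  by rewrite addrCA.
move=> i x i0; rewrite comp_lfunE (hasdeg_gp _ _ ed) subr0.
have [||y <-] := ex i i0 (gp G i (e x)); rewrite ?gpp ?de' //.
by rewrite gdp de linear0.
Qed.

End Hequiv.

(** * Tensor products of complexes *)

Section TensorComplex.

Variables (K : fieldType) (A B : falgType K).
Notation AB := (tens A B).

Lemma gp_bd0 (C : falgType K) (G : gcx C) i : (gb G < absz i)%N -> gp G i = 0.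
Proof. by move=> ib; apply/lfunP => x; rewrite gp_bd // zero_lfunE. Qed.

Lemma vmap0l (V V' W W' : vectType K) (g : 'Hom(W, W')) :
  vmap (0 : 'Hom(V, V')) g = 0.
Proof. by apply: vtens_hom_ext => x y; rewrite vmapE !zero_lfunE vpure0l. Qed.

Lemma vmap0r (V V' W W' : vectType K) (f : 'Hom(V, V')) :
  vmap f (0 : 'Hom(W, W')) = 0.
Proof. by apply: vtens_hom_ext => x y; rewrite vmapE !zero_lfunE vpure0r. Qed.

Section Def.
Variables (G : gcx A) (H : gcx B).
Notation GH := (tmod G H).

(** These projections separate points ([bigp_ext]), so that identities between
    operators on a tensor product can be tested on bihomogeneous parts. *)
Definition bigp (i j : int) : 'End(GH) := tmod_map (gp G i) (gp H j).

Lemma bigp_ext (z z' : GH) : (forall i j, bigp i j z = bigp i j z') -> z = z'.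
Proof.
move=> zz'.
have zE (t : GH) : t = \sum_(i <- zrange (gb G)) \sum_(j <- zrange (gb H)) bigp i j t.
  have -> : \sum_(i <- zrange (gb G)) \sum_(j <- zrange (gb H)) bigp i j t
      = (\sum_(i <- zrange (gb G)) \sum_(j <- zrange (gb H)) bigp i j) t.
    by rewrite sum_lfunE; apply: eq_bigr => i _; rewrite sum_lfunE.
  rewrite -[LHS]id_lfunE; congr (fun_of_lfun _ t); apply: tmod_ext => x y.
  rewrite id_lfunE sum_lfunE -{1}(gp_sum x) -{1}(gp_sum y) vpure_suml.
  apply: eq_bigr => i _; rewrite sum_lfunE vpure_sumr; apply: eq_bigr => j _.
  by rewrite /bigp /tmod_map vmapE.
by rewrite (zE z) (zE z'); apply: eq_bigr => i _; apply: eq_bigr => j _.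
Qed.

Definition tgp (k : int) : 'End(GH) :=
  \sum_(i <- zrange (gb G)) tmod_map (gp G i) (gp H (k - i)).

Lemma bigp_tgp i j k z : bigp i j (tgp k z) = if i + j == k then bigp i j z else 0.
Proof.
have -> : (if i + j == k then bigp i j z else 0)
    = (if i + j == k then bigp i j else 0) z.
  by case: ifP => _; rewrite ?zero_lfunE.
rewrite -comp_lfunE; congr (fun_of_lfun _ z); apply: tmod_ext => x y.
rewrite comp_lfunE sum_lfunE linear_sum (@sum_single _ _ _ i) ?zrange_uniq //=.
- rewrite /bigp /tmod_map !vmapE gpp gppE eq_sym subr_eq addrC eq_sym.
  by case: eqP; rewrite ?zero_lfunE ?vpure0r // vmapE.
- by move=> l li; rewrite /bigp /tmod_map !vmapE gpp0 1?eq_sym // vpure0l.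
by rewrite mem_zrange -ltnNge => ib; rewrite /tmod_map gp_bd0 // vmap0l zero_lfunE linear0.
Qed.

Fact tgp_alin k : alinear (tgp k).
Proof.
move=> a x; rewrite !sum_lfunE linear_sum; apply: eq_bigr => i _ /=.
by rewrite tmod_map_alinear //; apply: gp_alin.
Qed.

Fact tgpp k x : tgp k (tgp k x) = tgp k x.
Proof. by apply: bigp_ext => i j; rewrite !bigp_tgp; case: eqP. Qed.

Fact tgpp0 k l x : k != l -> tgp k (tgp l x) = 0.
Proof.
move=> kl; apply: bigp_ext => i j; rewrite !bigp_tgp linear0.
by case: eqP => // ->; rewrite (negbTE kl).
Qed.

Fact tgp_ext x : (forall k, tgp k x = 0) -> x = 0.
Proof.
move=> x0; apply: bigp_ext => i j; have := congr1 (bigp i j) (x0 (i + j)).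
by rewrite bigp_tgp eqxx.
Qed.

Fact tgp_bd k x : (gb G + gb H < absz k)%N -> tgp k x = 0.
Proof.
move=> kb; apply: bigp_ext => i j; rewrite bigp_tgp linear0; case: eqP => // ijk.
have [ib|ib] := ltnP (gb G) (absz i); rewrite /bigp /tmod_map.
  by rewrite gp_bd0 // vmap0l zero_lfunE.
by rewrite (@gp_bd0 _ H) ?vmap0r ?zero_lfunE //; lia.
Qed.

End Def.

Lemma tmod_map_deg (G G' : gcx A) (H H' : gcx B)
    (u : 'Hom(G, G')) (v : 'Hom(H, H')) m n k x :
  hasdeg m u -> hasdeg n v ->
  tmod_map u v (tgp G H k x) = tgp G' H' (k + (m + n)) (tmod_map u v x).
Proof.
move=> um vn.
have bE i j t : bigp G' H' i j (tmod_map u v t) = tmod_map u v (bigp G H (i - m) (j - n) t).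
  rewrite -!comp_lfunE; congr (fun_of_lfun _ t); apply: tmod_ext => y z.
  by rewrite !comp_lfunE /bigp /tmod_map !vmapE (hasdeg_gp _ _ um) (hasdeg_gp _ _ vn).
apply: bigp_ext => i j; rewrite bigp_tgp !bE bigp_tgp.
have -> : (i - m + (j - n) == k) = (i + j == k + (m + n)) by lia.
by case: ifP; rewrite // linear0.
Qed.

(** The second term is the usual [(-1)^i (1 (x) d)] in bidegree [(i, j)]. *)
Definition tgd (G : gcx A) (H : gcx B) : 'End(tmod G H) :=
  tmod_map (gd G) \1%VF + tmod_map (gsign G) (gd H).

Lemma tgdE (G : gcx A) (H : gcx B) x y :
  tgd G H (vpure x y) = vpure (gd G x) y + vpure (gsign G x) (gd H y).
Proof. by rewrite add_lfunE /tmod_map !vmapE id_lfunE. Qed.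

Section GradedTensor.
Variables (G : gcx A) (H : gcx B).

Fact tgd_alin : alinear (tgd G H).
Proof.
move=> a x; rewrite !add_lfunE linearD /=.
rewrite (tmod_map_alinear (@gd_alin _ _ G) (@alinear_id _ _ H)).
by rewrite (tmod_map_alinear (@gsign_alin _ _ G) (@gd_alin _ _ H)).
Qed.

Fact tgdp k x : tgd G H (tgp G H k x) = tgp G H (k + 1) (tgd G H x).
Proof.
rewrite !add_lfunE linearD /=.
rewrite (tmod_map_deg _ _ (@hasdeg_gd _ _ G) (@hasdeg_id _ _ H)) addr0.
by rewrite (tmod_map_deg _ _ (@hasdeg_gsign _ _ G) (@hasdeg_gd _ _ H)) add0r.
Qed.

Fact tgdd x : tgd G H (tgd G H x) = 0.
Proof.
rewrite -comp_lfunE -[RHS](zero_lfunE _ x); congr (fun_of_lfun _ x).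
apply: tmod_ext => y z; rewrite comp_lfunE zero_lfunE tgdE linearD /= !tgdE.
by rewrite !gdd vpure0l vpure0r add0r addr0 gd_gsign vpureNl addrN.
Qed.

Definition gtens : gcx AB :=
  GCx (@tgp_alin G H) tgd_alin (@tgpp G H) (@tgpp0 G H) (@tgp_ext G H) (@tgp_bd G H)
    tgdp tgdd.

End GradedTensor.

(** The bookkeeping common to the two homotopies on a tensor product below: the
    terms [c] and [e] cancel because odd operators anticommute with the signs. *)
Lemma homotopy_terms (V : zmodType) (a p q r t c e : V) :
  a + (p + q) + (r + t) = a + ((r - e) + (c + p) + ((t - c) + (e + q))).
Proof.
rewrite [X in _ = a + X](AC ((2*2)*(2*2)) (((4*8)*(1*5))*(3*6)*(7*2))) /=.
by rewrite !subrr !addr0 [RHS]addrA.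
Qed.

(** If [h] contracts [g F - 1] and [k] contracts [g2 F2 - 1], then
    [h (x) g2 F2 + s (x) k], with [s] the sign operator, contracts the difference
    of [g F (x) g2 F2] and the identity. This is the Kuenneth theorem over [K]. *)
Lemma hequiv_gtens (G G' : gcx A) (H H' : gcx B) :
  hequiv G G' -> hequiv H H' -> hequiv (gtens G H) (gtens G' H').
Proof.
move=> [F [g [h [h' [FA dF cF dg cg dh dh' gF Fg]]]]].
move=> [F2 [g2 [k [k' [F2A dF2 cF2 dg2 cg2 dk dk' gF2 Fg2]]]]].
have deg0 (G1 G2 : gcx A) (H1 H2 : gcx B) (u : 'Hom(G1, G2)) (v : 'Hom(H1, H2)) m n :
    hasdeg m u -> hasdeg n v ->
    @hasdeg _ AB AB (gtens G1 H1) (gtens G2 H2) (m + n) (tmod_map u v).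
  by move=> um vn i x; apply: tmod_map_deg.
pose hh : 'End(gtens G H) := tmod_map h (g2 \o F2)%VF + tmod_map (gsign G) k.
pose hh' : 'End(gtens G' H') := tmod_map h' (F2 \o g2)%VF + tmod_map (gsign G') k'.
exists (tmod_map F F2), (tmod_map g g2), hh, hh'.
have main (G1 G2 : gcx A) (H1 H2 : gcx B) (u : 'Hom(G1, G2)) (v : 'Hom(G2, G1))
    (u2 : 'Hom(H1, H2)) (v2 : 'Hom(H2, H1)) (a : 'End(G1)) (a2 : 'End(H1)) :
    (forall x, u (gd G1 x) = gd G2 (u x)) -> (forall x, v (gd G2 x) = gd G1 (v x)) ->
    (forall x, u2 (gd H1 x) = gd H2 (u2 x)) -> (forall x, v2 (gd H2 x) = gd H1 (v2 x)) ->
    hasdeg (-1) a ->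
    (forall x, v (u x) = x + (gd G1 (a x) + a (gd G1 x))) ->
    (forall x, v2 (u2 x) = x + (gd H1 (a2 x) + a2 (gd H1 x))) ->
    forall z : tmod G1 H1, tmod_map v v2 (tmod_map u u2 z)
      = z + (tgd G1 H1 ((tmod_map a (v2 \o u2)%VF + tmod_map (gsign G1) a2) z)
             + (tmod_map a (v2 \o u2)%VF + tmod_map (gsign G1) a2) (tgd G1 H1 z)).
  move=> cu cv cu2 cv2 da vu vu2 z.
  have as_ x : a (gsign G1 x) = - gsign G1 (a x) by apply: gsign_anti.
  rewrite -[X in _ = X + _]id_lfunE -!comp_lfunE -!add_lfunE.
  congr (fun_of_lfun _ z); apply: tmod_ext => x y.
  rewrite !(add_lfunE, comp_lfunE) id_lfunE /tmod_map !vmapE.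
  rewrite !linearD /= !vmapE !id_lfunE !comp_lfunE as_ gd_gsign !gsignK -cv2 -cu2.
  by rewrite vu !vpureNl !vpureDl {1}vu2 !vpureDr -homotopy_terms.
have chain (G1 G2 : gcx A) (H1 H2 : gcx B) (u : 'Hom(G1, G2)) (v : 'Hom(H1, H2)) :
    hasdeg 0 u -> (forall x, u (gd G1 x) = gd G2 (u x)) ->
    (forall x, v (gd H1 x) = gd H2 (v x)) ->
    forall z, tmod_map u v (tgd G1 H1 z) = tgd G2 H2 (tmod_map u v z).
  move=> du cu cv z; rewrite -!comp_lfunE; congr (fun_of_lfun _ z).
  apply: tmod_ext => x y; rewrite !comp_lfunE /tmod_map !vmapE !tgdE linearD /= !vmapE.
  rewrite cu cv; congr (vpure _ _ + vpure _ _).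
  by apply: gsign_comm => i t; rewrite du addr0.
split.
- exact: tmod_map_alinear.
- exact: (deg0 _ _ _ _ _ _ 0 0).
- exact: chain.
- exact: (deg0 _ _ _ _ _ _ 0 0).
- exact: chain.
- apply: hasdeg_add.
    rewrite -[-1]addr0; apply: deg0 => //.
    by rewrite -[0]addr0; apply: hasdeg_comp dg2.
  by rewrite -[-1]add0r; apply: deg0 => //; apply: hasdeg_gsign.
- apply: hasdeg_add.
    rewrite -[-1]addr0; apply: deg0 => //.
    by rewrite -[0]addr0; apply: hasdeg_comp dF2.
  by rewrite -[-1]add0r; apply: deg0 => //; apply: hasdeg_gsign.
- exact: main.
exact: main.
Qed.

End TensorComplex.

(** * Operations on graded modules *)

Section Exactness.

Variables (K : fieldType) (A B : falgType K).

Definition exact_off0 (C : falgType K) (G : gcx C) :=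
  forall i, i != 0 -> forall x, gp G i x = x -> gd G x = 0 -> exists y, gd G y = x.

(** The projections [E] and [E'] onto cohomology, which live in degree [0], give a
    projection [E (x) E'] homotopic to the identity, by [h (x) 1 + E s (x) h']. *)
Lemma exact_off0_gtens (G : gcx A) (H : gcx B) :
  exact_off0 G -> exact_off0 H -> exact_off0 (gtens G H).
Proof.
move=> /exact_harmonic[E [h [Ed hd Ecd xE E0]]].
move=> /exact_harmonic[E' [h' [Ed' hd' Ecd' xE' E0']]].
pose hT : 'End(tmod G H) := tmod_map h \1%VF + tmod_map (E \o gsign G)%VF h'.
have Es x : E (gsign G x) = gsign G (E x) by apply: gsign_comm => i y; rewrite Ed addr0.
have hs x : h (gsign G x) = - gsign G (h x) by apply: gsign_anti.
have main z : z = tmod_map E E' z + (tgd G H (hT z) + hT (tgd G H z)).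
  rewrite -{1}[z]id_lfunE -!comp_lfunE -!add_lfunE; congr (fun_of_lfun _ z).
  apply: tmod_ext => x y; rewrite !(add_lfunE, comp_lfunE) id_lfunE /tmod_map !vmapE.
  rewrite !linearD /= !vmapE !id_lfunE !comp_lfunE !Es hs !gsignK.
  have -> : gd G (gsign G (E x)) = 0 by rewrite gd_gsign (Ecd x).1 linear0 oppr0.
  have -> : gsign G (E (gd G x)) = 0 by rewrite (Ecd x).2 linear0.
  rewrite !vpure0l vpureNl {1}(xE x) !vpureDl {1}(xE' y) !vpureDr.
  have ht (V : zmodType) (a p q r t c : V) :
      a + (p + q) + (r + t) = a + ((r + 0) + (c + p) + ((t - c) + (0 + q))).
    by rewrite (homotopy_terms a p q r t c 0) subr0 addr0.
  exact: ht.
move=> k k0 z zk dz; exists (hT z).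
have Tk : tgp G H k (tmod_map E E' z) = 0.
  have EE i j : bigp G H i j (tmod_map E E' z) = vmap (gp G i \o E)%VF (gp H j \o E')%VF z.
    exact: vmap_comp.
  apply: bigp_ext => i j; rewrite bigp_tgp EE [RHS]linear0.
  have gE0 l : l != 0 -> (gp G l \o E = 0)%VF.
    by move=> l0; apply/lfunP => x; rewrite comp_lfunE E0 ?zero_lfunE.
  have gE0' l : l != 0 -> (gp H l \o E' = 0)%VF.
    by move=> l0; apply/lfunP => x; rewrite comp_lfunE E0' ?zero_lfunE.
  case: eqP => // ijk; have [i0|i0] := eqVneq i 0.
    by rewrite gE0' ?vmap0r ?zero_lfunE //; apply: contraNneq k0 => j0; rewrite -ijk i0 j0.
  by rewrite gE0 // vmap0l zero_lfunE.
have Ez : tmod_map E E' z = 0.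
  have := tmod_map_deg k z Ed Ed'; rewrite [tgp G H k z]zk => ->.
  by rewrite !addr0 Tk.
have := main z; rewrite Ez add0r [tgd G H z]dz linear0 addr0 => {2}->.
by [].
Qed.

End Exactness.

Section Shift.

Variables (K : fieldType) (A : falgType K) (G : gcx A) (m : int).

Fact shift_gcx_alin : alinear ((-1) ^ m *: gd G).
Proof. by move=> a x; rewrite !scale_lfunE gd_alin linearZ. Qed.
Fact shift_gcx_p0 i j x : i != j -> gp G (i + m) (gp G (j + m) x) = 0.
Proof. by move=> ij; rewrite gpp0 // (inj_eq (addIr m)). Qed.
Fact shift_gcx_ext x : (forall i, gp G (i + m) x = 0) -> x = 0.
Proof. by move=> x0; apply: gp_ext => i; rewrite -(subrK m i). Qed.
Fact shift_gcx_bd i x : (gb G + absz m < absz i)%N -> gp G (i + m) x = 0.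
Proof. by move=> ib; apply: gp_bd; lia. Qed.
Fact shift_gcx_dp i x :
  ((-1) ^ m *: gd G) (gp G (i + m) x) = gp G (i + 1 + m) (((-1) ^ m *: gd G) x).
Proof. by rewrite !scale_lfunE gdp linearZ addrAC. Qed.
Fact shift_gcx_dd x : ((-1) ^ m *: gd G) (((-1) ^ m *: gd G) x) = 0.
Proof. by rewrite !scale_lfunE linearZ /= gdd !scaler0. Qed.

Definition shift_gcx : gcx A :=
  @GCx K A G (fun i => gp G (i + m)) ((-1) ^ m *: gd G) (gb G + absz m)
    (fun i => @gp_alin K A G (i + m)) shift_gcx_alin
    (fun i => @gpp K A G (i + m)) shift_gcx_p0
    shift_gcx_ext shift_gcx_bd shift_gcx_dp shift_gcx_dd.

Lemma gsign_shift_gcx x : gsign shift_gcx x = (-1) ^ m *: gsign G x.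
Proof.
apply: (@gp_eq _ _ shift_gcx) => i; rewrite gp_gsign /= linearZ /= gp_gsign scalerA signzD.
by rewrite mulrCA signz2 mulr1.
Qed.

End Shift.

Definition shift_model (K : fieldType) (A : falgType K) (X : bcomplex A) (M : model X) m :
  model (shift X m).
Proof.
refine (@Model K A (shift X m) (shift_gcx M m)
  (fun k => mi M (k + m)) (fun k => mq M (k + m))
  (fun k => @mi_alin K A X M (k + m)) (fun k => @mq_alin K A X M (k + m))
  (fun k => @miK K A X M (k + m)) (fun k => @mqK K A X M (k + m)) _).
by move=> i j x; rewrite /= /shift_d !scale_lfunE linearZ /= (mdE M).
Defined.

Section ShiftTensor.

Variables (K : fieldType) (A B : falgType K) (G : gcx A) (H : gcx B) (m n : int).

(** As [gsign] is an involution, its [i]-th power depends on the parity of [i] only. *)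
Definition spow (i : int) : 'End(G) := if odd (absz i) then gsign G else \1%VF.

Lemma spow_alin i : alinear (spow i).
Proof. by rewrite /spow; case: ifP => _; [apply: gsign_alin | apply: alinear_id]. Qed.

Lemma spow_deg i : hasdeg 0 (spow i).
Proof. by rewrite /spow; case: ifP => _; [apply: hasdeg_gsign | apply: hasdeg_id]. Qed.

Lemma spowK i : cancel (spow i) (spow i).
Proof.
by rewrite /spow; case: ifP => _ x; [apply: gsignK | rewrite !id_lfunE].
Qed.

Lemma signz_odd (i : int) : (-1 : K) ^ i = (-1) ^+ odd (absz i).
Proof. by case: i => k; rewrite ?NegzE signr_odd // -invr_expz -exprnP -exprVn invrN1. Qed.

Lemma spow_gd i x : spow i (gd G x) = (-1) ^ i *: gd G (spow i x).
Proof.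
rewrite signz_odd /spow; case: ifP => _ /=; last by rewrite !id_lfunE scale1r.
by rewrite gd_gsign scaleN1r opprK.
Qed.

Lemma spow_gsign i x : spow i (gsign G x) = gsign G (spow i x).
Proof. by rewrite /spow; case: ifP => _; rewrite ?id_lfunE. Qed.

(** In the tensor product of the shifted complexes the differential of [G] comes
    with the sign of [m], that of [H] with the sign of [m + n]; conjugation with
    the [n]-th power of the sign operator of [G] corrects the former. *)
Lemma gtens_shift :
  hequiv (gtens (shift_gcx G m) (shift_gcx H n)) (shift_gcx (gtens G H) (m + n)).
Proof.
pose F : 'Hom(gtens (shift_gcx G m) (shift_gcx H n), shift_gcx (gtens G H) (m + n)) :=
  tmod_map (spow n) (\1%VF : 'End(H)).
have FK : cancel F F.
  move=> z; rewrite -comp_lfunE -[RHS]id_lfunE; congr (fun_of_lfun _ z).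
  by apply: tmod_ext => x y; rewrite comp_lfunE /F /tmod_map !vmapE spowK !id_lfunE.
suff [] : hequiv (gtens (shift_gcx G m) (shift_gcx H n)) (shift_gcx (gtens G H) (m + n))
  /\ hequiv (shift_gcx (gtens G H) (m + n)) (gtens (shift_gcx G m) (shift_gcx H n)) by [].
apply: (@iso_hequiv _ _ _ _ F).
- by apply: (@tmod_map_alinear _ _ _ G G H H); [apply: spow_alin | apply: alinear_id].
- move=> k z; rewrite [RHS](_ : _ = tgp G H (k + (m + n)) (F z)) //.
  have -> : F (gp (gtens (shift_gcx G m) (shift_gcx H n)) k z)
      = F (tgp G H (k + (m + n)) z).
    congr (F _); apply: (@bigp_ext _ _ _ G H) => i j; rewrite bigp_tgp.
    have := bigp_tgp (G := shift_gcx G m) (H := shift_gcx H n) (i - m) (j - n) k z.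
    rewrite /bigp /= !subrK => ->.
    by have -> : (i - m + (j - n) == k) = (i + j == k + (m + n)) by lia.
  by rewrite (tmod_map_deg _ _ (@spow_deg n) (@hasdeg_id _ _ H)) !addr0.
- move=> z; rewrite -!comp_lfunE; congr (fun_of_lfun _ z); apply: tmod_ext => x y.
  have Lx : gd (gtens (shift_gcx G m) (shift_gcx H n)) (vpure x y)
      = vpure ((-1) ^ m *: gd G x) y + vpure ((-1) ^ m *: gsign G x) ((-1) ^ n *: gd H y).
    by apply: etrans (tgdE _ _) _; rewrite gsign_shift_gcx /= !scale_lfunE.
  have Rx (p : G) : gd (shift_gcx (gtens G H) (m + n)) (vpure p y)
      = (-1) ^ (m + n) *: (vpure (gd G p) y + vpure (gsign G p) (gd H y)).
    by rewrite scale_lfunE; congr (_ *: _); apply: tgdE.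
  have Fx (p : G) (q : H) : F (vpure p q) = vpure (spow n p) q.
    by rewrite /F /tmod_map vmapE id_lfunE.
  rewrite !comp_lfunE Lx linearD /= !Fx Rx !linearZ /= spow_gd spow_gsign !vpureZr !vpureZl.
  by rewrite !scalerA scalerDr signzD mulrC.
- exact: can_inj FK.
by move=> y; exists (F y); rewrite FK.
Qed.

End ShiftTensor.

Section NuComplex.

Variables (K : fieldType) (A : falgType K).
Implicit Types M N P : fdmod A.

Lemma nu_mapM M N P (f : 'Hom(M, N)) (g : 'Hom(N, P)) x :
  alinear f -> alinear g -> nu_map g (nu_map f x) = nu_map (g \o f)%VF x.
Proof. by move=> fA gA; rewrite nu_map_comp // comp_lfunE. Qed.

Lemma alinear_lin M N k (f g : 'Hom(M, N)) :
  alinear f -> alinear g -> alinear (k *: f + g).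
Proof.
by move=> fA gA a x; rewrite !add_lfunE !scale_lfunE fA gA linearP.
Qed.

Lemma nu_map_lin M N k (f g : 'Hom(M, N)) :
  alinear f -> alinear g -> nu_map (k *: f + g) = k *: nu_map f + nu_map g.
Proof.
move=> fA gA; apply/lfunP => p; apply/lfunP => h.
rewrite add_lfunE scale_lfunE nu_mapE add_lfunE scale_lfunE !nu_mapE -linearP.
congr (p _); apply: hev_inj; apply/lfunP => x.
rewrite hev_linear add_lfunE scale_lfunE /hev !precompE //; last exact: alinear_lin.
by rewrite !comp_lfunE add_lfunE scale_lfunE linearP.
Qed.

Lemma nu_map_id M x : nu_map (\1%VF : 'End(M)) x = x.
Proof.
apply/lfunP => h; rewrite nu_mapE; congr (x _); apply: hev_inj; apply/lfunP => y.
by rewrite /hev precompE ?comp_lfunE ?id_lfunE //; apply: alinear_id.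
Qed.

Lemma alinear0 M N : @alinear K A M N 0.
Proof. by move=> a x; rewrite !zero_lfunE linear0. Qed.

Lemma nu_map_add M N (f g : 'Hom(M, N)) :
  alinear f -> alinear g -> nu_map (f + g) = nu_map f + nu_map g.
Proof. by move=> fA gA; have := nu_map_lin 1 fA gA; rewrite !scale1r. Qed.

Lemma nu_map_scale M N k (f : 'Hom(M, N)) :
  alinear f -> nu_map (k *: f) = k *: nu_map f.
Proof.
by move=> fA; have := nu_map_lin k fA (@alinear0 M N); rewrite nu_map0 !addr0.
Qed.

Lemma nu_map_sum M N (I : Type) (r : seq I) (f : I -> 'Hom(M, N)) :
  (forall i, alinear (f i)) ->
  alinear (\sum_(i <- r) f i) /\ nu_map (\sum_(i <- r) f i) = \sum_(i <- r) nu_map (f i).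
Proof.
move=> fA; elim: r => [|i r [IA IE]].
  by rewrite !big_nil nu_map0; split=> //; apply: alinear0.
rewrite !big_cons -[f i]scale1r; split; first exact: alinear_lin.
by rewrite scale1r nu_map_add // IE.
Qed.

Section NuG.
Variable G : gcx A.

Let p i := nu_map (gp G i).
Let d := nu_map (gd G).

Fact nu_gcx_pA i : alinear (p i). Proof. exact/nu_map_alinear/gp_alin. Qed.
Fact nu_gcx_dA : alinear d. Proof. exact/nu_map_alinear/gd_alin. Qed.

Let gp_alin' i := @gp_alin K A G i.
Let gd_alin' := @gd_alin K A G.

Fact nu_gcx_pp i x : p i (p i x) = p i x.
Proof.
rewrite /p nu_mapM //; congr (nu_map _ x); apply/lfunP => y.
by rewrite comp_lfunE gpp.
Qed.
Fact nu_gcx_p0 i j x : i != j -> p i (p j x) = 0.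
Proof.
move=> ij; rewrite /p nu_mapM // -[RHS](zero_lfunE _ x) -nu_map0.
by congr (nu_map _ x); apply/lfunP => y; rewrite comp_lfunE gpp0 // zero_lfunE.
Qed.
Fact nu_gcx_ext x : (forall i, p i x = 0) -> x = 0.
Proof.
move=> x0; rewrite -[LHS]nu_map_id.
have -> : \1%VF = \sum_(i <- zrange (gb G)) gp G i.
  by apply/lfunP => y; rewrite id_lfunE sum_lfunE gp_sum.
by rewrite (nu_map_sum _ gp_alin').2 sum_lfunE big1 // => i _; apply: x0.
Qed.
Fact nu_gcx_bd i x : (gb G < absz i)%N -> p i x = 0.
Proof. by move=> ib; rewrite /p gp_bd0 // nu_map0 zero_lfunE. Qed.
Fact nu_gcx_dp i x : d (p i x) = p (i + 1) (d x).
Proof.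
rewrite /d /p !nu_mapM //; congr (nu_map _ x); apply/lfunP => y.
by rewrite !comp_lfunE gdp.
Qed.
Fact nu_gcx_dd x : d (d x) = 0.
Proof.
rewrite /d nu_mapM // -[RHS](zero_lfunE _ x) -nu_map0.
by congr (nu_map _ x); apply/lfunP => y; rewrite comp_lfunE gdd zero_lfunE.
Qed.

Definition nu_gcx : gcx A :=
  GCx nu_gcx_pA nu_gcx_dA nu_gcx_pp nu_gcx_p0 nu_gcx_ext nu_gcx_bd nu_gcx_dp nu_gcx_dd.

Lemma gsign_nu_gcx x : gsign nu_gcx x = nu_map (gsign G) x.
Proof.
apply: (@gp_eq _ _ nu_gcx) => i; rewrite gp_gsign /= /p nu_mapM //; last exact: gsign_alin.
have -> : (gp G i \o gsign G = (-1) ^ i *: gp G i)%VF.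
  by apply/lfunP => y; rewrite comp_lfunE gp_gsign scale_lfunE.
by rewrite nu_map_scale // scale_lfunE.
Qed.

End NuG.

Definition nu_model (X : bcomplex A) (m : model X) : model (nu_complex X).
Proof.
refine (@Model K A (nu_complex X) (nu_gcx m)
  (fun k => nu_map (mi m k)) (fun k => nu_map (mq m k))
  _ _ _ _ _).
- by move=> k; apply/nu_map_alinear/mi_alin.
- by move=> k; apply/nu_map_alinear/mq_alin.
- move=> k x; rewrite nu_mapM; try by [apply: mi_alin | apply: mq_alin].
  rewrite -[RHS]nu_map_id; congr (nu_map _ x); apply/lfunP => y.
  by rewrite comp_lfunE miK id_lfunE.
- move=> k x; rewrite nu_mapM; try by [apply: mi_alin | apply: mq_alin].
  by congr (nu_map _ x); apply/lfunP => y; rewrite comp_lfunE mqK.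
move=> i j x; have dmA : alinear (gd m \o mi m i)%VF.
  by apply: alinear_comp; [apply: mi_alin | apply: gd_alin].
rewrite [nu_map _ (nu_map (mi m i) x)]nu_mapM; try by [apply: mi_alin | apply: gd_alin].
rewrite nu_mapM //; last exact: mq_alin.
by congr (nu_map _ x); apply/lfunP => y; rewrite !comp_lfunE -mdE.
Defined.

End NuComplex.

Section NuTensorComplex.

Variables (K : fieldType) (A B : falgType K) (G : gcx A) (H : gcx B).
Hypotheses (prG : projective G) (prH : projective H).

(** The degreewise comparison maps form one map on total modules, because the total
    modules are projective. *)
Lemma gtens_nu : hequiv (gtens (nu_gcx G) (nu_gcx H)) (nu_gcx (gtens G H)).
Proof.
pose F : 'Hom(gtens (nu_gcx G) (nu_gcx H), nu_gcx (gtens G H)) := nu_tens G H.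
suff [] : hequiv (gtens (nu_gcx G) (nu_gcx H)) (nu_gcx (gtens G H))
  /\ hequiv (nu_gcx (gtens G H)) (gtens (nu_gcx G) (nu_gcx H)) by [].
have nat (u : 'End(G)) (v : 'End(H)) z : alinear u -> alinear v ->
    nu_tens G H (tmod_map (nu_map u) (nu_map v) z) = nu_map (tmod_map u v) (nu_tens G H z).
  by move=> uA vA; apply: nu_tens_nat.
apply: (@iso_hequiv _ _ _ _ F).
- exact: nu_tens_alinear.
- move=> k z.
  rewrite [gp (gtens (nu_gcx G) (nu_gcx H)) k z](sum_lfunE _ _ _ z) linear_sum.
  rewrite [RHS](_ : _ = nu_map (tgp G H k) (F z)) //.
  rewrite /tgp (nu_map_sum _ _).2 => [|i]; last by apply: tmod_map_alinear; apply: gp_alin.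
  rewrite sum_lfunE; apply: eq_bigr => i _.
  by rewrite -nat //; apply: gp_alin.
- move=> z.
  rewrite [RHS](_ : _ = nu_map (tgd G H) (F z)) //.
  rewrite /tgd nu_map_add; first last.
  + by apply: tmod_map_alinear; [apply: gsign_alin | apply: gd_alin].
  + by apply: tmod_map_alinear; [apply: gd_alin | apply: alinear_id].
  rewrite [RHS]add_lfunE -!nat;
    try by [apply: gsign_alin | apply: gd_alin | apply: alinear_id].
  rewrite -linearD; congr (F _); rewrite -add_lfunE; congr (fun_of_lfun _ z).
  apply: tmod_ext => x y; rewrite [LHS]tgdE add_lfunE /tmod_map !vmapE.
  by rewrite gsign_nu_gcx nu_map_id.
- exact: nu_tens_inj.
exact: nu_tens_surj.
Qed.

End NuTensorComplex.

(** * The tensor product on bounded complexes *)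

Section Stalk.

Variables (K : fieldType) (A : falgType K) (M : fdmod A).

Let p (i : int) : 'End(M) := if i == 0 then \1%VF else 0.
Let d : 'End(M) := 0.

Fact stalk_gcx_pA i : alinear (p i).
Proof. by rewrite /p; case: ifP => _; [apply: alinear_id | apply: alinear0]. Qed.
Fact stalk_gcx_dA : alinear d.
Proof. exact: alinear0. Qed.
Fact stalk_gcx_pp i x : p i (p i x) = p i x.
Proof. by rewrite /p; case: ifP => _; rewrite ?id_lfunE ?zero_lfunE. Qed.
Fact stalk_gcx_p0 i j x : i != j -> p i (p j x) = 0.
Proof.
move=> ij; rewrite /p; case: (i =P 0) => [i0|_]; last by rewrite zero_lfunE.
by case: (j =P 0) => [j0|_]; [rewrite i0 j0 in ij | rewrite zero_lfunE linear0].
Qed.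
Fact stalk_gcx_ext x : (forall i, p i x = 0) -> x = 0.
Proof. by move/(_ 0); rewrite /p eqxx id_lfunE. Qed.
Fact stalk_gcx_bd i x : (0 < absz i)%N -> p i x = 0.
Proof. by rewrite absz_gt0 /p => /negbTE->; rewrite zero_lfunE. Qed.
Fact stalk_gcx_dp i x : d (p i x) = p (i + 1) (d x).
Proof. by rewrite /d !zero_lfunE linear0. Qed.
Fact stalk_gcx_dd x : d (d x) = 0.
Proof. by rewrite zero_lfunE. Qed.

Definition stalk_gcx : gcx A :=
  GCx stalk_gcx_pA stalk_gcx_dA stalk_gcx_pp stalk_gcx_p0 stalk_gcx_ext stalk_gcx_bd
    stalk_gcx_dp stalk_gcx_dd.

Definition st_in k : 'Hom(stalk_ob M k, M) :=
  if k == 0 as b return 'Hom(if b then M else zeromod A, M) then \1%VF else 0.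
Definition st_out k : 'Hom(M, stalk_ob M k) :=
  if k == 0 as b return 'Hom(M, if b then M else zeromod A) then \1%VF else 0.

Fact st_in_alin k : alinear (st_in k).
Proof.
rewrite /st_in /stalk_ob; case: (k == 0); [exact: alinear_id | exact: alinear0].
Qed.
Fact st_out_alin k : alinear (st_out k).
Proof.
rewrite /st_out /stalk_ob; case: (k == 0); [exact: alinear_id | exact: alinear0].
Qed.
Fact st_inK k x : st_out k (st_in k x) = x.
Proof.
move: x; rewrite /st_out /st_in /stalk_ob; case: (k == 0) => x.
  by rewrite !id_lfunE.
by rewrite [RHS]thinmx0 zero_lfunE.
Qed.
Fact st_outK k x : st_in k (st_out k x) = p k x.
Proof.
rewrite /st_out /st_in /p /stalk_ob; case: (k == 0); first by rewrite !id_lfunE.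
by rewrite !zero_lfunE.
Qed.
Fact st_dE i j x : diff (stalk M) i j x = st_out j (d (st_in i x)).
Proof. by rewrite /d !zero_lfunE linear0. Qed.

Definition st_model : model (stalk M) :=
  @Model K A (stalk M) stalk_gcx st_in st_out st_in_alin st_out_alin st_inK st_outK st_dE.

End Stalk.

Section Generalities.

Variables (K : fieldType) (A : falgType K).
Implicit Types X Y Z : bcomplex A.

Lemma qis_refl X : qis X X.
Proof.
exists (fun i => \1%VF); split=> [i a x|i j|i x _|i y yc]; rewrite ?id_lfunE //.
  by rewrite comp_lfun1l comp_lfun1r.
by exists y; rewrite // id_lfunE subrr mem0v.
Qed.

Lemma models_hequiv X (m m' : model X) : hequiv m m'.
Proof. exact: qis_model (qis_refl X). Qed.

Lemma qis_stalk_iso (M N : fdmod A) (f : 'Hom(M, N)) :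
  alinear f -> injective f -> (forall y, exists x, f x = y) -> qis (stalk M) (stalk N).
Proof.
move=> fA fi fs; apply: (@model_qis _ _ _ _ (st_model M) (st_model N)).
suff [] : hequiv (stalk_gcx M) (stalk_gcx N) /\ hequiv (stalk_gcx N) (stalk_gcx M) by [].
apply: (@iso_hequiv _ _ (stalk_gcx M) (stalk_gcx N) f) => // [i x|x]; last first.
  by rewrite !zero_lfunE linear0.
by rewrite /=; case: ifP => _; rewrite ?id_lfunE // !zero_lfunE linear0.
Qed.

(** A lifting is assembled from liftings on the homogeneous parts. *)
Lemma model_projective X (m : model X) : (forall i, projective (X i)) -> projective m.
Proof.
move=> prX; apply/projectiveP => M N p f pA ps fA.
have ex i : exists g : 'Hom(X i, M), alinear g /\ forall x, p (g x) = f (mi m i x).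
  have /projectiveP prXi := prX i.
  have [g gA pg] := prXi _ _ p (f \o mi m i)%VF pA ps
    (alinear_comp (@mi_alin _ _ _ m i) fA).
  by exists g; split=> // x; rewrite pg comp_lfunE.
pose g i : 'Hom(X i, M) := sval (boolp.cid (ex i)).
have gA i : alinear (g i) by rewrite /g; case: boolp.cid => ? [].
have gP i x : p (g i x) = f (mi m i x) by rewrite /g; case: boolp.cid => ? [] /=.
exists (\sum_(i <- zrange (gb m)) (g i \o mq m i)%VF) => [a x|x].
  rewrite !sum_lfunE linear_sum; apply: eq_bigr => i _ /=.
  by rewrite !comp_lfunE mq_alin gA.
rewrite sum_lfunE linear_sum -[in RHS](gp_sum x) linear_sum.
by apply: eq_bigr => i _ /=; rewrite comp_lfunE gP mqK.
Qed.

Lemma bc_projective (G : gcx A) i : projective G -> projective (bc G i).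
Proof.
apply: retract_projective; exists (bc_in G i), (bc_out G i).
by split; [apply: bc_in_alin | apply: bc_out_alin | move=> x; apply: bc_inK].
Qed.

End Generalities.

Section TensorBounded.

Variables (K : fieldType) (A B : falgType K).
Notation AB := (tens A B).
Implicit Types (X P : bcomplex A) (Y Q : bcomplex B).

Definition ctens X Y : bcomplex AB := bc (gtens (tot X) (tot Y)).

Lemma ctens_qis X Y X' Y' : qis X X' -> qis Y Y' -> qis (ctens X Y) (ctens X' Y').
Proof.
move=> XX YY; apply: (@model_qis _ _ _ _ (bc_model _) (bc_model _)).
by apply: hequiv_gtens; apply: qis_model.
Qed.

Lemma ctens_stalk (M : fdmod A) (N : fdmod B) :
  qis (ctens (stalk M) (stalk N)) (stalk (tmod M N)).
Proof.
apply: (@model_qis _ _ _ _ (bc_model _) (st_model _)).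
apply: (@hequiv_trans _ _ _ (gtens (stalk_gcx M) (stalk_gcx N))).
  by apply: hequiv_gtens; apply: (models_hequiv (tot _) (st_model _)).
suff [] : hequiv (gtens (stalk_gcx M) (stalk_gcx N)) (stalk_gcx (tmod M N))
  /\ hequiv (stalk_gcx (tmod M N)) (gtens (stalk_gcx M) (stalk_gcx N)) by [].
apply: (@iso_hequiv _ _ (gtens (stalk_gcx M) (stalk_gcx N)) (stalk_gcx (tmod M N)) \1%VF).
- exact: alinear_id.
- move=> k z; rewrite !id_lfunE /=.
  apply: (@bigp_ext _ _ _ (stalk_gcx M) (stalk_gcx N)) => i j.
  rewrite bigp_tgp /bigp /tmod_map /=.
  have [->|i0] := eqVneq i 0; last first.
    by rewrite vmap0l !zero_lfunE; case: ifP.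
  have [->|j0] := eqVneq j 0; last first.
    by rewrite vmap0r !zero_lfunE; case: ifP.
  rewrite !vmap_id addr0 eq_sym; by case: eqP => _; rewrite ?id_lfunE ?zero_lfunE.
- move=> z; rewrite !id_lfunE zero_lfunE; apply: etrans (add_lfunE _ _ _) _.
  by rewrite /tmod_map /= vmap0l vmap0r !zero_lfunE addr0.
- by move=> x y; rewrite !id_lfunE.
by move=> y; exists y; rewrite id_lfunE.
Qed.

Lemma ctens_shift X Y m n : qis (ctens (shift X m) (shift Y n)) (shift (ctens X Y) (m + n)).
Proof.
apply: (@model_qis _ _ _ _ (bc_model _) (shift_model (bc_model _) _)).
apply: hequiv_trans (gtens_shift _ _ _ _).
by apply: hequiv_gtens; apply: (models_hequiv (tot _) (shift_model (tot _) _)).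
Qed.

Lemma ctens_nu P Q : (forall i, projective (P i)) -> (forall i, projective (Q i)) ->
  qis (ctens (nu_complex P) (nu_complex Q)) (nu_complex (ctens P Q)).
Proof.
move=> prP prQ; apply: (@model_qis _ _ _ _ (bc_model _) (nu_model (bc_model _))).
apply: (@hequiv_trans _ _ _ (gtens (nu_gcx (tot P)) (nu_gcx (tot Q)))); last first.
  by apply: gtens_nu; apply: model_projective.
by apply: hequiv_gtens; apply: (models_hequiv (tot _) (nu_model (tot _))).
Qed.

Lemma ctens_projective P Q : (forall i, projective (P i)) -> (forall i, projective (Q i)) ->
  forall i, projective (ctens P Q i).
Proof.
move=> prP prQ i; apply: bc_projective.
by apply: tmod_projective; apply: model_projective.
Qed.

Lemma ctens_exact X Y : (forall i, i != 0 -> exact_at X i) ->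
  (forall i, i != 0 -> exact_at Y i) -> forall i, i != 0 -> exact_at (ctens X Y) i.
Proof.
move=> eX eY i i0; apply/(exact_atP (bc_model _)).
apply: exact_off0_gtens i0 => j j0; apply/exact_atP; [exact: eX | exact: eY].
Qed.

Lemma ctens_dbiso X Y X' Y' : dbiso X X' -> dbiso Y Y' -> dbiso (ctens X Y) (ctens X' Y').
Proof.
by move=> [Z ZX ZX'] [W WY WY']; exists (ctens Z W); apply: ctens_qis.
Qed.

Lemma dbiso_qis (C : falgType K) (X Y Z : bcomplex C) :
  dbiso X Y -> qis X Z -> dbiso Z Y.
Proof. by move=> [W WX WY] XZ; exists W => //; apply: qis_trans WX XZ. Qed.

(** Projective resolutions multiply, shifts multiply up to sign, and the Nakayama
    functor multiplies on projectives. *)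
Lemma is_nu_n_ctens n1 n2 X Y X' Y' : is_nu_n n1 X X' -> is_nu_n n2 Y Y' ->
  is_nu_n (n1 + n2) (ctens X Y) (ctens X' Y').
Proof.
move=> [P [prP PX nP]] [Q [prQ QY nQ]]; exists (ctens P Q); split.
- exact: ctens_projective.
- rewrite PoszD opprD; apply: qis_trans (ctens_shift _ _ _ _); exact: ctens_qis.
by apply: dbiso_qis (ctens_dbiso nP nQ) (ctens_nu prP prQ).
Qed.

Lemma ctens_regmod : qis (ctens (stalk (regmod A)) (stalk (regmod B))) (stalk (regmod AB)).
Proof.
apply: qis_trans (ctens_stalk _ _) _.
have li : linear (fun t : tmod (regmod A) (regmod B) => t : regmod AB) by [].
apply: (@qis_stalk_iso _ _ _ _ (lin_of li)).
- apply: tmod_alinear => a b x y; rewrite !(lin_ofE li) !lfunE /=.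
  exact/esym/pureM.
- by move=> x y; rewrite !lin_ofE.
by move=> y; exists y; rewrite lin_ofE.
Qed.

Lemma is_nu_n_invpow_ctens n1 n2 i X Y :
  is_nu_n_invpow n1 i (stalk (regmod A)) X ->
  is_nu_n_invpow n2 i (stalk (regmod B)) Y ->
  is_nu_n_invpow (n1 + n2) i (stalk (regmod AB)) (ctens X Y).
Proof.
elim: i X Y => [|i IHi] X Y /=.
  by move=> SX SY; apply: dbiso_qis (ctens_dbiso SX SY) ctens_regmod.
by move=> [Z SZ XZ] [W SW YW]; exists (ctens Z W); [apply: IHi | apply: is_nu_n_ctens].
Qed.

End TensorBounded.

(** * Projective dimension and syzygies *)

Section Syzygies.

Variables (K : fieldType) (A : falgType K).
Implicit Types M N P Z : fdmod A.

Lemma zero_projective M : (forall x : M, x = 0) -> projective M.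
Proof.
move=> M0; apply/projectiveP => N L p f pA ps fA; exists 0; first exact: alinear0.
by move=> x; rewrite (M0 x) !linear0.
Qed.

Lemma ses_iter_omega n Z P N :
  ses Z P N -> ses (iter n (@omega K A) Z) (iter n (@omega K A) P) (iter n (@omega K A) N).
Proof. by move=> e; elim: n => [|n IHn] //=; apply: ses_omega. Qed.

Lemma retract_iter_omega n M N :
  retract M N -> retract (iter n (@omega K A) M) (iter n (@omega K A) N).
Proof. by move=> e; elim: n => [|n IHn] //=; apply: retract_omega. Qed.

Lemma projective_iter_omega n M : projective M -> projective (iter n (@omega K A) M).
Proof. by move=> e; elim: n => [|n IHn] //=; apply: projective_omega. Qed.

(** Projective dimension less than [k]; the case [k = 0], of zero modules, starts the
    induction along a resolution at its left end. *)
Definition pd_lt (k : nat) M : Prop :=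
  if k is k'.+1 then projective (iter k' (@omega K A) M) else forall x : M, x = 0.

Lemma pd_lt_step k Z P N : ses Z P N -> projective P -> pd_lt k Z -> pd_lt k.+1 N.
Proof.
move=> ZPN prP; case: k => [/= Z0 | k /= prZ].
  apply: retract_projective prP; have [f [g [[fA gA] fi gs gf fg]]] := ZPN.
  have gi : injective g.
    move=> x y gxy; apply/eqP; rewrite -subr_eq0.
    have [z <-] : exists z, f z = x - y by apply: fg; rewrite linearB /= gxy subrr.
    by rewrite (Z0 z) linear0.
  have gK := surj_section gs; exists g^-1%VF, g; split=> // a x.
  by apply: gi; rewrite gA !gK.
apply: projective_omega_ses (ses_iter_omega k ZPN) prZ _.
exact: projective_iter_omega.
Qed.

Lemma stalk_ob0 M i (y : stalk_ob M i) : i != 0 -> y = 0.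
Proof. by move: y; rewrite /stalk_ob; case: (i == 0) => // y _; apply: thinmx0. Qed.

Lemma coboundaries_stalk M i x : x \in coboundaries (stalk M) i -> x = 0.
Proof. by move/coboundariesP => [j [y <-]]; rewrite zero_lfunE. Qed.

Lemma cocycles_stalk M i x : x \in cocycles (stalk M) i.
Proof. by apply/cocyclesP; rewrite zero_lfunE. Qed.

Lemma cocycles_all (X : bcomplex A) i x :
  x \in cocycles X i <-> forall j, diff X i j x = 0.
Proof.
split=> [/cocyclesP x0 j | x0]; last exact/cocyclesP.
by have [->|ij] := eqVneq j (i + 1); rewrite // diff_shape // zero_lfunE.
Qed.

Lemma coboundariesE (X : bcomplex A) i j x :
  j = i - 1 -> x \in coboundaries X i -> exists y, diff X j i y = x.
Proof. by move=> -> /memv_imgP[y _ ->]; exists y. Qed.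

(** ** From syzygies to resolutions *)

Section Splice.

Variables (Z F M : fdmod A) (f : 'Hom(Z, F)) (g : 'Hom(F, M)) (P : bcomplex A).
Variable q : forall i, 'Hom(P i, stalk Z i).
Hypotheses (fA : alinear f) (gA : alinear g) (fi : injective f)
  (gs : forall y, exists x, g x = y) (gf : forall x, g (f x) = 0)
  (fg : forall y, g y = 0 -> exists x, f x = y).
Hypotheses (qq : quasi_iso q) (P0 : forall i, 0 < i -> forall x : P i, x = 0).

(** The resolution [P] of [Z] moved one step to the left, to make room for [F] in
    degree [0]: degree [Negz k], that is [- k - 1], holds [P (- k)]. *)
Definition spl_ob (i : int) : fdmod A :=
  match i with
  | Posz 0 => F
  | Posz _ => zeromod A
  | Negz k => P (- k%:Z)
  end.

Let e : 'Hom(P 0, F) := (f \o q 0)%VF.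

Definition spl_d (i j : int) : 'Hom(spl_ob i, spl_ob j) :=
  match i, j return 'Hom(spl_ob i, spl_ob j) with
  | Negz 0, Posz 0 => e
  | Negz k, Negz l => diff P (- k%:Z) (- l%:Z)
  | _, _ => 0
  end.

Let eA : alinear e.
Proof. by apply: alinear_comp fA; apply: (qi_alinear qq). Qed.

Fact spl_alinear i j : alinear (spl_d i j).
Proof.
case: i j => [[|i]|[|i]] [[|j]|j]; try exact: alinear0; try exact: diff_alinear.
exact: eA.
Qed.

Fact spl_shape i j : j != i + 1 -> spl_d i j = 0.
Proof.
case: i j => [[|i]|[|i]] [[|j]|j] //= ij; apply: diff_shape; lia.
Qed.

Let ed i : (e \o diff P i 0)%VF = 0.
Proof.
rewrite /e -comp_lfunA (qi_chain qq) comp_lfunA.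
by rewrite [diff (stalk Z) i 0](_ : _ = 0) // comp_lfun0r comp_lfun0l.
Qed.

Fact spl_sq i j k : (spl_d j k \o spl_d i j)%VF = 0.
Proof.
case: i j k => [[|i]|[|i]] [[|j]|[|j]] [[|k]|k] /=;
  rewrite ?comp_lfun0l ?comp_lfun0r ?diff_sq //; exact: ed.
Qed.

Fact spl_bounded :
  exists b : nat, forall i, (b < absz i)%N -> \dim {:spl_ob i} = 0%N.
Proof.
have [b bP] := diff_bounded P; exists b.+1 => [[[|i]|i]] //= ib.
  by apply/dim0P => x; apply: thinmx0.
by apply: bP; lia.
Qed.

Definition spl : bcomplex A := BComplex spl_alinear spl_shape spl_sq spl_bounded.

Definition spl_q (i : int) : 'Hom(spl i, stalk M i) :=
  match i return 'Hom(spl_ob i, stalk_ob M i) with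
  | Posz 0 => g
  | _ => 0
  end.

Lemma spl_qis : quasi_iso spl_q.
Proof.
split.
- by case=> [[|i]|i]; [exact: gA | exact: alinear0 | exact: alinear0].
- move=> i j; rewrite [diff (stalk M) i j](_ : _ = 0) // comp_lfun0l.
  case: i j => [[|i]|[|i]] [[|j]|j] //=; rewrite ?comp_lfun0l ?comp_lfun0r //.
  by apply/lfunP => x; rewrite !comp_lfunE gf zero_lfunE.
- case=> [[|i]|[|i]] x.
  + move=> _ /coboundaries_stalk gx0; have [z fz] := fg gx0.
    have [y _ /coboundaries_stalk/eqP] := qi_surj qq (cocycles_stalk (z : stalk Z 0)).
    rewrite subr_eq0 => /eqP zy; apply/(@coboundariesP _ _ spl); exists (Negz 0), y.
    by rewrite -fz zy /= comp_lfunE.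
  + by move=> _ _; have -> : x = 0 by [apply: thinmx0]; apply: mem0v.
  + move=> /cocycles_all/(_ (Posz 0)); rewrite /= comp_lfunE => fq0 _.
    have qx0 : q 0 x = 0 by apply: fi; rewrite fq0 linear0.
    have : x \in coboundaries P 0.
      apply: (qi_inj qq); last by rewrite [q 0 _]qx0 mem0v.
      by apply/cocycles_all => j; have [->|j0] := eqVneq j 1;
        [apply: P0 | rewrite diff_shape // zero_lfunE].
    move=> /(@coboundariesE P 0 (-1))[//|y dy].
    exact: (proj2 (@coboundariesP K A spl (Negz 0) x)
      (ex_intro _ (Negz 1) (ex_intro _ y dy))).
  move=> /cocycles_all dx _.
  have : x \in coboundaries P (- i.+1%:Z).
    apply: (qi_inj qq); last by rewrite [q _ _]stalk_ob0 ?mem0v.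
    apply/cocycles_all => j; have [->|ji] := eqVneq j (- i%:Z); first exact: (dx (Negz i)).
    by rewrite diff_shape ?zero_lfunE //; lia.
  move=> /(@coboundariesE P _ (- i.+2%:Z))[|y dy]; first lia.
  exact: (proj2 (@coboundariesP K A spl (Negz i.+1) x)
    (ex_intro _ (Negz i.+2) (ex_intro _ y dy))).
case=> [[|i]|i] y _.
- have [x gx] := gs y; exists x; last by rewrite /= gx subrr mem0v.
  by apply/(@cocycles_all spl) => j; case: j => [[|j]|j]; rewrite zero_lfunE.
- by exists 0; rewrite ?mem0v // linear0 subr0 [y]stalk_ob0 // mem0v.
by exists 0; rewrite ?mem0v // linear0 subr0 [y]stalk_ob0 // mem0v.
Qed.

End Splice.

(** A resolution of the kernel is spliced with the surjection onto [M]. *)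
Lemma projdim_le_step n Z F M :
  ses Z F M -> projective F -> projdim_le n Z -> projdim_le n.+1 M.
Proof.
move=> [f [g [[fA gA] fi gs gf fg]]] prF [P [prP P0 [q qq]]].
have P0' i : 0 < i -> forall x : P i, x = 0.
  by move=> i0; apply/dim0P; apply: P0; rewrite i0 orbT.
exists (spl fA qq); split.
- case=> [[|i]|i] //=; apply: zero_projective => x; exact: thinmx0.
- case=> [[|i]|i] //= ib; first by apply/dim0P => x; apply: thinmx0.
  by apply: P0; lia.
by eexists; apply: spl_qis gs gf fg qq P0'.
Qed.

Lemma projective_projdim_le n M :
  projective (iter n (@omega K A) M) -> projdim_le n M.
Proof.
elim: n M => [|n IHn] M.
  move=> prM; exists (stalk M); split; last exact: qis_refl.
    move=> i /=; rewrite /stalk_ob; case: ifP => // _.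
    by apply: zero_projective => x; apply: thinmx0.
  move=> i ib; apply/dim0P => x; apply: stalk_ob0; lia.
rewrite iterSr => /IHn; apply: projdim_le_step; first exact: omega_ses.
exact: free_projective.
Qed.

(** ** From resolutions to syzygies *)

(** The resolution breaks up into short exact sequences between its modules of
    cocycles, and each of them raises the projective dimension by at most one. *)
Lemma projdim_le_projective n M :
  projdim_le n.+1 M -> projective (iter n.+1 (@omega K A) M).
Proof.
move=> [P [prP P0 [q qq]]].
have P0' i : (i < - n.+1%:Z) || (0 < i) -> forall x : P i, x = 0.
  by move=> ib; apply/dim0P; apply: P0.
have exP i : i != 0 -> exact_at P i.
  move=> i0; apply/subvP => x xc; apply: (qi_inj qq) => //.
  by rewrite [q i x](stalk_ob0 _ i0) mem0v.
pose Zm i : fdmod A := submod (stable_lker (@diff_alinear _ _ P i (i + 1))).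
have sesZ i : i + 1 < 0 -> ses (Zm i) (P i) (Zm (i + 1)).
  move=> i0; pose h : 'Hom(P i, Zm (i + 1)) :=
    (sproj (stable_lker (@diff_alinear _ _ P (i + 1) (i + 1 + 1))) \o diff P i (i + 1))%VF.
  have hE x : sincl _ (h x) = diff P i (i + 1) x.
    by rewrite comp_lfunE sprojK // memv_ker -comp_lfunE diff_sq zero_lfunE.
  exists (sincl _), h; split.
  - split; first exact: sincl_alinear.
    by move=> a x; apply: sincl_inj; rewrite sincl_alinear !hE diff_alinear.
  - exact: sincl_inj.
  - move=> y; have yc := sincl_mem y.
    have /subvP/(_ _ yc) : exact_at P (i + 1) by apply: exP; lia.
    move=> /(@coboundariesE P _ i)[|x dx]; first by rewrite addrK.
    by exists x; apply: sincl_inj; rewrite hE dx.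
  - move=> x; apply: sincl_inj; rewrite hE linear0.
    by apply/eqP; rewrite -memv_ker sincl_mem.
  move=> y /(congr1 (sincl _)); rewrite hE linear0 => dy.
  by exists (sproj _ y); rewrite sprojK // memv_ker dy.
(* The cocycles in degree - (n + 1) vanish, so the count starts at k = 0 there;
   degree 0 is treated apart, where the next map is the augmentation q 0. *)
have pdZ k : (k <= n)%N -> pd_lt k (Zm (k%:Z - n.+1%:Z)).
  elim: k => [_ x|k IHk kn].
    apply: sincl_inj; rewrite linear0; have xc := sincl_mem x.
    have i0 : 0%N%:Z - n.+1%:Z != 0 by lia.
    have [y <-] := @coboundariesE P (0%N%:Z - n.+1%:Z) (- n.+2%:Z) _ ltac:(lia)
      (subvP (exP _ i0) _ xc).
    by rewrite (P0' (- n.+2%:Z) _ y) ?linear0 //; lia.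
  have := sesZ (k%:Z - n.+1%:Z) ltac:(lia).
  have -> : k%:Z - n.+1%:Z + 1 = k.+1%:Z - n.+1%:Z by lia.
  by move/pd_lt_step; apply => //; apply: IHk; lia.
have {}pdZ : pd_lt n (Zm (-1)).
  by have := pdZ n (leqnn n); have -> : n%:Z - n.+1%:Z = -1 by lia.
have qA : @alinear _ _ (P 0) M (q 0) by apply: (qi_alinear qq).
pose B0 := submod (stable_lker qA).
have sesB : ses (Zm (-1)) (P (-1)) B0.
  pose h : 'Hom(P (-1), B0) := (sproj (stable_lker qA) \o diff P (-1) 0)%VF.
  have hE x : sincl _ (h x) = diff P (-1) 0 x.
    rewrite comp_lfunE sprojK // memv_ker; apply/eqP.
    have /lfunP/(_ x) := qi_chain qq (-1) 0; rewrite !comp_lfunE => ->.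
    by rewrite zero_lfunE.
  exists (sincl _), h; split.
  - split; first exact: sincl_alinear.
    by move=> a x; apply: sincl_inj; rewrite sincl_alinear !hE diff_alinear.
  - exact: sincl_inj.
  - move=> y; have := sincl_mem y; rewrite memv_ker => /eqP qy.
    have : sincl (stable_lker qA) y \in coboundaries P 0.
      apply: (qi_inj qq); last by rewrite [q 0 _]qy mem0v.
      by apply/cocyclesP; apply: P0'.
    move=> /(@coboundariesE P 0 (-1))[//|x dx].
    by exists x; apply: sincl_inj; rewrite hE dx.
  - move=> x; apply: sincl_inj; rewrite hE linear0.
    by apply/eqP; have := sincl_mem x; rewrite memv_ker.
  move=> y /(congr1 (sincl _)); rewrite hE linear0 => dy.
  by exists (sproj _ y); rewrite sprojK // memv_ker dy.
have sesM : ses B0 (P 0) M.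
  apply: ses_ker => s.
  have [x _ /coboundaries_stalk/eqP] := qi_surj qq (cocycles_stalk (s : stalk M 0)).
  by rewrite subr_eq0 => /eqP ->; exists x.
have := pd_lt_step sesM (prP 0) (pd_lt_step sesB (prP (-1)) pdZ).
by [].
Qed.

End Syzygies.

Section TensorDimension.

Variables (K : fieldType) (A B : falgType K).

Lemma projdim_le_tmod n1 n2 (M : fdmod A) (N : fdmod B) :
  projdim_le n1 M -> projdim_le n2 N -> projdim_le (n1 + n2) (tmod M N).
Proof.
move=> [P [prP P0 PM]] [Q [prQ Q0 QN]]; exists (ctens P Q); split.
- exact: ctens_projective.
- move=> i ib; apply/dim0P => x; apply: bc_in_inj; rewrite linear0 -bc_inP.
  apply: (@bigp_ext _ _ _ (tot P) (tot Q)) => a b; rewrite [LHS]bigp_tgp linear0.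
  case: eqP => // abi.
  have gp0 (C : falgType K) (X : bcomplex C) (m : model X) k :
      \dim {:X k} = 0%N -> gp m k = 0.
    move=> /dim0P X0; apply/lfunP => v.
    by rewrite -mqK (X0 (mq m k v)) linear0 zero_lfunE.
  have [ab|ab] := boolP ((a < - n1%:Z) || (0 < a)); rewrite /bigp /tmod_map.
    by rewrite gp0 ?vmap0l ?zero_lfunE // P0.
  by rewrite [gp (tot Q) b]gp0 ?vmap0r ?zero_lfunE // Q0 //; lia.
by apply: qis_trans (ctens_stalk _ _); apply: ctens_qis.
Qed.

End TensorDimension.

(** * Global dimension of the tensor product *)

Section Radical.

Variables (K : fieldType) (A : falgType K).

(** Minimal left ideals are added to [C] one at a time, omitting those contained in
    [L + C]; by minimality the others meet [L + C] trivially. *)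
Lemma semisimple_complement (L : {vspace A}) :
  semisimple_alg A -> left_ideal L ->
  exists C : {vspace A}, [/\ left_ideal C, (L + C)%VS = {:A}%VS & (L :&: C)%VS = 0%VS].
Proof.
move=> [r [I [minI sumI _]]] idL.
have idD (U V : {vspace A}) : left_ideal U -> left_ideal V -> left_ideal (U + V)%VS.
  move=> idU idV a _ /memv_addP[u uU [v vV ->]].
  by rewrite mulrDr memv_add // ?idU ?idV.
suff [C [idC LC0 sC]] : exists C : {vspace A},
    [/\ left_ideal C, (L :&: C)%VS = 0%VS & forall i, i \in enum 'I_r -> (I i <= L + C)%VS].
  exists C; split=> //; apply/eqP; rewrite eqEsubv subvf -sumI.
  by apply/subv_sumP => i _; apply: sC; rewrite mem_enum.
elim: (enum 'I_r) => [|j s [C [idC LC0 sC]]].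
  by exists 0%VS; split=> // [a x|]; rewrite ?capv0 // !memv0 => /eqP->; rewrite mulr0.
have [idI _ Imin] := minI j.
have idcap : left_ideal (I j :&: (L + C))%VS.
  move=> a x; rewrite !memv_cap => /andP[xI xLC].
  by rewrite idI //= (idD _ _ idL idC).
have [I0|IL] := Imin _ idcap (capvSl _ _); last first.
  exists C; split=> // i; rewrite inE => /orP[/eqP->|/sC //].
  by rewrite -IL capvSr.
exists (C + I j)%VS; split; first exact: idD.
  apply/eqP; rewrite -subv0; apply/subvP => x; rewrite memv_cap => /andP[xL].
  case/memv_addP => c cC [l lI xcl].
  have l0 : l \in (0%VS : {vspace A}).
    rewrite -I0 memv_cap lI /=; have -> : l = x - c by rewrite xcl addrC addKr.
    by apply: memv_add; rewrite ?memvN.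
  rewrite memv0 in l0; rewrite -LC0 memv_cap xL /=.
  by rewrite xcl (eqP l0) addr0.
move=> i; rewrite inE => /orP[/eqP->|/sC iLC].
  by rewrite addvA addvSr.
by apply: subv_trans iLC _; rewrite addvA addvSl.
Qed.

(** An element of a simple module is annihilated by a maximal left ideal, hence
    by the radical. *)
Lemma jacobson_socle (N : fdmod A) (U : {vspace N}) :
  stable U -> U <> 0%VS ->
  exists x, [/\ x \in U, x != 0 & forall j, j \in jacobson A -> fdact N j x = 0].
Proof.
move=> sU U0.
(* W is a nonzero stable subspace of least dimension: a simple module. *)
pose Q (d : nat) := boolp.asbool (exists W : {vspace N},
  [/\ stable W, W <> 0%VS, (W <= U)%VS & \dim W = d]).
have exQ : exists d, Q d by exists (\dim U); apply/boolp.asboolP; exists U.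
case: (ex_minnP exQ) => d /boolp.asboolP[W [sW W0 WU Wd]] dmin.
have [x xW x0] : exists2 x, x \in W & x != 0.
  by exists (vpick W); rewrite ?memv_pick // vpick0; apply/eqP.
exists x; split=> // [|j /jacobson_spaceP]; first exact: (subvP WU).
have lev : linear (fun a : A => fdact N a x).
  by move=> k a b; rewrite linearP add_lfunE scale_lfunE.
pose ev : 'Hom(A, N) := lin_of lev.
have evE a : ev a = fdact N a x by rewrite lin_ofE.
have memk a : (a \in lker ev) = (fdact N a x == 0) by rewrite memv_ker evE.
suff mk : max_left_ideal (lker ev) by move/(_ _ mk); rewrite memk => /eqP.
split.
- by move=> a b; rewrite !memk fdactM => /eqP->; rewrite linear0.
- by move=> kT; have := memvf (1 : A); rewrite -kT memk fdact1 (negbTE x0).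
move=> L idL kL.
have sev : stable (ev @: L)%VS.
  move=> a _ /memv_imgP[b bL ->]; rewrite evE -fdactM -evE.
  by apply: memv_img; apply: idL.
have evW : (ev @: L <= W)%VS.
  by apply/subvP => _ /memv_imgP[b _ ->]; rewrite evE sW.
have [ev0|ev0] := eqVneq (ev @: L)%VS 0%VS.
  left; apply/eqP; rewrite eqEsubv kL andbT; apply/subvP => b bL.
  by rewrite memv_ker -memv0 -ev0 memv_img.
right; apply: left_ideal_full => //.
have evLW : (ev @: L)%VS = W.
  apply/eqP; rewrite eqEdim evW Wd; apply: dmin; apply/boolp.asboolP.
  by exists (ev @: L)%VS; split=> //; [apply/eqP | apply: subv_trans evW WU].
move: xW; rewrite -evLW => /memv_imgP[b bL xb].
rewrite -(subrK b 1); apply: memvD => //; apply: (subvP kL).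
by rewrite memv_ker linearB /= -xb evE fdact1 subrr.
Qed.

Section QuotientModule.
Variable I : tsideal A.

Let act (a : A) (x : quo I) : quo I := quo_pi I a * x.

Fact quomod_linear a : linear (act a).
Proof. by move=> k x y; rewrite /act mulrDr scalerAr. Qed.
Fact quomod_linearl x : linear (act^~ x).
Proof. by move=> k a b; rewrite /act linearP mulrDl scalerAl. Qed.
Fact quomod_1 x : act 1 x = x.
Proof. by rewrite /act rmorph1 mul1r. Qed.
Fact quomod_M a b x : act (a * b) x = act a (act b x).
Proof. by rewrite /act rmorphM mulrA. Qed.

Definition quomod : fdmod A := mkmod quomod_linear quomod_linearl quomod_1 quomod_M.

Lemma quomodE a (x : quomod) : fdact quomod a x = quo_pi I a * (x : quo I).
Proof. exact: mkmodE. Qed.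

End QuotientModule.

End Radical.

Section TensorTop.

Variables (K : fieldType) (A B : falgType K).
Notation AB := (tens A B).
Let JA := jacobson A.
Let JB := jacobson B.
Let S : fdmod AB := tmod (quomod JA) (quomod JB).
Let Q := tens (quo JA) (quo JB).

Section Socle.
Variable M : fdmod AB.

Let actl a x := fdact M (pure a 1) x.

Fact resl_linear a : linear (actl a).
Proof. exact: linearP. Qed.
Fact resl_linearl x : linear (actl^~ x).
Proof. by move=> k a b; rewrite /actl pure_linearl linearP add_lfunE scale_lfunE. Qed.
Fact resl_1 x : actl 1 x = x.
Proof. by rewrite /actl pure1 fdact1. Qed.
Fact resl_M a b x : actl (a * b) x = actl a (actl b x).
Proof. by rewrite /actl -fdactM pureM mulr1. Qed.

Definition resl : fdmod A := mkmod resl_linear resl_linearl resl_1 resl_M.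

Let actr b x := fdact M (pure 1 b) x.

Fact resr_linear b : linear (actr b).
Proof. exact: linearP. Qed.
Fact resr_linearl x : linear (actr^~ x).
Proof. by move=> k a b; rewrite /actr pure_linearr linearP add_lfunE scale_lfunE. Qed.
Fact resr_1 x : actr 1 x = x.
Proof. by rewrite /actr pure1 fdact1. Qed.
Fact resr_M a b x : actr (a * b) x = actr a (actr b x).
Proof. by rewrite /actr -fdactM pureM mulr1. Qed.

Definition resr : fdmod B := mkmod resr_linear resr_linearl resr_1 resr_M.

(** The elements annihilated by the radical of [A] form a nonzero subspace, stable
    under [B] since the two actions commute; the radical of [B] annihilates a
    nonzero element of it. *)
Lemma tens_socle : (exists y : M, y != 0) ->
  exists x : M, [/\ x != 0, forall j b, j \in JA -> fdact M (pure j b) x = 0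
    & forall a j, j \in JB -> fdact M (pure a j) x = 0].
Proof.
move=> [y y0].
pose e (i : 'I_(\dim JA)) : A := (vbasis JA)`_i.
pose U : {vspace M} := (\bigcap_(i < \dim JA) lker (fdact M (pure (e i) 1%R)))%VS.
have memU x : x \in U <-> forall j, j \in JA -> fdact M (pure j 1) x = 0.
  split=> [xU j jJ | x0].
    rewrite (coord_vbasis jJ) -[fdact M _ x]/(actl _ x).
    pose al := lin_of (resl_linearl x); rewrite -(lin_ofE (resl_linearl x)) linear_sum.
    rewrite big1 // => i _; rewrite linearZ /= lin_ofE.
    have := xU; rewrite memvE => /subv_bigcapP/(_ i isT).
    by rewrite -memvE memv_ker => /eqP xi; rewrite /actl xi scaler0.
  rewrite memvE; apply/subv_bigcapP => i _; rewrite -memvE memv_ker x0 //.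
  by rewrite vbasis_mem // mem_nth // size_tuple.
have resrE b x : fdact resr b x = fdact M (pure 1 b) x by exact: mkmodE.
have reslE a x : fdact resl a x = fdact M (pure a 1) x by exact: mkmodE.
have comm a b x : fdact M (pure a 1) (fdact M (pure 1 b) x) = fdact M (pure a b) x.
  by rewrite -fdactM pureM mulr1 mul1r.
have comm' a b x : fdact M (pure 1 b) (fdact M (pure a 1) x) = fdact M (pure a b) x.
  by rewrite -fdactM pureM mulr1 mul1r.
have sU : @stable K B resr U.
  move=> b x /memU x0; apply/memU => j jJ.
  by rewrite resrE comm -comm' x0 // linear0.
have U0 : U <> 0%VS.
  have [||x [_ x0 xJ]] := @jacobson_socle K A resl fullv.
  - by move=> a x _; rewrite memvf.
  - move=> f0; have := memvf (y : resl); rewrite f0 memv0 => /eqP y00.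
    by move/eqP: y0; apply.
  move=> U0; have : (x : M) \in U by apply/memU => j jJ; rewrite -reslE xJ.
  by rewrite U0 memv0; apply/negP.
have [x [xU x0 xJ]] := jacobson_socle sU U0.
exists x; split=> // [j b jJ | a j jJ].
  by rewrite -comm' (memU x).1 // linear0.
by rewrite -comm -resrE xJ // linear0.
Qed.

(** If [x] is annihilated by both radicals, then the action on [x] factors through
    the quotients by the radicals, that is through the top [S]. *)
Lemma top_map : (exists y : M, y != 0) ->
  exists f : 'Hom(S, M), alinear f /\ limg f <> 0%VS.
Proof.
move=> /tens_socle[x [x0 xA xB]].
pose h (p : quomod JA) (q : quomod JB) : M :=
  fdact M (pure (quo_repr (p : quo JA)) (quo_repr (q : quo JB))) x.
have hl q : linear (h^~ q).
  move=> k p p'; rewrite /h [quo_repr (_ + _)]linearP pure_linearl.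
  by rewrite linearP add_lfunE scale_lfunE.
have hr p : linear (h p).
  move=> k q q'; rewrite /h [quo_repr (_ + _)]linearP pure_linearr.
  by rewrite linearP add_lfunE scale_lfunE.
pose f : 'Hom(S, M) := vtens_lift h.
have fE p q : f (vpure p q) = h p q by rewrite /f vtens_liftE.
(* quo_repr is not multiplicative, but its failure lies in the radicals. *)
have xeq u u' v v' : u - u' \in JA -> v - v' \in JB ->
    fdact M (pure u v) x = fdact M (pure u' v') x.
  move=> uJ vJ; apply/eqP; rewrite -subr_eq0 -opp_lfunE -add_lfunE -linearB /=.
  have -> : pure u v - pure u' v' = pure (u - u') v + pure u' (v - v').
    rewrite -[pure (u - u') v]/(vpure (u - u') v) vpureBl.
    rewrite -[pure u' (v - v')]/(vpure u' (v - v')) vpureBr.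
    by rewrite addrA subrK.
  by rewrite linearD add_lfunE xA // xB // addr0.
exists f; split.
  apply: tmod_alinear => a b p q; rewrite !fE !quomodE /h -fdactM pureM.
  apply: xeq; rewrite -quo_pi_eq quo_reprK rmorphM /= quo_reprK //.
move=> f0; have : f (vpure (quo_pi JA 1 : quomod JA) (quo_pi JB 1 : quomod JB)) \in limg f.
  by rewrite memv_img ?memvf.
have x1 : fdact M (pure 1 1) x = x by rewrite pure1 fdact1.
rewrite f0 memv0 fE /h (xeq _ 1 _ 1) ?x1 ?(negbTE x0) //;
  by rewrite -quo_pi_eq quo_reprK.
Qed.

End Socle.

Hypothesis ssQ : semisimple_alg Q.

(** The kernel of [f] is a left ideal of the semisimple algebra [Q], hence has a
    complement, on which [f] is injective. *)
Lemma top_image_retract (M : fdmod AB) (f : 'Hom(S, M)) (fA : alinear f) :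
  retract (submod (stable_limg fA)) S.
Proof.
have lt : linear (fun t : S => t : Q) by [].
pose th : 'Hom(S, Q) := lin_of lt.
have lt' : linear (fun t : Q => t : S) by [].
pose th' : 'Hom(Q, S) := lin_of lt'.
have thK : cancel th th' by move=> x; rewrite !lin_ofE.
have thK' : cancel th' th by move=> x; rewrite !lin_ofE.
have thM a b s : th (fdact S (pure a b) s) = pure (quo_pi JA a) (quo_pi JB b) * th s.
  rewrite (lin_ofE lt) (lin_ofE lt); move: s; apply: (@vtens_ext _ (quomod JA) (quomod JB)).
  - exact: linearP.
  - by move=> k x y; rewrite mulrDr scalerAr.
  move=> x y; rewrite tmod_act !quomodE; exact/esym/pureM.
pose L : {vspace Q} := (th @: lker f)%VS.
have memL s : (th s \in L) = (f s == 0).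
  rewrite -memv_ker; apply/memv_imgP/idP => [[s' s'k /(can_inj thK)->] // | sk].
  by exists s.
have idL : left_ideal L.
  move=> q _ /memv_imgP[s sk ->]; move: q.
  apply: (@vtens_ind K (quo JA) (quo JB) (fun q => (q : Q) * th s \in L)).
  - by rewrite mul0r mem0v.
  - by move=> k q q' qL q'L; rewrite mulrDl -scalerAl memvD // memvZ.
  move=> x y; rewrite -(quo_reprK x) -(quo_reprK y) -[vpure _ _]/(pure _ _) -thM memL fA.
  by move: sk; rewrite memv_ker => /eqP->; rewrite linear0.
have [C [idC LC LC0]] := semisimple_complement ssQ idL.
have CL0 : (C :&: L)%VS = 0%VS by rewrite capvC.
pose pr : 'End(Q) := daddv_pi C L.
have prC q : pr q \in C by exact: memv_pi.
have prL q : q - pr q \in L.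
  have qCL : q \in (C + L)%VS by rewrite addvC LC memvf.
  by rewrite -{1}(daddv_pi_add CL0 qCL) addrC addKr memv_pi.
have pr_id q : q \in C -> pr q = q by exact: daddv_pi_id.
have pr0 q : q \in L -> pr q = 0.
  move=> qL; apply/eqP; rewrite -memv0 -CL0 memv_cap prC /=.
  by have := memvB qL (prL q); rewrite opprB addrC subrK.
have prM q z : pr (q * z) = q * pr z.
  rewrite -[in LHS](subrK (pr z) z) mulrDr linearD /= (pr0 (q * (z - pr z))).
    by rewrite add0r pr_id //; apply: idC.
  exact: idL.
clearbody pr.
pose U := submod (stable_limg fA).
pose w (u : U) : S := f^-1%VF (sincl (stable_limg fA) u).
have fw u : f (w u) = sincl (stable_limg fA) u by rewrite limg_lfunVK ?sincl_mem.
have li : linear (fun u : U => th' (pr (th (w u)))).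
  by move=> k u v; rewrite /w !linearP.
have fpr s : f (th' (pr (th s))) = f s.
  apply/eqP; rewrite eq_sym -subr_eq0 -linearB -memL linearB /= thK'; exact: prL.
exists (lin_of li), (sproj (stable_limg fA) \o f)%VF; split.
- apply: tens_alinear => a b u; rewrite !(lin_ofE li); apply: (can_inj thK).
  rewrite thK' thM thK' -prM -thM; apply/eqP; rewrite -subr_eq0 -!linearB /= pr0 //.
  rewrite memL linearB /= fA !fw sincl_alinear subrr //.
- by move=> a s; rewrite !comp_lfunE fA sproj_act // memv_img ?memvf.
move=> u; apply: sincl_inj; rewrite comp_lfunE sprojK ?memv_img ?memvf //.
by rewrite lin_ofE fpr fw.
Qed.

(** Induction on the dimension of [M]: a nonzero [M] contains the nonzero image of
    a map from the top [S], which is a retract of [S], and [omega] turns the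
    sequence with the quotient by this image into a split one. *)
Lemma omega_top_projective n : projective (iter n (@omega K AB) S) ->
  forall M : fdmod AB, projective (iter n (@omega K AB) M).
Proof.
move=> prS M; have [d] := ubnP (\dim {:M}); elim: d M => // d IHd M Md.
have [M0 | M0] := boolp.pselect (forall y : M, y = 0).
  apply: retract_projective prS; apply: retract_iter_omega; exists 0, 0.
  by split; try exact: alinear0; move=> y; rewrite !zero_lfunE [RHS]M0.
have {M0} M0 : exists y : M, y != 0.
  by apply: boolp.contrapT => ny; apply: M0 => y; apply/eqP; apply: boolp.contrapT => y0;
    apply: ny; exists y; apply/negP.
have [f [fA f0]] := top_map M0.
have sU := stable_limg fA.
have sesU : ses (submod (stable_limg fA)) M (qmod (stable_limg fA)).
  exists (sincl _), (qpi (stable_limg fA)); split.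
  - by split; [apply: sincl_alinear | apply: qpi_alinear].
  - exact: sincl_inj.
  - by apply/surj_limg; apply: qpi_surj.
  - by move=> x; apply/eqP; rewrite -memv_ker qpi_ker sincl_mem.
  move=> y /eqP; rewrite -memv_ker qpi_ker => yU.
  by exists (sproj _ y); rewrite sprojK.
apply: (ses_projective (ses_iter_omega n sesU)).
  by apply: retract_projective prS; apply: retract_iter_omega; apply: top_image_retract.
apply: IHd; have := limg_ker_dim (qpi (stable_limg fA)) fullv.
rewrite qpi_surj capfv qpi_ker => dimM; move: Md; rewrite -dimM ltnS.
apply: leq_trans; rewrite -[X in (X < _)%N]add0n ltn_add2r lt0n dimv_eq0.
exact/eqP.
Qed.

Lemma gldim_le_tens n1 n2 :
  (1 <= n1)%N -> gldim_le A n1 -> gldim_le B n2 -> gldim_le AB (n1 + n2).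
Proof.
case: n1 => // n1 _ glA glB M; apply: projective_projdim_le.
apply: omega_top_projective; apply: projdim_le_projective.
exact: (projdim_le_tmod (glA _) (glB _)).
Qed.

End TensorTop.

Local Close Scope ring_scope.

Theorem theorem2p10 (K : fieldType) (n1 n2 : nat) (A1 A2 : falgType K) :
  (1 <= n1)%N -> (1 <= n2)%N ->
  rep_infinite A1 n1 -> rep_infinite A2 n2 ->
  semisimple_alg (tens (quo (jacobson A1)) (quo (jacobson A2))) ->
  rep_infinite (tens A1 A2) (n1 + n2).
Proof.
move=> n1_gt0 _ [gl1 X1] [gl2 X2] ss; split; first exact: gldim_le_tens.
move=> i; have [X SX eX] := X1 i; have [Y SY eY] := X2 i.
by exists (ctens X Y); [apply: is_nu_n_invpow_ctens | apply: ctens_exact].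
Qed.
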